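(* Let $0<\alpha<2$ and let $X=\{X(t):t\in\mathbb{R}\}$ be a stationary real harmonizable symmetric $\alpha$-stable process with finite control measure $m$, where $m$ is absolutely continuous with respect to Lebesgue measure on $\mathbb{R}$, with symmetric density $f$ and $m(\mathbb{R})=1$. Let $X$ be given by its series representation $X(t)=\sum_{k=1}^\infty R_k\cos(\Theta_k+tZ_k)$ (notation in the context). Let $J_0(s)=\frac1{2\pi}\int_{-\pi}^{\pi}e^{is\cos(u)}du$. (1) Let $h:\mathbb{R}\to\mathbb{R}$ be an integrable function with integrable Fourier transform $\mathcal{F}h$ such that $h(x)=\int_{\mathbb{R}}\mathcal{F}h(y)e^{ixy}dy$. Then $$\lim_{T\to\infty}\frac1T\int_0^Th(X(\tau))d\tau=\int_{\mathbb{R}}\mathcal{F}h(y)\left(\prod_{k=1}^\infty J_0(yR_k)\right)dy\quad\text{almost surely}.$$ (2) If instead $h:\mathbb{R}\to\mathbb{R}$ is $p$-periodic ($p>0$) with absolutely convergent Fourier series $h(x)=\sum_{n\in\mathbb{Z}}c_ne^{i\frac{2\pi}{p}nx}$, then $$\lim_{T\to\infty}\frac1T\int_0^Th(X(\tau))d\tau=\sum_{n\in\mathbb{Z}}c_n\prod_{k=1}^\infty J_0\left(n\tfrac{2\pi}{p}R_k\right)\quad\text{almost surely}.$$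
   Context: Stationary real harmonizable symmetric $\alpha$-stable (SRH $S\alpha S$) process: $X(t)=\mathrm{Re}\left(\int_{\mathbb{R}}e^{itx}M(dx)\right)$, $t\in\mathbb{R}$, where $M$ is an isotropic complex $S\alpha S$ random measure on $\mathbb{R}$ with finite control measure $m$, i.e. $M$ is independently scattered, $\sigma$-additive, complex-valued, and for every Borel $A$ the vector $(\mathrm{Re}\,M(A),\mathrm{Im}\,M(A))$ has characteristic function $s\mapsto\exp\{-m(A)\int_{S^1}|(\theta,s)|^\alpha\gamma(d\theta)\}$ with $\gamma$ the uniform probability measure on the unit circle $S^1$. Equivalently, the finite-dimensional characteristic functions of $X$ are $\mathbb{E}\exp\{i\sum_j s_jX(t_j)\}=\exp\{-\lambda_\alpha\int_{\mathbb{R}}|\sum_{j,k}s_js_k\cos((t_k-t_j)x)|^{\alpha/2}m(dx)\}$, $\lambda_\alpha=\frac1{2\pi}\int_0^{2\pi}|\cos x|^\alpha dx$. Series representation: $X(t)=\sum_{k=1}^\infty R_k\cos(\Theta_k+tZ_k)$, where $\{\Gamma_k\}_{k\ge1}$ are the arrival times of a unit rate Poisson process, $\{G_k^{(1)}\}_{k\ge1},\{G_k^{(2)}\}_{k\ge1}$ are sequences of i.i.d. standard normal random variables, $\{Z_k\}_{k\ge1}$ are i.i.d. with law $m$ (density $f$), $\{\Theta_k\}_{k\ge1}$ are i.i.d. uniform on $(0,2\pi)$, all these sequences are mutually independent, and $$R_k=(C_\alpha b_\alpha^{-1}m(\mathbb{R}))^{1/\alpha}\Gamma_k^{-1/\alpha}\sqrt{(G_k^{(1)})^2+(G_k^{(2)})^2},$$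 $b_\alpha=2^{\alpha/2}\Gamma(1+\alpha/2)$, $C_\alpha=\left(\int_0^\infty x^{-\alpha}\sin(x)dx\right)^{-1}$. A measurable version of $X$ is used, so that the time integrals are defined. *)

(* Defs.v *)
From HB Require Import structures.
From mathcomp Require Import all_boot all_order all_algebra.
From mathcomp Require Import finmap complex.
From mathcomp Require Import all_classical all_reals all_analysis.
Set Implicit Arguments.
Unset Strict Implicit.
Unset Printing Implicit Defensive.
Import Order.TTheory GRing.Theory Num.Theory.
Import numFieldTopology.Exports numFieldNormedType.Exports.
Import HBSimple.
Local Open Scope classical_set_scope.
Local Open Scope ring_scope.
Local Open Scope complex_scope.

Section complex_analysis.
Context {R : realType}.

Definition cexpi (x : R) : R[i] := cos x +i* sin x.

(* Limits and integrals of complex-valued functions are taken componentwise. *)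
Definition Clim (u : nat -> R[i]) : R[i] :=
  limn (fun n => complex.Re (u n)) +i* limn (fun n => complex.Im (u n)).

Definition Cint d (T : measurableType d) (mu : {measure set T -> \bar R})
    (D : set T) (g : T -> R[i]) : R[i] :=
  Rintegral mu D (fun x => complex.Re (g x))
    +i* Rintegral mu D (fun x => complex.Im (g x)).

Definition Cintegrable d (T : measurableType d)
    (mu : {measure set T -> \bar R}) (D : set T) (g : T -> R[i]) : Prop :=
  mu.-integrable D (fun x => (complex.Re (g x))%:E) /\
  mu.-integrable D (fun x => (complex.Im (g x))%:E).

Definition Cprod (u : nat -> R[i]) : R[i] :=
  Clim (fun n => \prod_(0 <= k < n) u k).

(* Sum over the integers as the limit of the sums over -n <= j <= n; only used
   for absolutely summable families. *)
Definition Zsum (u : int -> R[i]) : R[i] :=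
  Clim (fun n => \sum_(0 <= k < n.*2.+1) u (k%:Z - n%:Z)).

Definition J0 (s : R) : R[i] :=
  ((2 * pi)^-1)%:C *
  Cint lebesgue_measure `[- pi, pi] (fun u : R => cexpi (s * cos u)).

(* The normalization 1/(2 pi) is the one for which the inversion formula reads
   h x = \int Fourier h y * e^{ixy} dy. *)
Definition Fourier (h : R -> R) (y : R) : R[i] :=
  ((2 * pi)^-1)%:C *
  Cint lebesgue_measure setT (fun x : R => (h x)%:C * cexpi (- (x * y))).

End complex_analysis.

Section independence.
Context {R : realType} d {Omega : measurableType d} (P : probability Omega R).

Definition independent_systems (I : choiceType) (F : I -> set (set Omega)) :=
  forall (J : {fset I}) (E : I -> set Omega),
    (forall i, i \in J -> F i (E i)) ->
    P (\bigcap_(i in [set` J]) E i) = (\prod_(i <- J) fine (P (E i)))%:E.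

Definition sigma_RV d' (T : measurableType d') (Y : Omega -> T) :
    set (set Omega) :=
  preimage_set_system setT Y measurable.

Definition sigma_seq (Y : nat -> Omega -> R) : set (set Omega) :=
  <<s \bigcup_n sigma_RV (Y n) >>.

Definition iid (Y : nat -> Omega -> R) (mu : set R -> \bar R) : Prop :=
  independent_systems (fun n => sigma_RV (Y n)) /\
  forall n (A : set R), measurable A -> P (Y n @^-1` A) = mu A.

(* The arrival times of a unit rate Poisson process are the partial sums of
   i.i.d. unit exponential waiting times; index k stands for the (k+1)-st
   arrival. *)
Definition unit_poisson_arrivals (Gam : nat -> Omega -> R) : Prop :=
  iid (fun k w => Gam k w - (if k is j.+1 then Gam j w else 0))
      (exponential_prob 1).

End independence.

Section harmonizable.
Context {R : realType} d {Omega : measurableType d} (P : probability Omega R).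
Variables (alpha : R) (m : {measure set (measurableTypeR R) -> \bar R}).

(* \int_{S^1} |(theta, s)|^alpha gamma(dtheta), gamma uniform on S^1 *)
Definition circle_integral (s1 s2 : R) : R :=
  (2 * pi)^-1 * Rintegral lebesgue_measure `[0, 2 * pi]
    (fun phi : R => `|s1 * cos phi + s2 * sin phi| `^ alpha).

Record isotropic_SaS_random_measure (M : set R -> Omega -> R[i]) : Prop := {
  isSaS_measurable : forall A : set R, measurable A ->
    measurable_fun setT (fun w => complex.Re (M A w)) /\
    measurable_fun setT (fun w => complex.Im (M A w)) ;
  isSaS_scattered : forall n (A : 'I_n -> set R),
    (forall i, measurable (A i)) -> trivIset setT A ->
    independent_systems P (fun i =>
      sigma_RV (fun w => (complex.Re (M (A i) w), complex.Im (M (A i) w)))) ;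
  isSaS_sigma_additive : forall A : nat -> set R,
    (forall i, measurable (A i)) -> trivIset setT A ->
    {ae P, forall w,
      (series (fun i => complex.Re (M (A i) w)) @ \oo
         --> complex.Re (M (\bigcup_i A i) w)) /\
      (series (fun i => complex.Im (M (A i) w)) @ \oo
         --> complex.Im (M (\bigcup_i A i) w))} ;
  isSaS_charfun : forall (A : set R) (s1 s2 : R), measurable A ->
    Cint P setT
      (fun w => cexpi (s1 * complex.Re (M A w) + s2 * complex.Im (M A w)))
    = (expR (- (fine (m A) * circle_integral s1 s2)))%:C
}.

Definition simple_integral (M : set R -> Omega -> R[i])
    (u : {sfun measurableTypeR R >-> R}) (w : Omega) : R[i] :=
  \sum_(r \in range u) r%:C * M (u @^-1` [set r]) w.

(* Y is (a version of) \int phi dM: the limit in probability of the integrals of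
   complex simple functions u_n + i v_n approximating phi in L^alpha(m). *)
Definition is_stable_integral (M : set R -> Omega -> R[i])
    (phi : R -> R[i]) (Y : Omega -> R[i]) : Prop :=
  [/\ measurable_fun setT (fun w => complex.Re (Y w)),
      measurable_fun setT (fun w => complex.Im (Y w)) &
      exists u v : nat -> {sfun measurableTypeR R >-> R},
        ((\int[m]_x
            ((ComplexField.Normc.normc (phi x - (u n x +i* v n x))) `^ alpha)%:E)%E
           @[n --> \oo] --> 0%E) /\
        forall e : R, 0 < e ->
          P [set w | e <= ComplexField.Normc.normc
               (simple_integral M (u n) w + 'i * simple_integral M (v n) w
                - Y w)]
            @[n --> \oo] --> 0%E].

Definition SRH_SaS (X : R -> Omega -> R) : Prop :=
  exists2 M : set R -> Omega -> R[i], isotropic_SaS_random_measure M &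
    forall t : R, exists2 Y : Omega -> R[i],
      is_stable_integral M (fun x => cexpi (t * x)) Y &
      {ae P, forall w, X t w = complex.Re (Y w)}.

End harmonizable.

Section series_representation.
Context {R : realType}.

Definition Gamma_fun (a : R) : R :=
  Rintegral lebesgue_measure `]0, +oo[ (fun x : R => x `^ (a - 1) * expR (- x)).

Definition b_const (alpha : R) : R :=
  2 `^ (alpha / 2) * Gamma_fun (1 + alpha / 2).

(* For alpha <= 1 the integral over the half-line is only conditionally
   convergent, hence the improper integral. *)
Definition C_const (alpha : R) : R :=
  (lim (Rintegral lebesgue_measure `]0, b] (fun x : R => x `^ (- alpha) * sin x)
        @[b --> +oo]))^-1.

(* index k stands for the (k+1)-st term *)
Definition amplitude (Omega : Type) (alpha mass : R)
    (Gam G1 G2 : nat -> Omega -> R) (k : nat) (w : Omega) : R :=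
  (C_const alpha * (b_const alpha)^-1 * mass) `^ (alpha^-1)
  * (Gam k w) `^ (- alpha^-1)
  * Num.sqrt (G1 k w ^+ 2 + G2 k w ^+ 2).

Lemma two_pi_gt0 : (0 : R) < 2 * pi.
Proof. by rewrite mulr_gt0// pi_gt0. Qed.

Definition series_data d (Omega : measurableType d) (P : probability Omega R)
    (m : set R -> \bar R) (Gam G1 G2 Z Th : nat -> Omega -> R) : Prop :=
  [/\ unit_poisson_arrivals P Gam,
      iid P G1 (normal_prob 0 1) /\ iid P G2 (normal_prob 0 1),
      iid P Z m,
      iid P Th (uniform_prob two_pi_gt0) &
      independent_systems P
        (fun i : 'I_5 => sigma_seq (tnth [tuple Gam; G1; G2; Z; Th] i))].

End series_representation.

(* Main.v *)
Require Import Defs.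
From HB Require Import structures.
From mathcomp Require Import all_boot all_order all_algebra.
From mathcomp Require Import finmap complex.
From mathcomp Require Import all_classical all_reals all_analysis.
From mathcomp Require Import measurable_realfun.
From mathcomp Require Import ring lra zify.
Import Order.TTheory GRing.Theory Num.Theory.
Import numFieldTopology.Exports numFieldNormedType.Exports.
Local Open Scope classical_set_scope.
Local Open Scope ring_scope.
Local Open Scope complex_scope.
Set Implicit Arguments.
Unset Strict Implicit.
Unset Printing Implicit Defensive.

(** Along a path, the process is an infinite sum of oscillators
[R_k cos (Th_k + t Z_k)]. Almost surely its frequencies [Z_k] are rationally
independent, because their law has no atoms ([rationally_independent]), and its
amplitudes are square summable, because the arrival times grow linearly and
[alpha < 2] ([amplitude_square_summable]).

For the sum [Y_n] of the first [n] oscillators, rational independence forces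
the phases to equidistribute on the torus as time goes by (Kronecker and Weyl).
The time mean of [cos (phi + y Y_n)] therefore factors into averages over
circles, each of which is a Bessel function: it equals
[cos phi * \prod_(k < n) J_0 (y R_k)] ([time_mean_oscillators]).

The main point is to replace [Y_n] by the whole sum [X]. For this it suffices
that for almost every outcome there are arbitrarily large [n] for which the
mean of [(X - Y_n)^2] over [[0, T]] is small uniformly in [T]
([time_mean_path]). For fixed [T] the expectation of this mean is controlled by
the tail of the squared amplitudes, since oscillators with independent uniform
phases are orthogonal ([second_moment]). Uniformity in [T] comes from a maximal
inequality: given amplitudes and frequencies, the uniform phases make [X - Y_n]
stationary ([excess_stationary]), so the Hardy-Littlewood covering argument
bounds the probability that some mean exceeds [lam] by a multiple of the tail
divided by [lam] ([excess_maximal_inequality], [tail_control]).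

Consequently, outside one null event, [cos (phi + y X)] has time mean
[cos phi * \prod_k J_0 (y R_k)] for all [phi] and [y] ([mean_cos_path]). The
rest is analysis along a fixed path. When [h] is a Fourier integral, Fubini and
dominated convergence move the time mean inside the integral
([time_mean_inversion]); when it is an absolutely convergent Fourier series,
uniform convergence does the same ([time_mean_fourier_series]). Real and
imaginary parts are treated separately, sines being shifted cosines; the
imaginary part of the limit vanishes because [h] is real. *)

(** * Independence and integration of one coordinate at a time *)

Section independence_integral.
Context {R : realType} d {Omega : measurableType d} (P : probability Omega R).

Definition indep_sys (A B : set (set Omega)) := forall E F, A E -> B F ->
  P (E `&` F) = (P E * P F)%E.

(** As functions of the first event, the two sides are finite measures that
agree on the pi-system [A]. *)
Lemma indep_sys_sigma (A B : set (set Omega)) : A `<=` measurable -> setI_closed A -> A setT ->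
  B `<=` measurable -> indep_sys A B -> indep_sys <<s A >> B.
Proof.
move=> mA IA AT mB iAB E F sE BF.
have mF := mB _ BF.
have PF : P F \is a fin_num by rewrite fin_num_measure.
have F0 : 0 <= fine (P F) by rewrite fine_ge0.
pose m1 : {measure set Omega -> \bar R} := mrestr P mF.
pose m2 : {measure set Omega -> \bar R} := mscale (NngNum F0) P.
suff -> : P (E `&` F) = m2 E by rewrite /m2/= /mscale/= fineK// muleC.
change (m1 E = m2 E).
apply: (@g_sigma_algebra_measure_unique _ _ _ A mA (fun=> setT)) => //.
- by apply/seteqP; split => // x _; exists 0%N.
- move=> X AX; rewrite /m1/= /mrestr iAB// /m2/= /mscale/= fineK//.
  by rewrite muleC.
- move=> k; rewrite /m1/= /mrestr setTI.
  by rewrite ltey_eq PF.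
Qed.

(** The sub-sigma-algebra [<<s A>>] is used as a measurable space of its own:
independence says that the pair of the identity and [Y] has a product law, and
Tonelli applies. *)
Lemma indep_integral (A : set (set Omega)) d' (T : measurableType d') (mu : probability T R)
    (Y : Omega -> T) (G : g_sigma_algebraType A * T -> \bar R) :
  <<s A >> `<=` measurable -> measurable_fun setT Y ->
  (forall B, measurable B -> P (Y @^-1` B) = mu B) ->
  (forall E B, <<s A >> E -> measurable B ->
     P (E `&` Y @^-1` B) = (P E * P (Y @^-1` B))%E) ->
  measurable_fun setT G -> (forall x, (0 <= G x)%E) ->
  (\int[P]_w G (w, Y w) = \int[P]_w \int[mu]_y G (w, y))%E.
Proof.
move=> sAm mY lY iY mG G0.
pose TA := g_sigma_algebraType A.
pose i : Omega -> TA := id.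
have mi : measurable_fun setT i.
  by move=> _ C mC; rewrite setTI; exact: sAm.
pose im : {mfun Omega >-> TA} := mfun_Sub (mem_set mi).
pose mu1 : probability TA R := distribution P im.
pose j (w : Omega) : TA * T := (i w, Y w).
have mj : measurable_fun setT j by apply/measurable_fun_pairP.
pose jm : {mfun Omega >-> (TA * T)%type} := mfun_Sub (mem_set mj).
pose mu2 : probability (TA * T)%type R := distribution P jm.
have mu12 (X : set (TA * T)) : measurable X -> (mu1 \x mu)%E X = mu2 X.
  apply: product_measure_unique => C B mC mB.
  rewrite [LHS](_ : _ = P (C `&` Y @^-1` B))// iY// lY//.
transitivity (\int[mu2]_x G x)%E.
  rewrite /mu2 /distribution ge0_integral_pushforward//.
transitivity (\int[mu1 \x mu]_x G x)%E.
  apply: eq_measure_integral => X mX _; exact/esym/mu12.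
rewrite fubini_tonelli1// [LHS](_ : _ =
  \int[pushforward P im]_x \int[mu]_y G (x, y))%E//.
rewrite ge0_integral_pushforward//.
- exact: measurable_fun_fubini_tonelli_F.
- by move=> y _; exact: integral_ge0.
Qed.

End independence_integral.

Section independent_sequence.
Context {R : realType} d {Omega : measurableType d} (P : probability Omega R).

Lemma adaptedP (AA : set (set Omega)) (u : Omega -> measurableTypeR R) :
  measurable_fun setT (u : g_sigma_algebraType AA -> measurableTypeR R) <->
  sigma_RV u `<=` <<s AA >>.
Proof.
split => [mu _ [B mB <-]|su _ B mB]; first exact: mu.
by apply: su; exists B.
Qed.

Lemma adapted_measurable (AA : set (set Omega)) (u : Omega -> measurableTypeR R) :
  AA `<=` measurable -> sigma_RV u `<=` <<s AA >> -> measurable_fun setT u.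
Proof.
move=> mAA su _ B mB.
have sub : <<s AA >> `<=` measurable.
  by apply: smallest_sub => //; exact: sigma_algebra_measurable.
by apply: sub; apply: su; exists B.
Qed.

Variables (AA : set (set Omega)) (Y : nat -> Omega -> measurableTypeR R).

(** A pi-system carrying the information of [AA] and of every coordinate but
the [k]-th; only finitely many coordinates are constrained, which is what
finite-dimensional independence controls. *)
Definition others (k : nat) : set (set Omega) :=
  [set C | exists A E, [/\ AA A, forall j, sigma_RV (Y j) (E j), E k = setT,
    exists n, forall j, (n <= j)%N -> E j = setT & C = A `&` \bigcap_j E j]].

Hypothesis mY : forall k, measurable_fun setT (Y k).
Hypothesis mAA : AA `<=` measurable.
Hypothesis IAA : setI_closed AA.
Hypothesis TAA : AA setT.

Lemma sigma_RV_measurable k : sigma_RV (Y k) `<=` measurable.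
Proof. by move=> _ [B mB <-]; exact: mY. Qed.

Lemma sigma_RVT k : sigma_RV (Y k) setT.
Proof. by exists setT => //; rewrite setTI preimage_setT. Qed.

Lemma sigma_RVI k : setI_closed (sigma_RV (Y k)).
Proof.
move=> _ _ [B mB <-] [C mC <-]; exists (B `&` C); first exact: measurableI.
by rewrite preimage_setI setIACA setIid.
Qed.

Lemma others_measurable k : others k `<=` measurable.
Proof.
move=> _ [A [E [AA_A sE _ _ ->]]]; apply: measurableI; first exact: mAA.
by apply: bigcapT_measurable => j; exact: (sigma_RV_measurable (sE j)).
Qed.

Lemma others_setI k : setI_closed (others k).
Proof.
move=> _ _ [A [E [AA_A sE Ek [n En] ->]]] [B [F [AA_B sF Fk [m Fm] ->]]].
exists (A `&` B), (fun j => E j `&` F j); split.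
- exact: IAA.
- by move=> j; exact: sigma_RVI.
- by rewrite /= Ek Fk setTI.
- exists (maxn n m) => j; rewrite geq_max => /andP[nj mj].
  by rewrite /= En// Fm// setTI.
- by rewrite bigcapI setIACA.
Qed.

Lemma others_setT k : others k setT.
Proof.
exists setT, (fun=> setT); split => //; first by move=> j; exact: sigma_RVT.
- by exists 0%N.
- by rewrite setTI; apply/seteqP; split.
Qed.

Lemma others_AA k : AA `<=` others k.
Proof.
move=> A AA_A; exists A, (fun=> setT); split => //.
- by move=> j; exact: sigma_RVT.
- by exists 0%N.
- by rewrite (_ : \bigcap_j _ = setT) ?setIT//; apply/seteqP; split.
Qed.

Lemma others_RV k j : j != k -> sigma_RV (Y j) `<=` others k.
Proof.
move=> jk A sA; exists setT, (fun i => if i == j then A else setT); split => //.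
- by move=> i; case: eqP => [->//|_]; exact: sigma_RVT.
- by rewrite eq_sym (negbTE jk).
- by exists j.+1 => i ji; rewrite gtn_eqF.
- rewrite setTI; apply/seteqP; split => [w Aw i _|w /(_ j Logic.I)].
    by case: eqP.
  by rewrite eqxx.
Qed.

Hypothesis iY : independent_systems P (fun n => sigma_RV (Y n)).
Hypothesis iAA : forall A B, AA A -> sigma_seq Y B -> P (A `&` B) = (P A * P B)%E.

Lemma sigma_seq_bigcap (J : {fset nat}) (E : nat -> set Omega) :
  (forall j, sigma_RV (Y j) (E j)) -> sigma_seq Y (\bigcap_(j in [set` J]) E j).
Proof.
move=> sE.
have fJ : finite_set [set` J] by exact: finite_fset.
have := @fin_bigcap_measurable _ (g_sigma_algebraType (\bigcup_n sigma_RV (Y n)))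
  _ [set` J] E fJ.
apply => i _; apply: sub_sigma_algebra; exists i => //; exact: sE.
Qed.

Lemma others_indep k : indep_sys P (others k) (sigma_RV (Y k)).
Proof.
move=> _ C [A [E [AA_A sE Ek [n En] ->]]] sC.
pose J : {fset nat} := [fset j in iota 0 (maxn n k.+1)]%fset.
have JP j : (j \in J) = (j < maxn n k.+1)%N by rewrite !inE/= mem_iota.
have kJ : k \in J by rewrite JP leq_max ltnSn orbT.
have capJ (F : nat -> set Omega) : (forall j, (n <= j)%N -> j != k -> F j = setT) ->
    \bigcap_j F j = \bigcap_(j in [set` J]) F j.
  move=> Fn; apply/seteqP; split => [w Fw j _|w Fw j _]; first exact: Fw.
  have [jJ|] := boolP (j \in J); first exact: Fw.
  rewrite JP -leqNgt geq_max => /andP[nj kj].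
  by rewrite Fn// gtn_eqF.
pose F j := if j == k then C else E j.
have sF j : sigma_RV (Y j) (F j) by rewrite /F; case: eqP => [->|].
have EC : \bigcap_j E j `&` C = \bigcap_j F j.
  apply/seteqP; split => [w [Ew Cw] j _|w Fw].
    by rewrite /F; case: eqP => // _; exact: Ew.
  split; last by have := Fw k Logic.I; rewrite /F eqxx.
  move=> j _; have [->|jk] := eqVneq j k; first by rewrite Ek.
  by have := Fw j Logic.I; rewrite /F (negbTE jk).
rewrite -setIA EC.
rewrite (capJ F); last by move=> j nj jk; rewrite /F (negbTE jk) En.
rewrite (capJ E); last by move=> j nj _; exact: En.
rewrite iAA//; last exact: sigma_seq_bigcap.
rewrite iAA//; last exact: sigma_seq_bigcap.
rewrite -muleA; congr (_ * _)%E.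
rewrite iY//; rewrite iY// !(big_fsetD1 k kJ)/= {1}/F eqxx Ek probability_setT/=.
rewrite mul1r muleC EFinM fineK ?fin_num_measure//.
  congr (_ * _%:E)%E; apply: eq_big_seq => j.
  by rewrite in_fsetD1 => /andP[jk _]; rewrite /F (negbTE jk).
exact: (sigma_RV_measurable sC).
Qed.

Lemma sigma_others_measurable k : <<s others k >> `<=` measurable.
Proof.
by apply: smallest_sub; [exact: sigma_algebra_measurable|exact: others_measurable].
Qed.

(** Conditioning on everything except [Y k]. All the probabilistic
computations below freeze the other variables in this way, because [G] may
depend on infinitely many of them. *)
Lemma integral_one_coordinate k (mu : probability (measurableTypeR R) R)
    (G : g_sigma_algebraType (others k) * measurableTypeR R -> \bar R) :
  (forall B, measurable B -> P (Y k @^-1` B) = mu B) ->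
  measurable_fun setT G -> (forall x, (0 <= G x)%E) ->
  (\int[P]_w G (w, Y k w) = \int[P]_w \int[mu]_y G (w, y))%E.
Proof.
move=> lY mG G0; apply: indep_integral => //.
- exact: sigma_others_measurable.
- move=> E B sE mB.
  have sB : sigma_RV (Y k) (Y k @^-1` B) by exists B => //; rewrite setTI.
  apply: (indep_sys_sigma _ _ _ _ (@others_indep k)) => //.
  + exact: others_measurable.
  + exact: others_setI.
  + exact: others_setT.
  + exact: sigma_RV_measurable.
Qed.

Lemma measurable_other k j : j != k ->
  measurable_fun setT (Y j : g_sigma_algebraType (others k) -> measurableTypeR R).
Proof.
move=> jk _ B mB; rewrite setTI; apply: sub_sigma_algebra.
by apply: (others_RV jk); exists B => //; rewrite setTI.
Qed.

Lemma measurable_sub k (u : Omega -> measurableTypeR R) :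
  sigma_RV u `<=` <<s AA >> ->
  measurable_fun setT (u : g_sigma_algebraType (others k) -> measurableTypeR R).
Proof.
move=> su B0 B mB; rewrite setTI.
have sub : <<s AA >> `<=` <<s others k >>.
  by apply: sub_sigma_algebra2; exact: others_AA.
apply: sub; apply: su; by exists B => //; rewrite setTI.
Qed.

End independent_sequence.

(** * Rational independence of the frequencies *)

Lemma measurable_zero_set (R : realType) d (T : measurableType d) (f : T -> R) :
  measurable_fun setT f -> measurable [set x | f x = 0].
Proof.
move=> mf; rewrite -[X in measurable X]setTI.
have := mf measurableT [set 0].
by apply; exact: measurable_set1.
Qed.

Section almost_sure_tools.
Context {R : realType} d {Omega : measurableType d} (P : probability Omega R).

Lemma borel_cantelli_series (F : nat -> set Omega) (u : nat -> R) :
  (forall k, measurable (F k)) -> (forall k, (P (F k) <= (u k)%:E)%E) ->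
  cvgn (series u) -> {ae P, forall w, \forall k \near \oo, ~ F k w}.
Proof.
move=> mF Fu cu.
have u0 k : 0 <= u k.
  by rewrite -lee_fin (le_trans _ (Fu k))// measure_ge0.
have oo : (\sum_(n <oo) P (F n) < +oo)%E.
  apply: (@le_lt_trans _ _ (\sum_(n <oo) (u n)%:E)%E).
    by apply: lee_nneseries => // n _; exact: Fu.
  have -> : (\sum_(n <oo) (u n)%:E = (limn (series u))%:E)%E.
    rewrite -EFin_lim//; congr (lim (_ @ \oo)%classic); apply/funext => n /=.
    by rewrite -sumEFin.
  exact: ltry.
have P0 := lim_sup_set_cvg0 mF oo.
exists (lim_sup_set F); split => //.
  apply: bigcapT_measurable => n; apply: bigcup_measurable => k _; exact: mF.
move=> w /= nw n _; apply: contrapT => nF; apply: nw.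
exists n => // k /= nk Fk; apply: nF; exists k => //.
Qed.

Lemma ae_forall_count (T : countType) (Q : T -> Omega -> Prop) :
  (forall x, {ae P, forall w, Q x w}) -> {ae P, forall w, forall x, Q x w}.
Proof.
move=> aeQ.
have : {ae P, forall w, forall n, if choice.unpickle n is Some x then Q x w else True}.
  apply: ae_foralln => n; case: (choice.unpickle n) => [x|]; first exact: aeQ.
  by apply: aeW.
apply: filterS => w Qw x; have := Qw (choice.pickle x); by rewrite choice.pickleK.
Qed.

End almost_sure_tools.

Section rational_independence.
Context {R : realType} d {Omega : measurableType d} (P : probability Omega R).
Variable Y : nat -> {RV P >-> measurableTypeR R}.
Hypothesis iY : independent_systems P (fun n => sigma_RV (Y n : Omega -> R)).
Hypothesis atomless : forall k c, P (Y k @^-1` [set c]) = 0%E.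

Let TT : set (set Omega) := [set setT].

Let iTT A B : TT A -> sigma_seq (fun k => Y k : Omega -> R) B ->
  P (A `&` B) = (P A * P B)%E.
Proof. by move=> -> _; rewrite setTI probability_setT mul1e. Qed.

(** With the other coordinates frozen, the combination vanishes for a single
value of [Y k], which has probability zero. *)
Lemma integer_combination_neq0 (c : seq int) (k : nat) : c`_k != 0 ->
  {ae P, forall w, \sum_(i < size c) (c`_i)%:~R * Y i w != 0}.
Proof.
move=> ck.
have kc : (k < size c)%N by rewrite ltnNge; apply: contra ck => ?; rewrite nth_default.
pose ko := Ordinal kc.
pose S w := \sum_(i < size c) (if val i == k then 0 else (c`_i)%:~R * Y i w).
pose mu : probability (measurableTypeR R) R := distribution P (Y k).
pose Yf n : Omega -> measurableTypeR R := Y n.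
pose TO := g_sigma_algebraType (others TT Yf k).
have mYf n : measurable_fun setT (Yf n) by exact: measurable_funPT.
have mTT : TT `<=` measurable by move=> _ ->.
have ITT : setI_closed TT by move=> _ _ -> ->; rewrite /TT/= setTI.
have mS : measurable_fun setT (S : TO -> measurableTypeR R).
  apply: measurable_sum => i; case: eqP => [_|/eqP ik]; first exact: measurable_cst.
  apply: measurable_funM; first exact: measurable_cst.
  exact: (@measurable_other _ _ _ TT Yf erefl).
pose D : set (TO * measurableTypeR R) := [set x | S x.1 + (c`_k)%:~R * x.2 = 0].
have mD : measurable D.
  pose f (x : TO * measurableTypeR R) : measurableTypeR R := S x.1 + (c`_k)%:~R * x.2.
  have mf : measurable_fun setT f.
    apply: measurable_funD; first exact: measurableT_comp mS measurable_fst.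
    by apply: measurable_funM; [exact: measurable_cst|exact: measurable_snd].
  exact: measurable_zero_set mf.
pose G (x : TO * measurableTypeR R) : \bar R := (\1_D x)%:E.
have ckR : (c`_k)%:~R != 0 :> R by rewrite intr_eq0.
have mG : measurable_fun setT G by apply/measurable_EFinP; exact: measurable_indic.
have G0 x : (0 <= G x)%E by rewrite lee_fin.
have iYf : independent_systems P (fun n => sigma_RV (Yf n)) by exact: iY.
have := integral_one_coordinate mYf mTT ITT erefl iYf iTT (fun B _ => erefl (mu B)) mG G0.
have -> : (\int[P]_w \int[mu]_y G (w, y) = 0)%E.
  rewrite -[RHS](integral0 P setT); apply: eq_integral => w _.
  rewrite /G (_ : (fun y => _) = (fun y => (\1_[set - S w / (c`_k)%:~R] y)%:E)).
    rewrite integral_indic ?setIT; [exact: atomless|exact: measurableT|exact: (@measurable_set1 R)].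
  apply/funext => y; congr (_%:E); rewrite !indicE; congr (_%:R); congr nat_of_bool.
  apply/idP/idP; rewrite !inE /D/=.
    by move=> /eqP; rewrite addr_eq0 => /eqP ->; field.
  by move=> ->; field.
pose f w : measurableTypeR R := \sum_(i < size c) (c`_i)%:~R * Yf i w.
have mf : measurable_fun setT f.
  by apply: measurable_sum => i; apply: measurable_funM; [exact: measurable_cst|exact: mYf].
have mDf : measurable (f @^-1` [set 0]).
  exact: measurable_zero_set mf.
have fE w : f w = S w + (c`_k)%:~R * Yf k w.
  rewrite /f /S addrC (bigD1 ko)//= [in RHS](bigD1 ko)//= eqxx add0r.
  by congr (_ + _); apply: eq_bigr => i; rewrite -val_eqE/= => /negbTE ->.
move=> I0; exists (f @^-1` [set 0]); split => //.
  rewrite -[LHS](_ : (\int[P]_w (\1_(f @^-1` [set 0]) w)%:E)%E = _); last first.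
    by rewrite integral_indic ?setIT.
  rewrite -[RHS]I0; apply: eq_integral => w _; rewrite /G !indicE; congr (_%:R%:E); congr nat_of_bool.
  by apply/idP/idP; rewrite !inE /D/= fE.
by move=> w /= /negP; rewrite negbK => /eqP.
Qed.

Lemma rationally_independent :
  {ae P, forall w, forall c : seq int, forall k, c`_k != 0 ->
     \sum_(i < size c) (c`_i)%:~R * Y i w != 0}.
Proof.
apply: ae_forall_count => c; apply: ae_foralln => k.
have [ck0|ck] := eqVneq c`_k 0; first by apply: aeW => w /negP[]; apply/eqP.
by apply: filterS (integer_combination_neq0 ck) => w.
Qed.

End rational_independence.

(** * Square summability of the amplitudes *)

Section series_tools.
Context {R : realType}.

Lemma near_series_le_cvg (u v : R^nat) :
  (forall n, 0 <= u n) -> (forall n, 0 <= v n) ->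
  (\forall n \near \oo, u n <= v n) -> cvgn (series v) -> cvgn (series u).
Proof.
move=> u0 v0 [N _ Nuv] cv.
pose u' n := if (n < N)%N then 0 else u n.
have : cvgn (series u').
  apply: (@series_le_cvg _ _ v) => // n; rewrite /u'; case: ltnP => // Nn.
  exact: Nuv.
rewrite -(@is_cvg_series_restrict N R R^o) -(@is_cvg_series_restrict N R R^o u).
rewrite (_ : (fun n => _) = (fun n => \sum_(N <= k < n) u k))//.
apply/funext => n; apply: eq_big_nat => k /andP[Nk _].
by rewrite /u' ltnNge Nk.
Qed.

(** Comparison with the integral in telescoping form: with [q = p - 1], the
bound [1/(n+2) <= ln (n+2) - ln (n+1)] gives
[q (n+2)^(-p) <= (n+1)^(-q) - (n+2)^(-q)]. *)
Lemma cvg_pseries (p : R) : 1 < p ->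
  cvgn (series (fun n => n.+1%:R `^ (- p))).
Proof.
move=> p1; pose q := p - 1; have q0 : 0 < q by rewrite subr_gt0.
have step n : q * n.+2%:R `^ (- p) <= n.+1%:R `^ (- q) - n.+2%:R `^ (- q).
  have n2 : (0 : R) < n.+2%:R by rewrite ltr0n.
  have n1 : (0 : R) < n.+1%:R by rewrite ltr0n.
  have L : n.+2%:R^-1 <= ln n.+2%:R - ln (n.+1%:R : R).
    have h : -1 < - n.+2%:R^-1 :> R by rewrite ltrN2 invf_lt1// ltr1n.
    have := le_ln1Dx h; rewrite (_ : 1 - _ = n.+1%:R / n.+2%:R); last first.
      by rewrite -(natr1 n.+1); field; rewrite nat1r natr1 gt_eqF.
    by rewrite ln_div ?posrE//; rewrite lerNr opprB.
  have -> : n.+2%:R `^ (- p) = n.+2%:R `^ (- q) * n.+2%:R^-1 :> R.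
    rewrite (_ : - p = - q + - 1); last by rewrite /q; ring.
    by rewrite powRD ?powR_inv1// ?ltW// lt0r_neq0 ?implybT.
  have -> : n.+1%:R `^ (- q) = n.+2%:R `^ (- q) * expR (q * (ln n.+2%:R - ln n.+1%:R)) :> R.
    by rewrite /powR (gt_eqF n1) (gt_eqF n2) -expRD; congr expR; ring.
  rewrite -[X in _ <= _ - X]mulr1 -mulrBr mulrCA ler_wpM2l ?powR_ge0//.
  rewrite lerBrDl (le_trans _ (expR_ge1Dx _))// lerD2l.
  by rewrite ler_pM2l.
apply: nondecreasing_is_cvgn.
  by apply: nondecreasing_series => n _ _; exact: powR_ge0.
exists (1 + q^-1) => _ [n _ <-].
have bnd m : \sum_(0 <= k < m) k.+2%:R `^ (- p) <= q^-1 * (1 - m.+1%:R `^ (- q)) :> R.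
  elim: m => [|m IH]; first by rewrite big_geq// powR1 subrr mulr0.
  rewrite big_nat_recr//=; apply: (le_trans (lerD IH (lexx _))).
  rewrite -(ler_pM2l q0) mulrDr !mulrA divff ?gt_eqF// !mul1r.
  by have := step m; lra.
case: n => [|n]; first by rewrite /series/= big_geq// addr_ge0// invr_ge0 ltW.
rewrite /series/= big_nat_recl// powR1 lerD2l (le_trans (bnd n))//.
by rewrite ler_piMr ?invr_ge0 ?(ltW q0)// lerBlDr lerDl powR_ge0.
Qed.

Lemma ln_le_powR (x e : R) : 1 <= x -> 0 < e -> ln x <= e^-1 * x `^ e.
Proof.
move=> x1 e0; rewrite -(ler_pM2l e0) mulrA divff ?gt_eqF// mul1r -ln_powR.
by apply/ltW/ln_sublinear; rewrite powR_gt0// (lt_le_trans ltr01).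
Qed.

End series_tools.

Section poisson_growth.
Context {R : realType} d {Omega : measurableType d} (P : probability Omega R).

Let TT : set (set Omega) := [set setT].

(** The exact value is 1/2, but any bound below 1 serves the Chernoff estimate.
Replacing [expR (- y)] by 1 on [0, 1] and by [expR (- 1)] beyond 1 needs
only the distribution function. *)
Lemma integral_expN_exponential (mu : probability (measurableTypeR R) R) :
  (forall A : set (measurableTypeR R), measurable A -> mu A = exponential_prob 1 A) ->
  (\int[mu]_y (expR (- y))%:E <= (1 - expR (- 1) + expR (- 2))%:E)%E.
Proof.
move=> muE.
pose T := measurableTypeR R.
pose A0 : set T := [set` `]-oo, (0 : R)[].
pose A1 : set T := [set` `[(0 : R), 1]].
pose A2 : set T := [set` `](1 : R), +oo[].
have mA0 : measurable A0 by exact: measurable_itv.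
have mA1 : measurable A1 by exact: measurable_itv.
have mA2 : measurable A2 by exact: measurable_itv.
have mu0 : mu A0 = 0%E.
  rewrite muE//; apply: integral0_eq => x; rewrite /A0/= in_itv/= => x0.
  by rewrite lt0_exponential_pdf.
have mu1 : mu A1 = (1 - expR (- 1))%:E.
  by rewrite muE// exponential_prob_itv0c// mulN1r EFinB.
have UT : A0 `|` (A1 `|` A2) = setT.
  apply/seteqP; split => // x _; rewrite /A0 /A1 /A2 /= !in_itv/= andbT.
  have [x0|x0] := ltP x 0; [by left|right].
  by have [x1|x1] := leP x 1; [left|right].
have dj2 : A0 `&` (A1 `|` A2) = set0.
  apply/seteqP; split => // x; rewrite /A0 /A1 /A2 /= !in_itv/= andbT => -[x0].
  by case=> [/andP[]|] ; lra.
have dj3 : A1 `&` A2 = set0.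
  apply/seteqP; split => // x; rewrite /A0 /A1 /A2 /= !in_itv/= andbT.
  by move=> [/andP[]]; lra.
have mu2 : mu A2 = (expR (- 1))%:E.
  have : mu setT = 1%E by exact: probability_setT.
  rewrite -UT measureU//; last exact: measurableU.
  rewrite [X in (_ + X)%E](measureU mu)// [X in (X + _)%E]mu0 add0e [X in (X + _)%E]mu1.
  rewrite addeC => /esym/eqP; rewrite -sube_eq ?fin_num_adde_defl// => /eqP <-.
  by rewrite -EFinB; congr (_%:E); ring.
have mI (A : set T) : measurable A -> measurable_fun setT (fun y => (\1_A y)%:E : \bar R).
  by move=> mA; apply/measurable_EFinP; exact: measurable_indic.
have mE : measurable_fun setT (fun y : T => (expR (- y))%:E).
  by apply/measurable_EFinP; apply: measurableT_comp => //; exact: measurable_funN.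
apply: (@le_trans _ _ (\int[mu]_y ((\1_A1 y)%:E + (expR (- 1))%:E * (\1_A2 y)%:E))%E).
  apply: ae_ge0_le_integral => //.
  - by move=> y _; rewrite adde_ge0// ?mule_ge0// ?lee_fin// expR_ge0.
  - apply: emeasurable_funD; first exact: mI.
    by apply: emeasurable_funM; [exact: measurable_cst|exact: mI].
  - exists A0; split => // y /= /not_implyP[_] /negP; apply: contraNP => nA0.
    have y0 : 0 <= y by rewrite leNgt; apply/negP => h; apply: nA0; rewrite /A0/= in_itv.
    rewrite !indicE; have [y1|y1] := leP y 1.
      have h1 : (y \in A1) = true by apply/mem_set; rewrite /A1/= in_itv/= y0 y1.
      have h2 : (y \in A2) = false.
        by apply: memNset; rewrite /A2/= in_itv/= andbT ltNge y1.
      by rewrite h1 h2 mule0 adde0 lee_fin -expR0 ler_expR oppr_le0.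
    have h1 : (y \in A1) = false.
      by apply: memNset; rewrite /A1/= in_itv/= (leNgt y 1) y1 andbF.
    have h2 : (y \in A2) = true by apply/mem_set; rewrite /A2/= in_itv/= y1.
    by rewrite h1 h2 add0e mule1 lee_fin ler_expR lerN2 ltW.
rewrite ge0_integralD//; last 2 first.
- exact: (mI A1).
- by apply: emeasurable_funM; [exact: measurable_cst|exact: (mI A2)].
rewrite ge0_integralZl//; last exact: (mI A2).
rewrite !integral_indic// !setIT.
apply: (@le_trans _ _ (mu A1 + (expR (- 1))%:E * mu A2)%E); first exact: lexx.
rewrite mu1 mu2 -EFinM -EFinD lee_fin -expRD.
by rewrite (_ : - 1 - 1 = - 2)//; ring.
Qed.

Variable Gam : nat -> {RV P >-> measurableTypeR R}.
Hypothesis Gam_arrivals : unit_poisson_arrivals P (fun k => Gam k : Omega -> R).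

Let tau k w : measurableTypeR R := Gam k w - (if k is j.+1 then Gam j w else 0).

Let Gam_sum k w : Gam k w = \sum_(j < k.+1) tau j w.
Proof.
elim: k => [|k IH]; first by rewrite big_ord1 /tau subr0.
by rewrite big_ord_recr/= -IH /tau addrC subrK.
Qed.

Let mGam k : measurable_fun setT (Gam k : Omega -> measurableTypeR R).
Proof. exact: measurable_funPT. Qed.

Let mtau k : measurable_fun setT (tau k).
Proof.
rewrite /tau; apply: measurable_funB; first exact: mGam.
by case: k => [|k]; [exact: measurable_cst|exact: mGam].
Qed.

Let rho : R := 1 - expR (- 1) + expR (- 2).

Let rho_gt0 : 0 < rho.
Proof. by rewrite /rho ltr_pwDr ?expR_gt0// subr_ge0 -[leRHS]expR0 ler_expR lerN10. Qed.

Let rho_lt1 : rho < 1.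
Proof.
have : expR (- 2) < expR (- 1) :> R by rewrite ltr_expR; lra.
by rewrite /rho; lra.
Qed.

(** The waiting times are independent, so each of them contributes a factor
[rho < 1]. *)
Let laplace_arrivals k :
  (\int[P]_w (expR (- \sum_(j < k) tau j w))%:E <= (rho ^+ k)%:E)%E.
Proof.
elim: k => [|k IH].
  rewrite (eq_integral (cst 1%E)); last by move=> w _; rewrite big_ord0 oppr0 expR0.
  by rewrite integral_cst// [X in (_ * X)%E]probability_setT mule1 expr0.
have [itau ltau] := Gam_arrivals.
pose TO := g_sigma_algebraType (others TT tau k).
pose S w := \sum_(j < k) tau j w.
have mTT : TT `<=` measurable by move=> _ ->.
have ITT : setI_closed TT by move=> _ _ -> ->; rewrite /TT/= setTI.
have iTT A B : TT A -> sigma_seq tau B -> P (A `&` B) = (P A * P B)%E.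
  by move=> -> _; rewrite setTI probability_setT mul1e.
pose mu : probability (measurableTypeR R) R := distribution P (mfun_Sub (mem_set (mtau k))).
have mS : measurable_fun setT (S : TO -> measurableTypeR R).
  apply: measurable_sum => i; apply: (@measurable_other _ _ _ TT tau erefl).
  by rewrite neq_ltn ltn_ord.
have meS : measurable_fun setT (fun w : TO => expR (- S w)).
  by apply: measurableT_comp => //; exact: measurable_funN.
have meN : measurable_fun setT (fun y : measurableTypeR R => expR (- y)).
  by apply: measurableT_comp => //; exact: measurable_funN.
pose G (x : TO * measurableTypeR R) : \bar R := (expR (- S x.1) * expR (- x.2))%:E.
have mG : measurable_fun setT G.
  apply/measurable_EFinP; apply: measurable_funM.
    exact: (measurableT_comp meS measurable_fst).
  exact: (measurableT_comp meN measurable_snd).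
have G0 x : (0 <= G x)%E by rewrite lee_fin mulr_ge0 ?expR_ge0.
have := integral_one_coordinate mtau mTT ITT erefl itau iTT (fun B _ => erefl (mu B)) mG G0.
have -> : (\int[P]_w G (w, tau k w) = \int[P]_w (expR (- \sum_(j < k.+1) tau j w))%:E)%E.
  apply: eq_integral => w _; rewrite (_ : \sum_(j < k.+1) tau j w = S w + tau k w).
    by rewrite opprD expRD.
  by rewrite big_ord_recr.
move=> ->.
have mSO : measurable_fun setT (fun w : Omega => expR (- S w)).
  apply: measurableT_comp => //; apply: measurable_funN.
  by apply: measurable_sum => i; exact: mtau.
pose I := (\int[mu]_y (expR (- y))%:E)%E.
have I0 : (0 <= I)%E by apply: integral_ge0 => y _; rewrite lee_fin expR_ge0.
have Ir : (I <= rho%:E)%E by apply: integral_expN_exponential => A mA; exact: ltau.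
have -> : (\int[P]_w \int[mu]_y G (w, y) = \int[P]_w ((expR (- S w))%:E * I))%E.
  apply: eq_integral => w _; rewrite /G/=; under eq_integral do rewrite EFinM.
  rewrite ge0_integralZl//; try solve [by apply/measurable_EFinP
    | by move=> y _; rewrite lee_fin expR_ge0 | by rewrite lee_fin expR_ge0].
rewrite ge0_integralZr//; try solve [by apply/measurable_EFinP
  | by move=> y _; rewrite lee_fin expR_ge0].
rewrite exprSr EFinM lee_pmul//.
by apply: integral_ge0 => w _; rewrite lee_fin expR_ge0.
Qed.

(** Chernoff bound: [P (Gam k < c (k+1)) <= (expR c * rho) ^ (k+1)]. The choice
[rho = expR (- 2c)] makes the right-hand side summable. *)
Lemma arrivals_linear_growth :
  exists2 c : R, 0 < c & {ae P, forall w, \forall k \near \oo, c * k.+1%:R <= Gam k w}.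
Proof.
pose c := - ln rho / 2.
have c0 : 0 < c by rewrite divr_gt0// oppr_gt0 ln_lt0// rho_gt0.
have rhoE : rho = expR (- c) * expR (- c).
  by rewrite -expRD -[LHS]lnK ?posrE//; congr expR; rewrite /c; field.
exists c => //.
pose F k := [set w | Gam k w < c * k.+1%:R].
have mF k : measurable (F k).
  rewrite -[F k]setTI /F -[X in _ `&` X]/(Gam k @^-1` [set x | x < c * k.+1%:R]).
  rewrite (_ : [set x | _] = [set` `]-oo, c * k.+1%:R[]); first exact: mGam.
  by apply/seteqP; split => x /=; rewrite in_itv.
have : {ae P, forall w, \forall k \near \oo, ~ F k w}.
  apply: (@borel_cantelli_series _ _ _ _ _ (geometric (expR (- c)) (expR (- c)))) => //.
  - move=> k; rewrite -(@setIT _ (F k)) -integral_indic//.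
    rewrite /geometric/= -exprS.
    have e0 : (0 <= (expR (c * k.+1%:R))%:E)%E :> bool by rewrite lee_fin expR_ge0.
    have meG : measurable_fun setT (fun w => expR (- \sum_(j < k.+1) tau j w)).
      apply: measurableT_comp => //; apply: measurable_funN.
      by apply: measurable_sum => i; exact: mtau.
    apply: (@le_trans _ _ (\int[P]_w ((expR (c * k.+1%:R))%:E *
        (expR (- \sum_(j < k.+1) tau j w))%:E))%E).
      apply: ge0_le_integral => //.
      - by apply/measurable_EFinP; exact: measurable_indic.
      - apply/measurable_EFinP; apply: measurable_funM => //; exact: measurable_cst.
      - move=> w _; rewrite -EFinM lee_fin -Gam_sum -expRD indicE.
        case: (boolP (w \in F k)) => [|_]; last exact: expR_ge0.
        rewrite inE /F/= => Fw; rewrite -[leLHS]expR0 ler_expR subr_ge0; exact: ltW.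
    rewrite ge0_integralZl//; try solve [by apply/measurable_EFinP
      | by move=> w _; rewrite lee_fin expR_ge0].
    apply: (@le_trans _ _ ((expR (c * k.+1%:R))%:E * (rho ^+ k.+1)%:E)%E).
      by rewrite lee_wpmul2l.
    by rewrite -EFinM lee_fin expRM_natr rhoE exprMn mulrA -exprMn -expRD subrr expR0 expr1n mul1r.
  - by apply: is_cvg_geometric_series; rewrite ger0_norm ?expR_ge0// -expR0 ltr_expR oppr_lt0.
apply: filterS => w; apply: filterS => k /negP; by rewrite -leNgt.
Qed.

End poisson_growth.

Section normal_tail.
Context {R : realType} d {Omega : measurableType d} (P : probability Omega R).

(** Split [expR (- x^2/2)] into two equal factors: one is at most
[expR (- c/4)] on the event, the other is proportional to the density of
variance 2, which has total mass 1. *)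
Lemma normal_prob_tail : exists2 C : R, 0 <= C & forall c : R, 0 <= c ->
  (normal_prob 0 1 [set x : R | (c < x ^+ 2)%R] <= (C * expR (- (c / 4)))%:E)%E.
Proof.
pose s : R := Num.sqrt 2.
have s0 : s != 0 by rewrite gt_eqF// sqrtr_gt0.
exists (normal_peak 1 / normal_peak s).
  by rewrite divr_ge0// normal_peak_ge0.
move=> c c0; rewrite /normal_prob.
set A := [set x | _].
have mA : measurable (A : set R).
  rewrite (_ : A = setT `&` (fun x : R => x ^+ 2) @^-1` [set` `]c, +oo[]).
    by apply: (measurable_funX 2 (@measurable_id _ R setT)) => //; exact: measurable_itv.
  by rewrite setTI; apply/seteqP; split => x; rewrite /A/= in_itv/= andbT.
set C := _ / _.
have p0 : 0 < normal_peak s by exact: normal_peak_gt0.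
have C0 : 0 <= C by rewrite /C divr_ge0// normal_peak_ge0.
have Ce0 : 0 <= C * expR (- (c / 4)) by rewrite mulr_ge0 ?expR_ge0.
have mn : measurable_fun A (fun x => (normal_pdf 0 s x)%:E).
  by apply/measurable_EFinP/measurable_funTS; exact: measurable_normal_pdf.
apply: (@le_trans _ _ (\int[lebesgue_measure]_(x in A) ((C * expR (- (c / 4)))%:E * (normal_pdf 0 s x)%:E))%E).
  apply: ge0_le_integral => //.
  - by move=> x _; rewrite lee_fin normal_pdf_ge0.
  - by apply/measurable_EFinP/measurable_funTS; exact: measurable_normal_pdf.
  - by apply: emeasurable_funM => //; exact: measurable_cst.
  - move=> x; rewrite /A/= => cx; rewrite lee_fin !normal_pdfE ?oner_neq0// /C.
    rewrite mulrA mulrAC -!mulrA ler_wpM2l ?normal_peak_ge0// mulrA mulrC.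
    rewrite [leRHS](_ : _ = expR (- (c / 4)) * normal_fun 0 s x); last first.
      by field; rewrite gt_eqF.
    rewrite /normal_fun -expRD ler_expR subr0 /s sqr_sqrtr// expr1n.
    rewrite [leLHS](_ : _ = - (x ^+ 2 / 4) + - x ^+ 2 / (2 *+ 2)); last first.
      by rewrite -(mulr_natr 2 2) -[1 *+ 2]/(2 : R); field.
    by rewrite lerD2r lerN2 ler_pM2r ?invr_gt0// ltW.
rewrite ge0_integralZl//; last by move=> x _; rewrite lee_fin normal_pdf_ge0.
rewrite -[leRHS]mule1 lee_wpmul2l// -(integral_normal_pdf 0 s).
apply: ge0_subset_integral => //.
  by apply/measurable_EFinP; exact: measurable_normal_pdf.
by move=> x _; rewrite lee_fin normal_pdf_ge0.
Qed.

Lemma normal_log_growth (G : nat -> {RV P >-> measurableTypeR R}) :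
  iid P (fun k => G k : Omega -> R) (normal_prob 0 1) ->
  {ae P, forall w, \forall k \near \oo, G k w ^+ 2 <= 8 * ln k.+1%:R}.
Proof.
move=> [_ lG]; have [C C0 tail] := normal_prob_tail.
(* With this threshold the tail bound is [C (k+1)^(-2)]. *)
pose c k : R := 8 * ln k.+1%:R.
have c0 k : 0 <= c k by rewrite mulr_ge0// ln_ge0// ler1n.
pose A k : set R := [set x | c k < x ^+ 2].
have mA k : measurable (A k).
  rewrite (_ : A k = setT `&` (fun x : R => x ^+ 2) @^-1` [set` `]c k, +oo[]).
    by apply: (measurable_funX 2 (@measurable_id _ R setT)) => //; exact: measurable_itv.
  by rewrite setTI; apply/seteqP; split => x; rewrite /A/= in_itv/= andbT.
have mF k : measurable (G k @^-1` A k).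
  by rewrite -[X in measurable X]setTI; exact: (measurable_funPT (G k) measurableT _ (mA k)).
have : {ae P, forall w, \forall k \near \oo, ~ (G k @^-1` A k) w}.
  apply: (@borel_cantelli_series _ _ _ _ _ (C *: (fun k => k.+1%:R `^ (- 2)))) => //.
  - move=> k; rewrite lG// (le_trans (tail _ (c0 k)))// lee_fin ler_wpM2l//.
    rewrite /powR gt_eqF ?ltr0n// ler_expR /c.
    by rewrite le_eqVlt; apply/orP; left; apply/eqP; field.
  - by apply: is_cvg_seriesZ; apply: cvg_pseries; rewrite ltr1n.
by apply: filterS => w; apply: filterS => k /negP; rewrite /A/= -leNgt.
Qed.

End normal_tail.

Section amplitudes.
Context {R : realType} d {Omega : measurableType d} (P : probability Omega R).

(** [Gam k] grows at least linearly and the squared normals at most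
logarithmically, so the [k]-th square is at most of order
[k ^ (- 2/alpha) * ln k]. Since [2/alpha > 1], half of the excess
[2/alpha - 1] absorbs the logarithm. *)
Lemma amplitude_square_summable (alpha mass : R)
    (Gam G1 G2 : nat -> {RV P >-> measurableTypeR R}) :
  0 < alpha < 2 ->
  unit_poisson_arrivals P (fun k => Gam k : Omega -> R) ->
  iid P (fun k => G1 k : Omega -> R) (normal_prob 0 1) ->
  iid P (fun k => G2 k : Omega -> R) (normal_prob 0 1) ->
  {ae P, forall w,
     cvgn (series (fun k => amplitude alpha mass Gam G1 G2 k w ^+ 2))}.
Proof.
move=> /andP[a0 a2] /arrivals_linear_growth[c c0 aeG]
  /normal_log_growth ae1 /normal_log_growth ae2.
near=> w.
have Gc : \forall k \near \oo, c * k.+1%:R <= Gam k w by near: w.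
have N1 : \forall k \near \oo, G1 k w ^+ 2 <= 8 * ln k.+1%:R by near: w.
have N2 : \forall k \near \oo, G2 k w ^+ 2 <= 8 * ln k.+1%:R by near: w.
set K := (C_const alpha * (b_const alpha)^-1 * mass) `^ (alpha^-1).
pose p := 2 / alpha; pose e := (p - 1) / 2.
have p1 : 1 < p by rewrite ltr_pdivlMr// mul1r.
have e0 : 0 < e by rewrite divr_gt0// subr_gt0.
pose D := K ^+ 2 * c `^ (- p) * (16 * e^-1).
apply: (@near_series_le_cvg _ _ (D *: (fun k => k.+1%:R `^ (- (1 + e))))).
- by move=> k; exact: sqr_ge0.
- move=> k; rewrite mulr_ge0 ?powR_ge0// /D !mulr_ge0 ?sqr_ge0 ?powR_ge0//.
  by rewrite invr_ge0 ltW.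
- near=> k.
  have k0 : (0 : R) < k.+1%:R by rewrite ltr0n.
  have ck : 0 < c * k.+1%:R by rewrite mulr_gt0.
  have G0 : 0 < Gam k w by apply: (lt_le_trans ck); near: k.
  rewrite /amplitude -/K !exprMn sqr_sqrtr ?addr_ge0 ?sqr_ge0//.
  rewrite (_ : (Gam k w `^ (- alpha^-1)) ^+ 2 = Gam k w `^ (- p)); last first.
    by rewrite -powR_mulrn ?powR_ge0// -powRrM mulNr mulrC.
  have LG : Gam k w `^ (- p) <= c `^ (- p) * k.+1%:R `^ (- p).
    rewrite -powRM ?(ltW c0) ?(ltW k0)// !powRN lef_pV2 ?posrE ?powR_gt0//.
    rewrite ge0_ler_powR ?nnegrE ?(ltW ck) ?(ltW G0) ?(le_trans _ (ltW p1))//.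
    by near: k.
  have LN : G1 k w ^+ 2 + G2 k w ^+ 2 <= 16 * (e^-1 * k.+1%:R `^ e).
    have L1 : G1 k w ^+ 2 <= 8 * ln k.+1%:R by near: k.
    have L2 : G2 k w ^+ 2 <= 8 * ln k.+1%:R by near: k.
    apply: (le_trans (lerD L1 L2)); rewrite -mulrDl -natrD ler_pM2l//.
    by apply: ln_le_powR => //; rewrite ler1n.
  apply: (@le_trans _ _ (K ^+ 2 * (c `^ (- p) * k.+1%:R `^ (- p)) *
      (16 * (e^-1 * k.+1%:R `^ e)))).
    by rewrite ler_pM ?mulr_ge0 ?addr_ge0 ?sqr_ge0 ?powR_ge0// ler_wpM2l ?sqr_ge0.
  rewrite [X in _ <= X](_ : _ = D * k.+1%:R `^ (- (1 + e)))//.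
  rewrite (_ : - (1 + e) = - p + e); last by rewrite /e; field.
  by rewrite powRD ?(gt_eqF k0) ?implybT// /D le_eqVlt; apply/orP; left; apply/eqP; ring.
- by apply: is_cvg_seriesZ; apply: cvg_pseries; rewrite ltrDl.
Unshelve. all: by end_near. Qed.

End amplitudes.

(** * Translation and periodicity of integrals *)

Section periodic_integrals.
Context {R : realType}.
Local Notation mu := (@lebesgue_measure R).
Local Open Scope ereal_scope.

Lemma lebesgue_measure_translation (v : R) (A : set R) : measurable A ->
  pushforward mu (fun x : measurableTypeR R => (x + v)%R : measurableTypeR R) A = mu A.
Proof.
move=> mA.
pose sv : measurableTypeR R -> measurableTypeR R := fun x => (x + v)%R.
have mv : measurable_fun setT sv.
  by apply: measurable_funD => //; exact: measurable_cst.
pose sh : {mfun measurableTypeR R >-> measurableTypeR R} := mfun_Sub (mem_set mv).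
apply/esym/(@lebesgue_measure_unique R (pushforward lebesgue_measure sh)) => //= _ [[a b]] _ <-.
rewrite /pushforward.
have -> : sh @^-1` `]a, b] = `](a - v)%R, (b - v)%R]%classic.
  by apply/seteqP; split => x /=; rewrite !in_itv/= ltrBlDr lerBrDr.
rewrite !lebesgue_measure_itv/= !lte_fin ltrD2r.
by case: ifP => // _; rewrite -EFinB -EFinB; congr (_%:E); ring.
Qed.

Lemma ge0_integral_translation (v a b : R) (f : R -> \bar R) :
  measurable_fun setT f -> (forall x, 0 <= f x) ->
  \int[mu]_(x in `[a, b[) f (x + v)%R = \int[mu]_(x in `[(a + v)%R, (b + v)%R[) f x.
Proof.
move=> mf f0; rewrite (_ : `[a, b[%classic =
    (fun x : measurableTypeR R => (x + v)%R : measurableTypeR R) @^-1`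
      `[(a + v)%R, (b + v)%R[); last first.
  by apply/seteqP; split => x /=; rewrite !in_itv/= lerD2r ltrD2r.
have mv : measurable_fun setT (fun x : measurableTypeR R => (x + v)%R : measurableTypeR R).
  by apply: measurable_funD => //; exact: measurable_cst.
rewrite -(ge0_integral_pushforward mv)//=; last exact: measurable_funS mf.
by apply: eq_measure_integral => //= A mA AS; exact/lebesgue_measure_translation.
Qed.

Lemma periodicz (p : R) (f : R -> \bar R) (n : int) x :
  (forall x, f (x + p)%R = f x) -> f (x + n%:~R * p)%R = f x.
Proof.
move=> fp; have H (k : nat) y : f (y + k%:R * p)%R = f y.
  elim: k => [|k IH] in y *; first by rewrite mul0r addr0.
  by rewrite -natr1 mulrDl mul1r addrA fp IH.
case: n => k; first by rewrite -[RHS](H k).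
rewrite NegzE mulrNz mulNr -[LHS](H k.+1); congr (f _).
by rewrite -[k.+1%:~R]/(k.+1%:R : R) subrK.
Qed.

(** Modulo the period the shift lies in [[0, p[]; the piece of the window that
leaves on the right is then a translate of the piece missing on the left. *)
Lemma ge0_integral_periodic (p v : R) (f : R -> \bar R) : (0 < p)%R ->
  measurable_fun setT f -> (forall x, 0 <= f x) -> (forall x, f (x + p)%R = f x) ->
  \int[mu]_(x in `[0%R, p[) f (x + v)%R = \int[mu]_(x in `[0%R, p[) f x.
Proof.
move=> p0 mf f0 fp.
pose n := Num.floor (v / p); pose r := (v - n%:~R * p)%R.
have r0 : (0 <= r)%R by rewrite subr_ge0 -ler_pdivlMr// ge_floor.
have rp : (r < p)%R.
  have := floorD1_gt (v / p); rewrite ltr_pdivrMr// intrD mulrDl mul1r.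
  by rewrite /r; lra.
transitivity (\int[mu]_(x in `[0%R, p[) f (x + r)%R).
  apply: eq_integral => x _.
  by rewrite -[RHS](periodicz n _ fp) /r; congr f; rewrite -addrA subrK.
rewrite ge0_integral_translation// add0r.
have spl (a b c : R) : (a <= b)%R -> (b <= c)%R ->
    \int[mu]_(x in `[a, c[) f x = \int[mu]_(x in `[a, b[) f x + \int[mu]_(x in `[b, c[) f x.
  move=> ab bc; rewrite -ge0_integral_setU//.
  - congr (integral _ _ _); apply/seteqP; split => x /=; rewrite !in_itv/=.
      by move=> /andP[ax xc]; have [xb|bx] := ltP x b; [left; rewrite ax|right; rewrite xc].
    by case=> /andP[h1 h2]; apply/andP; split => //; lra.
  - exact: measurable_funTS.
  - by apply/disj_setPS => x []/=; rewrite !in_itv/= => /andP[_ h1] /andP[h2 _]; lra.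
rewrite (spl r p (p + r)%R) ?lerDl ?(ltW rp)// (spl 0%R r p) ?(ltW rp)// addeC.
congr (_ + _); have := @ge0_integral_translation p 0%R r f mf f0.
by rewrite add0r [(r + p)%R]addrC => <-; apply: eq_integral => x _; rewrite fp.
Qed.

(** A uniform phase absorbs any shift: this is the source of stationarity. *)
Lemma integral_uniform_shift (v : R) (f : R -> \bar R) :
  measurable_fun setT f -> (forall x, 0 <= f x) ->
  (forall x, f (x + 2 * pi)%R = f x) ->
  \int[uniform_prob (@two_pi_gt0 R)]_x f (x + v)%R =
  \int[uniform_prob (@two_pi_gt0 R)]_x f x.
Proof.
move=> mf f0 fp.
have mfv : measurable_fun setT (fun x : R => f (x + v)%R).
  apply: (measurableT_comp mf).
  by apply: measurable_funD => //; exact: measurable_cst.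
rewrite !integral_uniform//; congr (_ * _).
have co (g : R -> \bar R) : measurable_fun setT g ->
    \int[mu]_(x in `[0%R, (2 * pi)%R]) g x = \int[mu]_(x in `[0%R, (2 * pi)%R[) g x.
  move=> mg; apply/esym/integral_itv_bndo_bndc; exact: measurable_funTS.
by rewrite !co//; apply: ge0_integral_periodic => //; exact: two_pi_gt0.
Qed.

End periodic_integrals.

(** * A maximal inequality for random trigonometric sums *)

Section maximal_inequality_counting.
Context {R : realType}.
Local Open Scope ereal_scope.

(** Weak-type estimate for one-sided averages. Scan the indices from the left:
the first bad index opens a window on which [g] has mean at least [lam], all
the indices of that window are charged to it, and the scan resumes after it.
A window opened before [N] ends before [N + N]. *)
Lemma maximal_inequality_counting (g : nat -> \bar R) (lam : R) (N : nat)
    (B : nat -> bool) :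
  (forall j, 0 <= g j) -> (0 <= lam)%R ->
  (forall i, B i -> exists2 T, (0 < T <= N)%N &
     (lam * T%:R)%:E <= \sum_(i <= j < i + T) g j) ->
  \sum_(0 <= i < N) (if B i then lam%:E else 0) <= \sum_(0 <= j < N + N) g j.
Proof.
move=> g0 lam0 HB.
have H n a : (N - a <= n)%N -> (a <= N)%N ->
    \sum_(a <= i < N) (if B i then lam%:E else 0) <= \sum_(a <= j < N + N) g j.
  elim: n a => [|n IH] a Na aN.
    by rewrite big_geq ?sume_ge0//; lia.
  have [aN'|aN'] := leqP N a; first by rewrite big_geq// sume_ge0.
  have [Ba|nBa] := boolP (B a); last first.
    rewrite big_ltn// (negbTE nBa) add0e [leRHS]big_ltn; last by lia.
    by rewrite (le_trans (IH a.+1 _ _)) ?leeDr//; lia.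
  have [T /andP[T0 TN] HT] := HB a Ba.
  pose b := minn (a + T) N.
  rewrite (@big_cat_nat _ _ _ b) ?/b//=; try lia.
  rewrite [leRHS](@big_cat_nat _ _ _ (a + T)) //=; try lia.
  apply: leeD.
    apply: le_trans HT.
    apply: (@le_trans _ _ (\sum_(a <= i < minn (a + T) N) lam%:E)).
      by apply: lee_sum => i _; case: ifP => // _; rewrite lee_fin.
    rewrite sumEFin lee_fin sumr_const_nat -[X in (X <= _)%R]mulr_natr ler_wpM2l// ler_nat.
    by lia.
  have [aTN|NaT] := leqP (a + T) N.
    by apply: IH; lia.
  by rewrite big_geq// sume_ge0.
by apply: (H N); lia.
Qed.

End maximal_inequality_counting.

Lemma measurable_cosine (R : realType) : measurable_fun setT (cos : R -> R).
Proof. by apply: continuous_measurable_fun; exact: continuous_cos. Qed.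

Section path_energy.
Context {R : realType}.

Definition unit_uniform : probability (measurableTypeR R) R := uniform_prob (@ltr01 R).

(** The integral of [f ^ 2] over [[j, j+1]]; the unit interval is taken as a
probability space so that the tools available for [P] apply to time as well. *)
Definition energy (f : R -> R) (j : nat) : \bar R :=
  (\int[unit_uniform]_t ((f (j%:R + t) ^+ 2)%:E))%E.

(** Integer horizons make the event a finite union of measurable ones; passing
to real horizons costs only a factor 2. *)
Definition excess (N : nat) (lam : R) (f : R -> R) : Prop :=
  exists2 T, (0 < T <= N)%N & ((lam * T%:R)%:E < \sum_(0 <= j < T) energy f j)%E.

Lemma energy_ge0 f j : (0 <= energy f j)%E.
Proof. by apply: integral_ge0 => t _; rewrite lee_fin sqr_ge0. Qed.

Lemma energy_shift f i j : energy (fun t => f (i%:R + t)) j = energy f (i + j).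
Proof. by apply: eq_integral => t _; rewrite addrA -natrD. Qed.

Context d (T : measurableType d) (F : T -> R -> R).
Hypothesis mF : measurable_fun setT (fun u : T * measurableTypeR R => F u.1 u.2).

Lemma measurable_path_square (j : nat) :
  measurable_fun setT (fun u : T * measurableTypeR R => ((F u.1 (j%:R + u.2)) ^+ 2)%:E).
Proof.
apply/measurable_EFinP; apply: measurable_funX.
pose s (u : T * measurableTypeR R) : T * measurableTypeR R := (u.1, j%:R + u.2).
have ms : measurable_fun setT s.
  apply/measurable_fun_pairP; split; first exact: measurable_fst.
  apply: measurable_funD; [exact: measurable_cst|exact: measurable_snd].
exact: (measurableT_comp mF ms).
Qed.

Lemma measurable_energy j : measurable_fun setT (fun x => energy (F x) j).
Proof.
apply: (@measurable_fun_fubini_tonelli_F _ _ _ _ _ unit_uniform _ (measurable_path_square j)).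
by move=> u; rewrite lee_fin sqr_ge0.
Qed.

Lemma measurable_excess N lam : measurable [set x | excess N lam (F x)].
Proof.
rewrite (_ : [set x | _] = \bigcup_(n in [set n | (0 < n <= N)%N])
    [set x | ((lam * n%:R)%:E < \sum_(0 <= j < n) energy (F x) j)%E]).
  apply: bigcup_measurable => n _.
  have mS : measurable_fun setT (fun x => (\sum_(0 <= j < n) energy (F x) j)%E).
    by apply: emeasurable_sum => j; exact: measurable_energy.
  rewrite -[X in measurable X]setTI.
  exact: (emeasurable_fun_o_infty measurableT mS).
by apply/seteqP; split => x [n nN h]; exists n.
Qed.

End path_energy.

Section stationary_random_trigonometric_sums.
Context {R : realType} d {Omega : measurableType d} (P : probability Omega R).
Variables (AA : set (set Omega)) (Th Z r : nat -> Omega -> measurableTypeR R).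
Hypothesis mTh : forall k, measurable_fun setT (Th k).
Hypothesis mAA : AA `<=` measurable.
Hypothesis IAA : setI_closed AA.
Hypothesis TAA : AA setT.
Hypothesis iTh : independent_systems P (fun n => sigma_RV (Th n)).
Hypothesis iAA : forall A B, AA A -> sigma_seq Th B -> P (A `&` B) = (P A * P B)%E.
Hypothesis lTh : forall k B, measurable B ->
  P (Th k @^-1` B) = uniform_prob (@two_pi_gt0 R) B.
Hypothesis sZ : forall k, sigma_RV (Z k) `<=` <<s AA >>.
Hypothesis sr : forall k, sigma_RV (r k) `<=` <<s AA >>.

Let TO k := g_sigma_algebraType (others AA Th k).

(** Given everything except [Th k], the shift [v] is a constant. *)
Lemma integral_phase_shift k (v : Omega -> measurableTypeR R)
    (G : TO k * measurableTypeR R -> \bar R) :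
  measurable_fun setT (v : TO k -> measurableTypeR R) ->
  measurable_fun setT G -> (forall x, (0 <= G x)%E) ->
  (forall w y, G (w, (y + 2 * pi)%R) = G (w, y)) ->
  (\int[P]_w G (w, (Th k w + v w)%R) = \int[P]_w G (w, Th k w))%E.
Proof.
move=> mv mG G0 Gp.
pose mu : probability (measurableTypeR R) R := uniform_prob (@two_pi_gt0 R).
pose s (x : TO k * measurableTypeR R) : TO k * measurableTypeR R := (x.1, x.2 + v x.1).
have ms : measurable_fun setT s.
  apply/measurable_fun_pairP; split; first exact: measurable_fst.
  apply: measurable_funD; first exact: measurable_snd.
  exact: (measurableT_comp mv measurable_fst).
have mGs : measurable_fun setT (G \o s) by exact: measurableT_comp.
have lT B : measurable B -> P (Th k @^-1` B) = mu B by exact: lTh.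
rewrite (integral_one_coordinate mTh mAA IAA TAA iTh iAA lT mG G0).
have := integral_one_coordinate mTh mAA IAA TAA iTh iAA lT mGs (fun x => G0 (s x)).
rewrite /s/= => ->; apply: eq_integral => w _.
rewrite (@integral_uniform_shift R (v w) (fun y => G (w, y)))//.
have H : measurable_fun setT (fun y : measurableTypeR R => G (w, y)).
  pose c (y : measurableTypeR R) : TO k * measurableTypeR R := (w, y).
  have mc : measurable_fun setT c by apply/measurable_fun_pairP; split; [exact: measurable_cst|exact: measurable_id].
  exact: (measurableT_comp mG mc).
exact: H.
Qed.

Let measurable_r i : measurable_fun setT (r i).
Proof. exact: adapted_measurable mAA (@sr i). Qed.

Let measurable_Z i : measurable_fun setT (Z i).
Proof. exact: adapted_measurable mAA (@sZ i). Qed.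

(** The oscillators of index below [L] have already been moved forward by the
time [s], the others not: [L] interpolates between the sum at [t] and the sum
at [s + t]. *)
Definition trig_sum (L : nat) (s : R) (m : nat) (w : Omega) (t : R) : R :=
  \sum_(i < m) r i w * cos (Th i w + (if (i < L)%N then s else 0) * Z i w + t * Z i w).

(** [trig_sum] with the [k]-th phase turned into a free variable. *)
Let path_at k L s m (x : TO k * measurableTypeR R) (t : R) : R :=
  \sum_(i < m) r i x.1 *
    cos ((if val i == k then x.2 else Th i x.1 + (if (i < L)%N then s else 0) * Z i x.1)
         + t * Z i x.1).

Let measurable_path_at k L s m : measurable_fun setT
  (fun u : (TO k * measurableTypeR R) * measurableTypeR R => path_at L s m u.1 u.2).
Proof.
pose p1 (u : (TO k * measurableTypeR R) * measurableTypeR R) : TO k := u.1.1.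
have mp1 : measurable_fun setT p1 by apply: measurableT_comp; [exact: measurable_fst|exact: measurable_fst].
have mr i : measurable_fun setT (fun u => r i (p1 u)).
  exact: (measurableT_comp (@measurable_sub _ _ _ AA Th k (r i) (@sr i)) mp1).
have mZ i : measurable_fun setT (fun u => Z i (p1 u)).
  exact: (measurableT_comp (@measurable_sub _ _ _ AA Th k (Z i) (@sZ i)) mp1).
apply: measurable_sum => i; apply: measurable_funM; first exact: mr.
apply: (measurableT_comp (@measurable_cosine R)).
apply: measurable_funD; last first.
  by apply: measurable_funM; [exact: measurable_snd|exact: mZ].
case: eqP => [_|/eqP ik].
  exact: (measurableT_comp measurable_snd measurable_fst).
apply: measurable_funD.
  exact: (measurableT_comp (@measurable_other _ _ _ AA Th TAA k i ik) mp1).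
by apply: measurable_funM; [exact: measurable_cst|exact: mZ].
Qed.

Lemma measurable_trig_sum L s m : measurable_fun setT
  (fun u : Omega * measurableTypeR R => trig_sum L s m u.1 u.2).
Proof.
have mfst (u : Omega -> measurableTypeR R) : measurable_fun setT u ->
    measurable_fun setT (fun x : Omega * measurableTypeR R => u x.1).
  by move=> mu; exact: (measurableT_comp mu measurable_fst).
apply: measurable_sum => i; apply: measurable_funM.
  exact: mfst (measurable_r i).
apply: (measurableT_comp (@measurable_cosine R)).
apply: measurable_funD; last first.
  by apply: measurable_funM; [exact: measurable_snd|exact: mfst (measurable_Z i)].
apply: measurable_funD; first exact: mfst (mTh i).
by apply: measurable_funM; [exact: measurable_cst|exact: mfst (measurable_Z i)].
Qed.

(** Moving oscillator [L] forward by the time [s] adds [s * Z L] to its phase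
[Th L], and the phase is uniform given the rest. *)
Let excess_step N lam L s m :
  P [set w | excess N lam (trig_sum L s m w)] = P [set w | excess N lam (trig_sum L.+1 s m w)].
Proof.
pose D := [set x : TO L * measurableTypeR R | excess N lam (path_at L s m x)].
have mD : measurable D by apply: measurable_excess; exact: measurable_path_at.
pose G x : \bar R := (\1_D x)%:E.
have mG : measurable_fun setT G by apply/measurable_EFinP; exact: measurable_indic.
have mZ : measurable_fun setT (fun w : TO L => s * Z L w : measurableTypeR R).
  apply: measurable_funM; first exact: measurable_cst.
  exact: (@measurable_sub _ _ _ AA Th L (Z L) (@sZ L)).
have Gp w y : G (w, y + 2 * pi) = G (w, y).
  rewrite /G; congr (_%:E); rewrite !indicE; congr (_%:R); congr nat_of_bool.
  suff E : path_at L s m (w, y + 2 * pi) = path_at L s m (w, y) by apply/idP/idP; rewrite !inE /D/= E.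
  apply/funext => t; apply: eq_bigr => i _ /=; case: eqP => // _.
  by rewrite addrAC mulr_natl cosD2pi.
have G0 x : (0 <= G x)%E by rewrite lee_fin.
have PG (y : Omega -> R) L' :
    (forall w, @path_at L L s m (w, y w) = trig_sum L' s m w :> (R -> R)) ->
    P [set w | excess N lam (trig_sum L' s m w)] = (\int[P]_w G (w, y w))%E.
  move=> E; set A := [set w | _].
  have mA : measurable A by apply: measurable_excess; exact: measurable_trig_sum.
  transitivity (\int[P]_w (\1_A w)%:E)%E; first by rewrite integral_indic// setIT.
  apply: eq_integral => w _.
  rewrite /G; congr (_%:E); rewrite !indicE; congr (_%:R); congr nat_of_bool.
  have Ew : D (w, y w) = A w := congr1 (excess N lam) (E w).
  by apply/idP/idP; rewrite !inE Ew.
rewrite (PG (Th L) L).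
  rewrite (PG (fun w => Th L w + s * Z L w) L.+1).
    by rewrite (integral_phase_shift mZ mG G0 Gp).
  move=> w; apply/funext => t; apply: eq_bigr => i _ /=; rewrite ltnS.
  case: eqP => [->|/eqP iL]; first by rewrite leqnn.
  by rewrite [(i <= L)%N]leq_eqVlt -[X in X || _]/(val i == L) (negbTE iL).
move=> w; apply/funext => t; apply: eq_bigr => i _ /=.
by case: eqP => [->|//]; rewrite ltnn mul0r addr0.
Qed.

Lemma trig_sum_shift L s m w t : (m <= L)%N ->
  trig_sum L s m w t = trig_sum 0 0 m w (s + t).
Proof.
move=> mL; apply: eq_bigr => i _; rewrite (leq_trans (ltn_ord i) mL) mul0r addr0.
by rewrite mulrDl addrA.
Qed.

Lemma excess_stationary N lam s m :
  P [set w | excess N lam (fun t => trig_sum 0 0 m w (s + t))] =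
  P [set w | excess N lam (trig_sum 0 0 m w)].
Proof.
have H L : P [set w | excess N lam (trig_sum L s m w)] =
    P [set w | excess N lam (trig_sum 0 s m w)].
  by elim: L => [//|L IH]; rewrite -IH; apply/esym/excess_step.
transitivity (P [set w | excess N lam (trig_sum m s m w)]).
  congr (P _); apply/seteqP; split => w /=;
  by rewrite (_ : trig_sum m s m w = (fun t => trig_sum 0 0 m w (s + t)))//;
     apply/funext => t; rewrite trig_sum_shift.
rewrite H; congr (P _); apply/seteqP; split => w /=;
  by rewrite (_ : trig_sum 0 s m w = trig_sum 0 0 m w).
Qed.

Lemma trig_sum0 m w t :
  trig_sum 0 0 m w t = \sum_(i < m) r i w * cos (Th i w + t * Z i w).
Proof. by apply: eq_bigr => i _; rewrite mul0r addr0. Qed.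

(** Averaging the integrand over [y] and [y + pi] kills the cross term. *)
Let integral_random_phase (a b c : R) :
  (\int[uniform_prob (@two_pi_gt0 R)]_y ((a + b * cos (y + c)) ^+ 2)%:E <=
    (a ^+ 2 + b ^+ 2)%:E)%E.
Proof.
pose mu : probability (measurableTypeR R) R := uniform_prob (@two_pi_gt0 R).
pose f (y : R) : \bar R := ((a + b * cos (y + c)) ^+ 2)%:E.
have mf : measurable_fun setT f.
  apply/measurable_EFinP; apply: measurable_funX; apply: measurable_funD => //.
  apply: measurable_funM => //; apply: (measurableT_comp (@measurable_cosine R)).
  by apply: measurable_funD => //; exact: measurable_cst.
have f0 y : (0 <= f y)%E by rewrite lee_fin sqr_ge0.
have fp y : f (y + 2 * pi) = f y by rewrite /f addrAC mulr_natl cosD2pi.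
have mfs : measurable_fun setT (fun y : R => f (y + pi)).
  by apply: (measurableT_comp mf); apply: measurable_funD => //; exact: measurable_cst.
set I := (X in (X <= _)%E).
have I2 : (I + I <= (2 * (a ^+ 2 + b ^+ 2))%:E)%E.
  rewrite {1}/I -(integral_uniform_shift pi mf f0 fp) -ge0_integralD//; try by move=> y _; exact: f0.
  apply: (@le_trans _ _ (\int[mu]_y (cst (2 * (a ^+ 2 + b ^+ 2))%:E y))%E).
    apply: ge0_le_integral => //.
    - by move=> y _; rewrite adde_ge0// /f lee_fin sqr_ge0.
    - exact: emeasurable_funD.
    - move=> y _; rewrite /f -EFinD lee_fin addrAC cosDpi.
      set x := cos _; have x1 : 0 <= b ^+ 2 * (1 - x ^+ 2).
        rewrite mulr_ge0 ?sqr_ge0// subr_ge0 -(cos2Dsin2 (y + c)) lerDl sqr_ge0//.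
      by move: x1; nra.
  by rewrite integral_cst// [X in (_ * X)%E]probability_setT mule1.
have I0 : (0 <= I)%E by apply: integral_ge0 => y _; rewrite lee_fin sqr_ge0.
move: I2 I0; case: I => [i| |]//; rewrite -EFinD !lee_fin => h _; lra.
Qed.

Let measurable_of_sub k d' (U : measurableType d') (u : Omega -> U) :
  measurable_fun setT (u : TO k -> U) -> measurable_fun setT u.
Proof.
move=> mu _ B mB; rewrite setTI; apply: (@sigma_others_measurable _ _ _ AA Th mTh mAA k).
by have := mu measurableT B mB; rewrite setTI.
Qed.

(** Oscillators with independent uniform phases are orthogonal; the phases are
integrated out one at a time, the last one first. *)
Lemma second_moment m t :
  (\int[P]_w ((trig_sum 0 0 m w t) ^+ 2)%:E <= \int[P]_w (\sum_(i < m) r i w ^+ 2)%:E)%E.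
Proof.
under eq_integral do rewrite trig_sum0.
elim: m => [|m IH].
  rewrite le_eqVlt; apply/orP; left; apply/eqP; apply: eq_integral => w _.
  by rewrite !big_ord0 expr0n.
pose S w : measurableTypeR R := \sum_(i < m) r i w * cos (Th i w + t * Z i w).
have mS : measurable_fun setT (S : TO m -> measurableTypeR R).
  apply: measurable_sum => i.
  apply: measurable_funM; first exact: (@measurable_sub _ _ _ AA Th m (r i) (@sr i)).
  apply: (measurableT_comp (@measurable_cosine R)); apply: measurable_funD.
    by apply: (@measurable_other _ _ _ AA Th TAA m i); rewrite neq_ltn ltn_ord.
  apply: measurable_funM; first exact: measurable_cst.
  exact: (@measurable_sub _ _ _ AA Th m (Z i) (@sZ i)).
have mSO : measurable_fun setT (S : Omega -> measurableTypeR R).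
  apply: measurable_sum => i; apply: measurable_funM; first exact: measurable_r.
  apply: (measurableT_comp (@measurable_cosine R)); apply: measurable_funD; first exact: mTh.
  by apply: measurable_funM; [exact: measurable_cst|exact: measurable_Z].
pose G (x : TO m * measurableTypeR R) : \bar R :=
  ((S x.1 + r m x.1 * cos (x.2 + t * Z m x.1)) ^+ 2)%:E.
have mG : measurable_fun setT G.
  apply/measurable_EFinP; apply: measurable_funX; apply: measurable_funD.
    exact: (measurableT_comp mS measurable_fst).
  apply: measurable_funM.
    exact: (measurableT_comp (@measurable_sub _ _ _ AA Th m (r m) (@sr m)) measurable_fst).
  apply: (measurableT_comp (@measurable_cosine R)); apply: measurable_funD.
    exact: measurable_snd.
  apply: measurable_funM; first exact: measurable_cst.
  exact: (measurableT_comp (@measurable_sub _ _ _ AA Th m (Z m) (@sZ m)) measurable_fst).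
have G0 x : (0 <= G x)%E by rewrite lee_fin sqr_ge0.
have lT B : measurable B -> P (Th m @^-1` B) = uniform_prob (@two_pi_gt0 R) B by exact: lTh.
have E := integral_one_coordinate mTh mAA IAA TAA iTh iAA lT mG G0.
rewrite (eq_integral (fun w => G (w, Th m w))); last first.
  by move=> w _; rewrite /G big_ord_recr.
rewrite E.
have mr : measurable_fun setT (fun w : Omega => r m w ^+ 2).
  by apply: measurable_funX; exact: measurable_r.
have mS2 : measurable_fun setT (fun w : Omega => S w ^+ 2) by exact: measurable_funX.
have mrs : measurable_fun setT (fun w : Omega => \sum_(i < m) r i w ^+ 2).
  by apply: measurable_sum => i; apply: measurable_funX; exact: measurable_r.
apply: (@le_trans _ _ (\int[P]_w ((S w ^+ 2)%:E + (r m w ^+ 2)%:E))%E).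
  apply: ge0_le_integral => //.
  - by move=> w _; apply: integral_ge0.
  - have := @measurable_fun_fubini_tonelli_F _ _ _ _ _ (uniform_prob (@two_pi_gt0 R)) _ mG G0.
    exact: measurable_of_sub.
  - by apply: emeasurable_funD; exact/measurable_EFinP.
  - by move=> w _; exact: (integral_random_phase (S w) (r m w) (t * Z m w)).
rewrite ge0_integralD//; try solve [by move=> w _; rewrite lee_fin sqr_ge0
  | exact/measurable_EFinP].
rewrite [leRHS](_ : _ = (\int[P]_w ((\sum_(i < m) r i w ^+ 2)%:E + (r m w ^+ 2)%:E))%E); last first.
  by apply: eq_integral => w _; rewrite big_ord_recr.
rewrite ge0_integralD//; try solve [by move=> w _; rewrite lee_fin ?sumr_ge0// => *; rewrite sqr_ge0
  | exact/measurable_EFinP].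
by rewrite leeD2r.
Qed.

(** By stationarity the event has the same probability when the time origin is
moved to [i = 0, ..., N - 1]. The counting inequality bounds [lam] times the
number of these [i] for which it occurs by the energy on [[0, 2N]], whose
expectation is at most [2 N eps]. *)
Lemma excess_maximal_inequality N lam eps m : 0 < lam -> (0 < N)%N ->
  (forall w, \sum_(i < m) r i w ^+ 2 <= eps) ->
  (P [set w | excess N lam (trig_sum 0 0 m w)] <= (2 * eps / lam)%:E)%E.
Proof.
move=> lam0 N0 reps.
pose W := trig_sum 0 0 m.
pose B i := [set w | excess N lam (fun t => W w (i%:R + t))].
have mW : measurable_fun setT (fun u : Omega * measurableTypeR R => W u.1 u.2).
  exact: measurable_trig_sum.
have mB i : measurable (B i).
  apply: measurable_excess; pose sh (u : Omega * measurableTypeR R) :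
    Omega * measurableTypeR R := (u.1, i%:R + u.2).
  have msh : measurable_fun setT sh.
    apply/measurable_fun_pairP; split; first exact: measurable_fst.
    by apply: measurable_funD; [exact: measurable_cst|exact: measurable_snd].
  exact: (measurableT_comp mW msh).
have PB i : P (B i) = P (B 0%N).
  rewrite /B (excess_stationary N lam i%:R m); congr (P _); apply/seteqP.
  by split => w /=; rewrite (_ : (fun t => W w (0 + t)) = W w)//; apply/funext => t; rewrite add0r.
have energy_le j : (\int[P]_w energy (W w) j <= eps%:E)%E.
  have mf := measurable_path_square mW j.
  rewrite /energy (fubini_tonelli _ mf); last by move=> u; rewrite lee_fin sqr_ge0.
  have le1 t : (\int[P]_w ((W w (j%:R + t)) ^+ 2)%:E <= eps%:E)%E.
    apply: (le_trans (second_moment m _)).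
    apply: (@le_trans _ _ (\int[P]_w (cst eps%:E w))%E).
      apply: ge0_le_integral => //.
      - by move=> w _; rewrite lee_fin sumr_ge0// => i _; rewrite sqr_ge0.
      - apply/measurable_EFinP; apply: measurable_sum => i; apply: measurable_funX.
        exact: measurable_r.
      - by move=> w _; rewrite lee_fin.
    by rewrite integral_cst// [X in (_ * X)%E]probability_setT mule1.
  apply: (@le_trans _ _ (\int[unit_uniform]_t (cst eps%:E t))%E).
    apply: ge0_le_integral => //.
    - by move=> t _; apply: integral_ge0 => w _; rewrite lee_fin sqr_ge0.
    - have := @measurable_fun_fubini_tonelli_G _ _ _ _ _ P _ mf; apply.
      by move=> u; rewrite lee_fin sqr_ge0.
    - by move=> t _; exact: le1.
  by rewrite integral_cst// [X in (_ * X)%E]probability_setT mule1.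
have count w : (\sum_(0 <= i < N) (if `[< B i w >] then lam%:E else 0) <=
    \sum_(0 <= j < N + N) energy (W w) j)%E.
  apply: maximal_inequality_counting => [j||i /asboolP [T TN hT]].
  - exact: energy_ge0.
  - exact: ltW.
  - exists T => //; apply: ltW; apply: (lt_le_trans hT).
    have -> : (\sum_(i <= j < i + T) energy (W w) j = \sum_(0 <= j < T) energy (W w) (j + i)%N)%E.
      by rewrite -{1}(add0n i) big_addn addKn.
    by apply: lee_sum => j _; rewrite energy_shift addnC.
have indE i : (fun w => if `[< B i w >] then lam%:E else 0%E : \bar R) =
    (fun w => lam%:E * (\1_(B i) w)%:E)%E.
  apply/funext => w; rewrite indicE; case: asboolP => [Bw|nBw].
    by rewrite mem_set// mule1.
  by rewrite memNset// mule0.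
have mind i : measurable_fun setT (fun w => if `[< B i w >] then lam%:E else 0%E : \bar R).
  rewrite indE; apply: emeasurable_funM; first exact: measurable_cst.
  by apply/measurable_EFinP; exact: measurable_indic.
have Iind i : (\int[P]_w (if `[< B i w >] then lam%:E else 0) = lam%:E * P (B 0%N))%E.
  rewrite -(PB i) indE ge0_integralZl//; last by rewrite lee_fin ltW.
    by rewrite integral_indic// setIT.
  by apply/measurable_EFinP; exact: measurable_indic.
have ind0 i w : (0 <= (if `[< B i w >] then lam%:E else 0) :> \bar R)%E.
  by case: ifP => // _; rewrite lee_fin ltW.
have le_int : (\int[P]_w (\sum_(0 <= i < N) (if `[< B i w >] then lam%:E else 0)) <=
    \int[P]_w (\sum_(0 <= j < N + N) energy (W w) j))%E.
  apply: ge0_le_integral => //.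
  - by move=> w _; apply: sume_ge0.
  - by apply: emeasurable_sum.
  - by apply: emeasurable_sum => j; exact: measurable_energy.
have : (\sum_(0 <= i < N) lam%:E * P (B 0%N) <= \sum_(0 <= j < N + N) eps%:E)%E.
  apply: le_trans (le_trans le_int _).
    rewrite ge0_integral_sum// le_eqVlt; apply/orP; left; apply/eqP.
    by apply: eq_bigr => i _; rewrite Iind.
  rewrite ge0_integral_sum//.
  - by apply: lee_sum.
  - by move=> j; exact: measurable_energy.
  - by move=> j w _; exact: energy_ge0.
have <- : P (B 0%N) = P [set w | excess N lam (trig_sum 0 0 m w)].
  congr (P _); apply/seteqP.
  by split => w /=; rewrite /B/= (_ : (fun t => W w (0 + t)) = W w)//; apply/funext => t; rewrite add0r.
have /fineK <- : P (B 0%N) \is a fin_num by rewrite fin_num_measure.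
rewrite -EFinM !sumEFin !lee_fin !sumr_const_nat !subn0.
rewrite -[X in X <= _]mulr_natr -[X in _ <= X]mulr_natr natrD => h.
rewrite ler_pdivlMr// -(@ler_pM2r _ N%:R) ?ltr0n//.
rewrite [leLHS](_ : _ = lam * fine (P (B 0%N)) * N%:R); last by ring.
by apply: (le_trans h); rewrite le_eqVlt; apply/orP; left; apply/eqP; ring.
Qed.

End stationary_random_trigonometric_sums.

(** * Mean-square approximation of the path, uniformly over horizons *)

Section convergence_along_time.
Context {R : realType}.

Lemma cvg_sum_nat (n : nat) (u : nat -> nat -> R) (l : nat -> R) :
  (forall j, u j m @[m --> \oo] --> l j) ->
  \sum_(0 <= j < n) u j m @[m --> \oo] --> \sum_(0 <= j < n) l j.
Proof.
move=> ul; elim: n => [|n IH].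
  by rewrite big_geq//; under eq_fun do rewrite big_geq//; exact: cvg_cst.
rewrite big_nat_recr//=; under eq_fun do rewrite big_nat_recr//=.
exact: cvgD.
Qed.

Lemma lt_limn_einf (u : (\bar R)^nat) (l : \bar R) : (l < limn_einf u)%E ->
  \forall n \near \oo, (l < u n)%E.
Proof.
rewrite limn_einf_lim (cvg_lim _ (@cvg_einfs_sup _ u))//.
move=> /ereal_sup_gt[_ [n _ <-] ln]; exists n => // m /= nm.
by apply: (lt_le_trans ln); apply: ereal_inf_lbound; exists m.
Qed.

(** Fatou: the strict lower bound on the energy of the limit is inherited by
the terms of large index. *)
Lemma excess_limit N lam (F : nat -> R -> R) (f : R -> R) :
  (forall m, measurable_fun setT (F m)) -> measurable_fun setT f ->
  (forall j : nat, {ae @unit_uniform R, forall t,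
     F m (j%:R + t) @[m --> \oo] --> f (j%:R + t)}) ->
  excess N lam f -> \forall m \near \oo, excess N lam (F m).
Proof.
move=> mF mf cF [T TN hT].
have msh (g : R -> R) (j : nat) : measurable_fun setT g ->
    measurable_fun setT (fun t : measurableTypeR R => ((g (j%:R + t)) ^+ 2)%:E).
  move=> mg; apply/measurable_EFinP; apply: measurable_funX; apply: (measurableT_comp mg).
  by apply: measurable_funD => //; exact: measurable_cst.
pose h m t : \bar R := (\sum_(0 <= j < T) (F m (j%:R + t) ^+ 2)%:E)%E.
have mh m : measurable_fun setT (h m : measurableTypeR R -> \bar R).
  by apply: emeasurable_sum => j; exact: msh.
have h0 m t : (0 <= h m t)%E by apply: sume_ge0 => j _; rewrite lee_fin sqr_ge0.
have hE m : (\sum_(0 <= j < T) energy (F m) j = \int[@unit_uniform R]_t h m t)%E.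
  rewrite ge0_integral_sum// => [j|j t _]; first exact: msh.
  by rewrite lee_fin sqr_ge0.
have : ((lam * T%:R)%:E < limn_einf (fun m => \int[@unit_uniform R]_t h m t))%E.
  apply: (lt_le_trans hT); apply: le_trans (fatou _ measurableT mh (fun m t _ => h0 m t)).
  rewrite /energy -ge0_integral_sum//; last 2 first.
  - by move=> j; exact: msh.
  - by move=> j t _; rewrite lee_fin sqr_ge0.
  apply: ae_ge0_le_integral => //.
  - by move=> t _; apply: sume_ge0 => j _; rewrite lee_fin sqr_ge0.
  - by apply: emeasurable_sum => j; exact: msh.
  - move=> t _; rewrite limn_einf_lim (cvg_lim _ (@cvg_einfs_sup _ _))//.
    apply: (@le_trans _ _ (einfs (h^~ t) 0%N)); last by apply: ereal_sup_ubound; exists 0%N.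
    by apply: le_ereal_inf_tmp => _ [m _ <-].
  - apply: measurableT_comp => //; apply: measurable_fun_limn_esup => m.
    exact: measurableT_comp.
  - have : {ae @unit_uniform R, forall t, forall j : nat,
        F m (j%:R + t) @[m --> \oo] --> f (j%:R + t)} by exact: ae_foralln.
    apply: negligibleS => t /=; apply: contra_not => ct _.
    have : h m t @[m --> \oo] --> (\sum_(0 <= j < T) (f (j%:R + t) ^+ 2)%:E)%E.
      rewrite /h sumEFin; under eq_fun do rewrite sumEFin.
      apply: cvg_EFin; first by apply: nearW.
      apply: (@cvg_sum_nat _ (fun j m => F m (j%:R + t) ^+ 2)) => j.
      rewrite expr2; under eq_fun do rewrite expr2.
      exact: cvgM.
    by move=> /cvg_limn_einf_sup[-> _].
move=> /lt_limn_einf; apply: filterS => m; rewrite -hE => hm.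
by exists T.
Qed.

Context d {Omega : measurableType d} (P : probability Omega R).

(** Exchange of quantifiers by Tonelli: the set of pairs (w, t) without
convergence is negligible for the product measure. *)
Lemma ae_cvg_along_time (F : nat -> Omega -> R -> R) (X : Omega -> R -> R) :
  (forall m, measurable_fun setT (fun u : Omega * measurableTypeR R => F m u.1 u.2)) ->
  measurable_fun setT (fun u : Omega * measurableTypeR R => X u.1 u.2) ->
  (forall t, {ae P, forall w, F m w t @[m --> \oo] --> X w t}) ->
  {ae P, forall w, forall j : nat, {ae @unit_uniform R, forall t,
     F m w (j%:R + t) @[m --> \oo] --> X w (j%:R + t)}}.
Proof.
move=> mF mX cF; apply: ae_foralln => j.
pose D (q m : nat) : set (Omega * measurableTypeR R) :=
  [set u | `|X u.1 (j%:R + u.2) - F m u.1 (j%:R + u.2)| < q.+1%:R^-1].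
pose C := \bigcap_q \bigcup_M \bigcap_(m in [set m | (M <= m)%N]) D q m.
have mD q m : measurable (D q m).
  pose sh (u : Omega * measurableTypeR R) : Omega * measurableTypeR R := (u.1, j%:R + u.2).
  have msh : measurable_fun setT sh.
    apply/measurable_fun_pairP; split; first exact: measurable_fst.
    by apply: measurable_funD; [exact: measurable_cst|exact: measurable_snd].
  have mg : measurable_fun setT (fun u => `|X (sh u).1 (sh u).2 - F m (sh u).1 (sh u).2|).
    apply: measurableT_comp => //; apply: measurable_funB.
      exact: (measurableT_comp mX msh).
    exact: (measurableT_comp (mF m) msh).
  rewrite (_ : D q m = setT `&` (fun u => `|X (sh u).1 (sh u).2 - F m (sh u).1 (sh u).2|) @^-1`
    [set` `]-oo, q.+1%:R^-1[]); first by apply: mg => //; exact: measurable_itv.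
  by rewrite setTI; apply/seteqP; split => u /=; rewrite in_itv.
have mC : measurable C.
  apply: bigcapT_measurable => q; apply: bigcupT_measurable => M.
  by apply: bigcap_measurable => [|m _]; [exists M => /=|exact: mD].
have CP w t : C (w, t) <-> F m w (j%:R + t) @[m --> \oo] --> X w (j%:R + t).
  split => [Cwt|/cvgrPdist_lt cwt q _].
    apply/cvgrPdist_lt => e e0.
    have [q qe] : exists q : nat, q.+1%:R^-1 < e.
      by have [q _ /(_ q (leqnn _)) qe] := near_infty_natSinv_lt (PosNum e0); exists q.
    have [M _ HM] := Cwt q Logic.I; exists M => // m Mm.
    exact: lt_trans (HM m Mm) qe.
  have q0 : (0 : R) < q.+1%:R^-1 by rewrite invr_gt0.
  by have [M _ HM] := cwt _ q0; exists M => // m Mm; exact: HM.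
pose G (u : Omega * measurableTypeR R) : \bar R := (\1_(~` C) u)%:E.
have mG : measurable_fun setT G.
  by apply/measurable_EFinP; apply: measurable_indic; exact: measurableC.
have G0 u : (0 <= G u)%E by rewrite lee_fin.
have GE w t : G (w, t) = (\1_(~` [set t | C (w, t)]) t)%:E.
  by rewrite /G !indicE; congr (_%:R%:E); congr nat_of_bool; apply/idP/idP; rewrite !inE.
have I0 : (\int[P]_w \int[@unit_uniform R]_t G (w, t) = 0)%E.
  rewrite (fubini_tonelli _ mG)//; apply: integral0_eq => t _.
  have mt : measurable [set w | ~ C (w, t)].
    rewrite (_ : [set w | _] = ysection (~` C) t).
      by apply: measurable_ysection; exact: measurableC.
    by apply/seteqP; split => w; rewrite /ysection/= inE.
  rewrite (eq_integral (fun w => (\1_[set w | ~ C (w, t)] w)%:E)); last first.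
    by move=> w _; rewrite /G !indicE; congr (_%:R%:E); congr nat_of_bool; apply/idP/idP; rewrite !inE.
  rewrite integral_indic// setIT; apply: measure_negligible => //.
  have := cF (j%:R + t); apply: negligibleS => w /=; apply: contra_not.
  by move=> ?; apply/CP.
have mI := @measurable_fun_fubini_tonelli_F _ _ _ _ _ (@unit_uniform R) _ mG G0.
have I0' w : (0 <= \int[@unit_uniform R]_t G (w, t))%E by apply: integral_ge0.
have : ae_eq P setT (fun w => \int[@unit_uniform R]_t G (w, t))%E (cst 0%E).
  apply/ae_eq_integral_abs => //; rewrite -[RHS]I0; apply: eq_integral => w _.
  by rewrite gee0_abs.
apply: filterS => w /(_ Logic.I) /= Gw.
have mw : measurable (xsection (~` C) w).
  by apply: measurable_xsection; exact: measurableC.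
exists (xsection (~` C) w); split => //.
- rewrite -Gw -[xsection _ _]setIT -[LHS]integral_indic//; apply: eq_integral => t _.
  rewrite /G !indicE; congr (_%:R%:E); congr nat_of_bool.
  by apply/idP/idP; rewrite /xsection/= !inE/= inE.
- by move=> t; rewrite /xsection/= inE; apply: contra_not => /= ?; apply/CP.
Qed.

End convergence_along_time.

Lemma measurable_superlevel (R : realType) d (T : measurableType d) (f : T -> R) a :
  measurable_fun setT f -> measurable [set x | a < f x].
Proof.
move=> mf; rewrite (_ : [set x | _] = setT `&` f @^-1` [set` `]a, +oo[]).
  by apply: mf => //; exact: measurable_itv.
by rewrite setTI; apply/seteqP; split => x /=; rewrite in_itv/= andbT.
Qed.

Section tail_control.
Context {R : realType} d {Omega : measurableType d} (P : probability Omega R).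
Variables (AA : set (set Omega)) (Th Z c : nat -> Omega -> measurableTypeR R).
Hypothesis mTh : forall k, measurable_fun setT (Th k).
Hypothesis mAA : AA `<=` measurable.
Hypothesis IAA : setI_closed AA.
Hypothesis TAA : AA setT.
Hypothesis iTh : independent_systems P (fun n => sigma_RV (Th n)).
Hypothesis iAA : forall A B, AA A -> sigma_seq Th B -> P (A `&` B) = (P A * P B)%E.
Hypothesis lTh : forall k B, measurable B ->
  P (Th k @^-1` B) = uniform_prob (@two_pi_gt0 R) B.
Hypothesis sZ : forall k, sigma_RV (Z k) `<=` <<s AA >>.
Hypothesis sc : forall k, sigma_RV (c k) `<=` <<s AA >>.
Variable X : Omega -> R -> R.
Hypothesis mX : measurable_fun setT (fun u : Omega * measurableTypeR R => X u.1 u.2).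

Definition partial_sum (n : nat) (w : Omega) (t : R) : R :=
  \sum_(0 <= k < n) c k w * cos (Th k w + t * Z k w).

Hypothesis cvX : forall t, {ae P, forall w, partial_sum n w t @[n --> \oo] --> X w t}.
Hypothesis cvc : {ae P, forall w, cvgn (series (fun k => c k w ^+ 2))}.

Let gAA := g_sigma_algebraType AA.

Let mc k : measurable_fun setT (c k).
Proof. exact: adapted_measurable mAA (@sc k). Qed.

Let mcA k : measurable_fun setT (c k : gAA -> measurableTypeR R).
Proof. by apply/adaptedP; exact: sc. Qed.

Let mY n : measurable_fun setT
  (fun u : Omega * measurableTypeR R => partial_sum n u.1 u.2).
Proof.
have mfst (u : Omega -> measurableTypeR R) : measurable_fun setT u ->
    measurable_fun setT (fun x : Omega * measurableTypeR R => u x.1).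
  by move=> mu; exact: (measurableT_comp mu measurable_fst).
apply: measurable_sum => i; apply: measurable_funM.
  exact: mfst (mc i).
apply: (measurableT_comp (@measurable_cosine R)).
apply: measurable_funD; first exact: mfst (mTh i).
by apply: measurable_funM; [exact: measurable_snd|exact: mfst (adapted_measurable mAA (@sZ i))].
Qed.

Let big_tail (eps : R) n : set Omega :=
  \bigcup_m [set w | eps < \sum_(n <= k < m) c k w ^+ 2].

Let measurable_big_tail eps n : measurable (big_tail eps n).
Proof.
apply: bigcupT_measurable => m; apply: measurable_superlevel.
by apply: measurable_sum => k; apply: measurable_funX; exact: mc.
Qed.

(** The events decrease, and on their intersection the series of squares is
not Cauchy. *)
Let big_tail_cvg0 eps : 0 < eps -> P (big_tail eps n) @[n --> \oo] --> 0%E.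
Proof.
move=> eps0.
have -> : 0%E = P (\bigcap_n big_tail eps n).
  apply/esym/measure_negligible; first exact: bigcapT_measurable.
  move: cvc; apply: negligibleS => w /= tail.
  move=> /cauchy_cvgP/cauchy_seriesP/(_ _ eps0) [[A B] /= [[n1 _ A1] [n2 _ B2]] AB].
  pose n := maxn n1 n2.
  have [m _ /= h] := tail n Logic.I.
  have nm : (n <= m)%N.
    by rewrite leqNgt; apply/negP => mn; move: h; rewrite big_geq ?ltNge ?(ltW eps0)// ltnW.
  have := AB (n, m) (conj (A1 n (leq_maxl _ _)) (B2 m (leq_trans (leq_maxr _ _) nm))).
  by rewrite /= ltNge (le_trans (ltW h))// ler_norm.
apply: nonincreasing_cvg_mu => //.
- by rewrite (le_lt_trans (probability_le1 _ _)) ?ltry.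
- exact: bigcapT_measurable.
- move=> a b ab; apply/subsetPset => w [m _ h]; exists m => //.
  apply: (lt_le_trans h).
  have [mb|bm] := leqP m b.
    by rewrite big_geq// sumr_ge0// => i _; rewrite sqr_ge0.
  rewrite [leRHS](big_cat_nat ab (ltnW bm))/= lerDr sumr_ge0// => i _.
  by rewrite sqr_ge0.
Qed.

(** The maximal inequality requires a deterministic bound on the sum of squares.
It is applied to the amplitudes multiplied by the indicator of the event [A]
that the tail is small; that event depends on the amplitudes only, so the
phases remain independent and uniform. *)
Let truncated_bound (eps lam : R) N n m : 0 < eps -> 0 < lam -> (0 < N)%N -> (n <= m)%N ->
  (P [set w | excess N lam (fun t => partial_sum m w t - partial_sum n w t)%R] <=
    P (big_tail eps n) + (2 * eps / lam)%:E)%E.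
Proof.
move=> eps0 lam0 N0 nm.
pose A : set Omega := [set w | \sum_(n <= k < m) c k w ^+ 2 <= eps].
have mA : measurable (A : set gAA).
  rewrite (_ : A = ~` [set w | eps < \sum_(n <= k < m) c k w ^+ 2]).
    apply: measurableC; apply: (@measurable_superlevel _ _ gAA).
    by apply: measurable_sum => k; apply: measurable_funX; exact: mcA.
  by apply/seteqP; split => w /=; rewrite /A/= leNgt => /negP.
pose r k w : measurableTypeR R := if (n <= k)%N then c k w * \1_A w else 0.
have sr k : sigma_RV (r k) `<=` <<s AA >>.
  apply/adaptedP; rewrite /r; have [_|_] := leqP n k; last exact: measurable_cst.
  apply: measurable_funM; first exact: mcA.
  exact: measurable_indic.
have rle w : \sum_(i < m) r i w ^+ 2 <= eps.
  rewrite -(big_mkord xpredT (fun i => r i w ^+ 2)) (big_cat_nat _ nm)//=.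
  rewrite big1_seq ?add0r; last first.
    move=> i /andP[_]; rewrite mem_index_iota /r => /andP[_ ni].
    by rewrite leqNgt ni expr0n.
  rewrite (eq_big_nat _ _ (F2 := fun i => c i w ^+ 2 * \1_A w)); last first.
    move=> i /andP[ni _]; rewrite /r ni exprMn; congr (_ * _).
    by rewrite indicE; case: (_ \in _); rewrite ?expr1n ?expr0n.
  rewrite -mulr_suml indicE; have [Aw|nAw] := boolP (w \in A).
    by rewrite mulr1; exact/set_mem.
  by rewrite mulr0 ltW.
have maxi := excess_maximal_inequality mTh mAA IAA TAA iTh iAA lTh sZ sr lam0 N0 rle.
have mE : measurable [set w | excess N lam (fun t => partial_sum m w t - partial_sum n w t)].
  apply: (@measurable_excess _ _ _ (fun w t => partial_sum m w t - partial_sum n w t)).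
  by apply: measurable_funB; exact: mY.
have mT : measurable [set w | excess N lam (trig_sum Th Z r 0 0 m w)].
  apply: measurable_excess; exact: (measurable_trig_sum mTh mAA sZ sr).
apply: (@le_trans _ _ (P (big_tail eps n `|`
    [set w | excess N lam (trig_sum Th Z r 0 0 m w)]))).
  apply: le_measure; rewrite ?inE//; first exact: measurableU.
  move=> w /= ew; have [Aw|nAw] := pselect (A w); [right|left].
    rewrite (_ : trig_sum Th Z r 0 0 m w = (fun t => partial_sum m w t - partial_sum n w t))//.
    apply/funext => t; rewrite trig_sum0 /partial_sum (big_cat_nat _ nm)//= addrAC subrr add0r.
    rewrite -(big_mkord xpredT (fun i => r i w * cos (Th i w + t * Z i w))) (big_cat_nat _ nm)//=.
    rewrite big1_seq ?add0r; last first.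
      move=> i /andP[_]; rewrite mem_index_iota /r => /andP[_ ni].
      by rewrite leqNgt ni mul0r.
    by apply: eq_big_nat => i /andP[ni _]; rewrite /r ni indicE mem_set// mulr1.
  by exists m => //=; move/negP : nAw; rewrite /A/= -ltNge.
by apply: (le_trans (measureU2 _ _ _)) => //; rewrite leeD2l.
Qed.

Let excess_tail N lam n : set Omega :=
  [set w | excess N lam (fun t => X w t - partial_sum n w t)].

Let measurable_excess_tail N lam n : measurable (excess_tail N lam n).
Proof.
apply: (@measurable_excess _ _ _ (fun w t => X w t - partial_sum n w t)).
by apply: measurable_funB; [exact: mX|exact: mY].
Qed.

(** Letting [m] tend to infinity: an excess of [X - partial_sum n] is, almost
surely, an excess of [partial_sum m - partial_sum n] for all large [m]. *)
Let excess_tail_bound (eps lam : R) N n : 0 < eps -> 0 < lam -> (0 < N)%N ->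
  (P (excess_tail N lam n) <= P (big_tail eps n) + (2 * eps / lam)%:E)%E.
Proof.
move=> eps0 lam0 N0; set bound := (_ + _)%E.
pose F m w t := partial_sum m w t - partial_sum n w t.
pose B m := [set w | excess N lam (F m w)].
have mF m : measurable_fun setT (fun u : Omega * measurableTypeR R => F m u.1 u.2).
  by apply: measurable_funB; exact: mY.
have mB m : measurable (B m) by apply: measurable_excess.
pose G M := \bigcap_(m in [set m | (M <= m)%N]) B m.
have mG M : measurable (G M).
  by apply: bigcap_measurable => [|m _]; [exists M => /=|exact: mB].
have mX1 w : measurable_fun setT (X w).
  exact: (measurableT_comp mX (pair1_measurable w)).
have mY1 m w : measurable_fun setT (partial_sum m w).
  exact: (measurableT_comp (mY m) (pair1_measurable w)).
have GP : (P (\bigcup_M G M) <= bound)%E.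
  have ndG : nondecreasing_seq G.
    by move=> a b ab; apply/subsetPset => w Gw m /= bm; apply: Gw; exact: leq_trans bm.
  have cG := @nondecreasing_cvg_mu _ _ _ P _ mG (bigcupT_measurable _ mG) ndG.
  rewrite -(cvg_lim _ cG)//; apply: lime_le; first by apply/cvg_ex; eexists; exact: cG.
  apply: nearW => M /=; apply: (@le_trans _ _ (P (B (maxn M n)))).
    by apply: le_measure; rewrite ?inE// => w; apply => /=; exact: leq_maxl.
  by apply: truncated_bound => //; exact: leq_maxr.
apply: le_trans GP.
have mXn : measurable_fun setT (fun u : Omega * measurableTypeR R => X u.1 u.2 - partial_sum n u.1 u.2).
  by apply: measurable_funB; [exact: mX|exact: mY].
have cF t : {ae P, forall w, F m w t @[m --> \oo] --> X w t - partial_sum n w t}.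
  by apply: filterS (cvX t) => w cw; apply: cvgB => //; exact: cvg_cst.
have [N1 [mN1 N10 hN1]] := @ae_cvg_along_time _ _ _ P F (fun w t => X w t - partial_sum n w t) mF mXn cF.
apply: (@le_trans _ _ (P (\bigcup_M G M `|` N1))).
  apply: le_measure; rewrite ?inE//; first by apply: measurableU => //; exact: bigcupT_measurable.
  move=> w ew; have [nw|nw] := pselect (N1 w); [by right|left].
  have cw : forall j : nat, {ae @unit_uniform R, forall t,
      F m w (j%:R + t) @[m --> \oo] --> X w (j%:R + t) - partial_sum n w (j%:R + t)}.
    by apply: contrapT => h; apply: nw; apply: hN1.
  have [M _ HM] := excess_limit (fun m => measurable_funB (mY1 m w) (mY1 n w))
    (measurable_funB (mX1 w) (mY1 n w)) cw ew.
  by exists M => // m Mm; exact: HM.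
apply: (le_trans (measureU2 _ _ _)) => //; first exact: bigcupT_measurable.
by rewrite [X in (_ + X)%E]N10 adde0.
Qed.

(** The probability of an excess at any horizon is at most
[P (big_tail eps n) + 2 eps / lam], which is arbitrarily small for suitable
[eps] and large [n]; hence almost surely an excess does not occur for every
[n >= n0]. *)
Lemma tail_control lam : 0 < lam -> {ae P, forall w, forall n0, exists2 n, (n0 <= n)%N &
  forall N, ~ excess N lam (fun t => X w t - partial_sum n w t)}.
Proof.
move=> lam0; apply: ae_foralln => n0.
pose U n := \bigcup_N excess_tail N lam n.
have mU n : measurable (U n) by apply: bigcupT_measurable => N; exact: measurable_excess_tail.
have UP eps n : 0 < eps -> (P (U n) <= P (big_tail eps n) + (2 * eps / lam)%:E)%E.
  move=> eps0.
  have ndE : nondecreasing_seq (fun N => excess_tail N lam n).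
    move=> a b ab; apply/subsetPset => w [T /andP[T0 Ta] hT].
    by exists T => //; rewrite T0 (leq_trans Ta).
  have cE := @nondecreasing_cvg_mu _ _ _ P _ (fun N => measurable_excess_tail N lam n) (mU n) ndE.
  rewrite -(cvg_lim _ cE)//; apply: lime_le; first by apply/cvg_ex; eexists; exact: cE.
  by exists 1%N => // N /= N0; exact: excess_tail_bound.
exists (\bigcap_(n in [set n | (n0 <= n)%N]) U n).
have mI : measurable (\bigcap_(n in [set n | (n0 <= n)%N]) U n).
  by apply: bigcap_measurable => [|n _]; [exists n0 => /=|exact: mU].
split => //.
  apply/eqP; rewrite eq_le measure_ge0 andbT; apply/lee_addgt0Pr => e e0.
  rewrite add0e; pose eps := lam * e / 4.
  have eps0 : 0 < eps by rewrite divr_gt0// mulr_gt0.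
  have e20 : 0 < e / 2 by rewrite divr_gt0.
  have [M _ HM] : \forall n \near \oo, (P (big_tail eps n) < (e / 2)%:E)%E.
    have /fine_cvgP[_ /cvgrPdist_lt/(_ _ e20)] := big_tail_cvg0 eps0.
    apply: filterS => k; rewrite sub0r normrN => hk.
    rewrite -[P _]fineK ?fin_num_measure// lte_fin.
    exact: le_lt_trans (ler_norm _) hk.
  pose n := maxn M n0.
  apply: (@le_trans _ _ (P (U n))).
    by apply: le_measure; rewrite ?inE// => w; apply => /=; exact: leq_maxr.
  apply: (le_trans (UP eps n eps0)).
  rewrite [leRHS](_ : _ = (e / 2)%:E + (2 * eps / lam)%:E)%E.
    by apply: leeD => //; apply/ltW/HM; exact: leq_maxl.
  by rewrite -EFinD; congr (_%:E); rewrite /eps; field; rewrite gt_eqF.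
move=> w /= nw n nn0; apply: contrapT => nU; apply: nw; exists n => // N ew.
by apply: nU; exists N.
Qed.

End tail_control.

(** * Taylor bounds for the cosine *)

Section cosine_taylor.
Context {R : realType}.

(** The [j]-th derivative of the cosine is the cosine shifted by [j pi / 2]. *)
Definition cos_taylor (J : nat) (x z : R) : R :=
  \sum_(0 <= j < J) z ^+ j / j`!%:R * cos (x + j%:R * (pi / 2)).

Lemma is_derive_monomial (n : nat) (k z : R) :
  is_derive z 1 (fun y : R => y ^+ n.+1 * k) (n.+1%:R * z ^+ n * k).
Proof.
rewrite (_ : (fun y : R => _) = k *: ((@id R) ^+ n.+1)); last first.
  by apply/funext => y; rewrite mulrC exprfctE.
apply: is_derive_eq; rewrite /GRing.scale/= mulr1 mulrC; congr (_ * _).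
Qed.

Lemma is_derive_cos_taylor (J : nat) (x z : R) :
  is_derive z 1 (cos_taylor J.+1 x) (cos_taylor J (x + pi / 2) z).
Proof.
elim: J => [|J IH].
  have -> : cos_taylor 1 x = (fun=> cos x).
    apply/funext => y.
    by rewrite /cos_taylor big_nat1 expr0 fact0 invr1 !mul1r mul0r addr0.
  have -> : cos_taylor 0 (x + pi / 2) z = 0 by rewrite /cos_taylor big_geq.
  exact: is_derive_cst.
rewrite (_ : cos_taylor J.+2 x = cos_taylor J.+1 x \+
    (fun z => z ^+ J.+1 * (J.+1`!%:R^-1 * cos (x + J.+1%:R * (pi / 2))))); last first.
  apply/funext => y; rewrite /cos_taylor big_nat_recr//=; congr (_ + _).
  by rewrite -[LHS]mulrA.
rewrite {2}/cos_taylor big_nat_recr//= -/(cos_taylor J (x + pi / 2) z).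
apply: is_deriveD.
have -> : z ^+ J / J`!%:R * cos (x + pi / 2 + J%:R * (pi / 2)) =
    J.+1%:R * z ^+ J * (J.+1`!%:R^-1 * cos (x + J.+1%:R * (pi / 2))).
  rewrite (_ : x + pi / 2 + J%:R * (pi / 2) = x + J.+1%:R * (pi / 2)).
    by rewrite factS natrM; field; rewrite nat1r !pnatr_eq0 -?lt0n ?fact_gt0.
  by rewrite -natr1; ring.
exact: is_derive_monomial.
Qed.

(** The error and its bound vanish at 0, and the inequality between their
derivatives is the previous case; the mean value theorem compares them. *)
Lemma cos_taylor_le (J : nat) (x z : R) : 0 <= z -> `|cos (x + z) - cos_taylor J x z| <= z ^+ J / J`!%:R.
Proof.
elim: J => [|J IH] in x z *.
  by move=> z0; rewrite /cos_taylor big_geq// subr0 expr0 fact0 invr1 mulr1 ler_norml cos_geN1 cos_le1.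
move=> z0.
pose E y := cos (x + y) - cos_taylor J.+1 x y.
pose E' y := cos (x + pi / 2 + y) - cos_taylor J (x + pi / 2) y.
pose B y : R := y ^+ J.+1 / J.+1`!%:R.
have dE (y : R) : is_derive y 1 E (E' y).
  apply: is_deriveB; last exact: is_derive_cos_taylor.
  by apply: is_derive_eq; rewrite add0r mulr1 addrAC cosDpihalf.
have dB (y : R) : is_derive y 1 B (y ^+ J / J`!%:R).
  have := is_derive_monomial J (J.+1`!%:R^-1) y.
  rewrite (_ : J.+1%:R * y ^+ J / J.+1`!%:R = y ^+ J / J`!%:R)// factS natrM; field.
  by rewrite nat1r !pnatr_eq0 -?lt0n ?fact_gt0.
have E0 : E 0 = 0.
  rewrite /E addr0 /cos_taylor big_nat_recl// expr0 fact0 invr1 !mul1r mul0r addr0.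
  by rewrite big1 ?addr0 ?subrr// => i _; rewrite expr0n mul0r mul0r.
have B0 : B 0 = 0 by rewrite /B expr0n mul0r.
have key (s : R) : `|s| = 1 -> 0 <= B z + s * E z.
  move=> s1.
  have dBE (t : R) : is_derive t 1 (fun t => B t + s * E t) (t ^+ J / J`!%:R + s * E' t).
    have dE' := is_deriveZ s (dE t).
    exact: (is_deriveD (dB t) dE').
  have cBE : {within `[0, z], continuous (fun t => B t + s * E t)}.
    apply: continuous_subspaceT => t.
    by apply/differentiable_continuous/derivable1_diffP; have [] := dBE t.
  have [c cz] := MVT_segment z0 (fun t _ => dBE t) cBE.
  rewrite B0 E0 mulr0 addr0 !subr0 => ->.
  rewrite mulr_ge0//; move: cz; rewrite in_itv/= => /andP[c0 _].
  have := IH (x + pi / 2) c c0; rewrite -/(E' c).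
  have := ler_norm (- (s * E' c)); rewrite normrN normrM s1 mul1r.
  by move: (`|E' c|) (_ / _) (s * E' c) => u v w'; lra.
rewrite -/(E z) -/(B z) ler_norml; have := key 1 (normr1 _); have := key (-1).
rewrite normrN1 => /(_ erefl); rewrite mulN1r mul1r; move: (B z) (E z) => u v.
by move=> h1 h2; apply/andP; split; lra.
Qed.

Lemma cos_taylor_norm_le (J : nat) (x z : R) : `|cos (x + z) - cos_taylor J x z| <= `|z| ^+ J / J`!%:R.
Proof.
have [z0|z0] := leP 0 z; first by rewrite (ger0_norm z0) cos_taylor_le.
have nz : 0 <= - z by rewrite oppr_ge0 ltW.
rewrite (ltr0_norm z0); have := cos_taylor_le J (- x) nz.
rewrite -opprD cosN (_ : cos_taylor J (- x) (- z) = cos_taylor J x z)//.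
apply: eq_bigr => j _; rewrite exprNn.
have cosDnpi (i : nat) y : cos (y + i%:R * pi) = (-1) ^+ i * cos y :> R.
  elim: i => [|i IH]; first by rewrite mul0r addr0 mul1r.
  by rewrite -natr1 mulrDl mul1r addrA cosDpi IH exprS mulN1r mulNr.
have -> : cos (- x + j%:R * (pi / 2)) = (-1) ^+ j * cos (x + j%:R * (pi / 2)).
  rewrite (_ : - x + _ = - (x + j%:R * (pi / 2)) + j%:R * pi); last by field.
  by rewrite cosDnpi cosN.
have aux (s u v w : R) : s ^+ 2 = 1 -> s * u * v * (s * w) = u * v * w.
  by move=> s2; rewrite -[RHS]mul1r -s2; ring.
by rewrite aux// sqrr_sign.
Qed.

End cosine_taylor.

(** * Time means and circle averages *)

Section interval_averages.
Context {R : realType}.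
Local Notation mu := (@lebesgue_measure R).

Definition bounded_measurable (g : R -> R) : Prop :=
  measurable_fun setT g /\ exists M, forall x, `|g x| <= M.

Lemma bounded_measurable_integrable a b g : bounded_measurable g ->
  mu.-integrable `[a, b] (EFin \o g).
Proof.
move=> [mg [M gM]]; apply: measurable_bounded_integrable => //.
- by rewrite /= lebesgue_measure_itv; case: ifP => //= _; rewrite -EFinB ltry.
- exact: measurable_funTS.
- exists M; split; first exact: num_real.
  by move=> x Mx t _; apply: le_trans (gM t) _; exact: ltW.
Qed.

Lemma bounded_measurableD f g : bounded_measurable f -> bounded_measurable g ->
  bounded_measurable (fun t => f t + g t).
Proof.
move=> [mf [M fM]] [mg [N gN]]; split; first exact: measurable_funD.
by exists (M + N) => t; rewrite (le_trans (ler_normD _ _))// lerD.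
Qed.

Lemma bounded_measurableM f g : bounded_measurable f -> bounded_measurable g ->
  bounded_measurable (fun t => f t * g t).
Proof.
move=> [mf [M fM]] [mg [N gN]]; split; first exact: measurable_funM.
by exists (M * N) => t; rewrite normrM ler_pM.
Qed.

Lemma bounded_measurable_cst k : bounded_measurable (fun=> k).
Proof. by split; [exact: measurable_cst|exists `|k|]. Qed.

Lemma bounded_measurable_cos f : measurable_fun setT f ->
  bounded_measurable (fun t => cos (f t)).
Proof.
move=> mf; split; first exact: (measurableT_comp (@measurable_cosine R) mf).
by exists 1 => t; rewrite ler_norml cos_geN1 cos_le1.
Qed.

Lemma bounded_measurable_expn f n : bounded_measurable f ->
  bounded_measurable (fun t => f t ^+ n).
Proof.
move=> bf; elim: n => [|n IH]; first exact: bounded_measurable_cst.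
by under eq_fun do rewrite exprS; exact: bounded_measurableM.
Qed.

Lemma bounded_measurable_sum n (f : nat -> R -> R) :
  (forall i, bounded_measurable (f i)) ->
  bounded_measurable (fun t => \sum_(0 <= i < n) f i t).
Proof.
move=> bf; elim: n => [|n IH].
  by under eq_fun do rewrite big_geq//; exact: bounded_measurable_cst.
by under eq_fun do rewrite big_nat_recr//=; exact: bounded_measurableD.
Qed.

Definition interval_avg (a b : R) (g : R -> R) : R :=
  (b - a)^-1 * Rintegral mu `[a, b] g.

Lemma interval_avgD a b f g : bounded_measurable f -> bounded_measurable g ->
  interval_avg a b (fun t => f t + g t) = interval_avg a b f + interval_avg a b g.
Proof.
move=> bf bg; rewrite /interval_avg RintegralD ?mulrDr//;
exact: bounded_measurable_integrable.
Qed.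

Lemma interval_avgZ a b k f : bounded_measurable f ->
  interval_avg a b (fun t => k * f t) = k * interval_avg a b f.
Proof.
move=> bf; rewrite /interval_avg RintegralZl//; first by rewrite mulrCA.
exact: bounded_measurable_integrable.
Qed.

Lemma interval_avg_sum a b n (f : nat -> R -> R) :
  (forall i, bounded_measurable (f i)) ->
  interval_avg a b (fun t => \sum_(0 <= i < n) f i t) =
  \sum_(0 <= i < n) interval_avg a b (f i).
Proof.
move=> bf; elim: n => [|n IH].
  under eq_fun do rewrite big_geq//; rewrite big_geq//.
  by rewrite /interval_avg Rintegral_cst// mul0r mulr0.
under eq_fun do rewrite big_nat_recr//=; rewrite big_nat_recr//= -IH.
by apply: interval_avgD => //; exact: bounded_measurable_sum.
Qed.

Lemma interval_avg_cst a b k : a < b -> interval_avg a b (fun=> k) = k.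
Proof.
move=> ab; rewrite /interval_avg Rintegral_cst//.
have -> : fine (mu `[a, b]) = b - a by rewrite lebesgue_measure_itv/= lte_fin ab.
by field; rewrite subr_eq0 gt_eqF.
Qed.

Lemma interval_avg_le a b f g : a <= b -> bounded_measurable f -> bounded_measurable g ->
  (forall t, f t <= g t) -> interval_avg a b f <= interval_avg a b g.
Proof.
move=> ab bf bg fg; rewrite /interval_avg ler_wpM2l ?invr_ge0 ?subr_ge0//.
by apply: le_Rintegral => //; exact: bounded_measurable_integrable.
Qed.

Lemma interval_avg_dist a b f g e : a < b -> bounded_measurable f -> bounded_measurable g ->
  (forall t, `|f t - g t| <= e) -> `|interval_avg a b f - interval_avg a b g| <= e.
Proof.
move=> ab bf bg fg.
have le1 u v : bounded_measurable u -> bounded_measurable v ->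
    (forall t, `|u t - v t| <= e) -> interval_avg a b u <= interval_avg a b v + e.
  move=> bu bv uv; rewrite -[X in _ + X](interval_avg_cst e ab).
  have bc := bounded_measurable_cst e.
  rewrite -interval_avgD//; apply: interval_avg_le => //; first exact: ltW.
    exact: bounded_measurableD.
  by move=> t; rewrite -lerBlDl (le_trans (ler_norm _)).
rewrite ler_distl lerBlDr; apply/andP; split; first last.
  exact: le1.
by apply: le1 => // t; rewrite distrC.
Qed.

Definition time_mean (g : R -> R) (l : R) : Prop :=
  interval_avg 0 T g @[T --> +oo] --> l.

Lemma time_mean_cst (k : R) : time_mean (fun=> k) k.
Proof.
apply: cvg_near_cst; near=> T; apply: interval_avg_cst; near: T.
exact: nbhs_pinfty_gt.
Unshelve. all: by end_near. Qed.

Lemma time_mean_unique g (k l : R) : time_mean g k -> time_mean g l -> k = l.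
Proof. by move=> gk gl; apply: cvg_unique gk gl. Qed.

Lemma time_meanD f g k l : bounded_measurable f -> bounded_measurable g ->
  time_mean f k -> time_mean g l -> time_mean (fun t => f t + g t) (k + l).
Proof.
move=> bf bg fk gl; rewrite /time_mean.
under eq_fun do rewrite interval_avgD//.
exact: cvgD.
Qed.

Lemma time_meanZ f k l : bounded_measurable f ->
  time_mean f l -> time_mean (fun t => k * f t) (k * l).
Proof.
move=> bf fl; rewrite /time_mean.
under eq_fun do rewrite interval_avgZ//.
by apply: cvgM => //; exact: cvg_cst.
Qed.

Lemma time_mean_sum n (f : nat -> R -> R) (l : nat -> R) :
  (forall i, bounded_measurable (f i)) -> (forall i, time_mean (f i) (l i)) ->
  time_mean (fun t => \sum_(0 <= i < n) f i t) (\sum_(0 <= i < n) l i).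
Proof.
move=> bf fl; elim: n => [|n IH].
  rewrite big_geq// /time_mean.
  under eq_fun do rewrite interval_avg_sum// big_geq//.
  exact: cvg_cst.
rewrite big_nat_recr//=; under eq_fun do rewrite big_nat_recr//=.
by apply: time_meanD => //; exact: bounded_measurable_sum.
Qed.

Lemma time_mean_uniform_limit f l (F : nat -> R -> R) (L e : nat -> R) :
  bounded_measurable f -> (forall n, bounded_measurable (F n)) ->
  (forall n t, `|f t - F n t| <= e n) -> (forall n, `|l - L n| <= e n) ->
  (forall n, time_mean (F n) (L n)) -> e @ \oo --> 0 -> time_mean f l.
Proof.
move=> bf bF fF lL FL e0; apply/cvgrPdist_le => eps eps0.
have e3 : 0 < eps / 3 by rewrite divr_gt0.
have /cvgrPdist_le/(_ _ e3)[n _ /(_ n (leqnn _))] := e0.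
rewrite sub0r normrN => en; have {}en := le_trans (ler_norm _) en.
have /cvgrPdist_le/(_ _ e3) Fn := FL n.
near=> T.
have T0 : 0 < T by near: T; exact: nbhs_pinfty_gt.
have h1 := le_trans (interval_avg_dist T0 bf (bF n) (fF n)) en.
have h2 := le_trans (lL n) en.
have h3 : `|L n - interval_avg 0 T (F n)| <= eps / 3 by near: T.
rewrite (_ : l - _ = (l - L n) + (L n - interval_avg 0 T (F n)) +
  (interval_avg 0 T (F n) - interval_avg 0 T f)); last by ring.
rewrite (le_trans (ler_normD _ _))// (le_trans (lerD (ler_normD _ _) (lexx _)))//.
by rewrite [X in _ + X]distrC; lra.
Unshelve. all: by end_near. Qed.

Lemma time_mean_cos (phi lam : R) : lam != 0 -> time_mean (fun t => cos (phi + lam * t)) 0.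
Proof.
move=> lam0.
have E T : 0 < T -> interval_avg 0 T (fun t => cos (phi + lam * t)) =
    T^-1 * (lam^-1 * (sin (phi + lam * T) - sin phi)).
  move=> T0; rewrite /interval_avg subr0; congr (_ * _).
  pose F t : R := lam^-1 * sin (phi + lam * t).
  have dF (t : R) : is_derive t 1 F (cos (phi + lam * t)).
    by apply: is_derive_eq; rewrite /GRing.scale/=; field.
  have cF g g' : (forall t : R, is_derive t 1 g (g' t)) -> continuous (g : R -> R).
    by move=> dg t; apply/differentiable_continuous/derivable1_diffP; have [] := dg t.
  have cf : continuous (fun t : R => cos (phi + lam * t)).
    apply: (cF _ (fun t => - (lam * sin (phi + lam * t)))) => t.
    by apply: is_derive_eq; rewrite /GRing.scale/=; ring.
  rewrite /Rintegral (@continuous_FTC2 _ (fun t => cos (phi + lam * t)) F 0 T T0).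
  - by rewrite /F mulr0 addr0 -EFinB/= -mulrBr.
  - exact: continuous_subspaceT.
  - split; first by move=> t _; have [] := dF t.
    + exact/cvg_at_right_filter/(cF _ _ dF).
    + exact/cvg_at_left_filter/(cF _ _ dF).
  - by move=> t _; rewrite derive1E; have [_] := dF t.
apply/cvgrPdist_le => eps eps0; near=> T.
have T0 : 0 < T by near: T; exact: nbhs_pinfty_gt.
rewrite sub0r normrN E// mulrA normrM.
have sl (u v : R) : `|sin u - sin v| <= 2.
  rewrite (le_trans (ler_normB _ _))// (_ : 2 = 1 + 1)//; apply: lerD.
    by rewrite ler_norml sin_geN1 sin_le1.
  by rewrite ler_norml sin_geN1 sin_le1.
apply: (le_trans (ler_wpM2l (normr_ge0 _) (sl _ _))).
rewrite normrM (gtr0_norm (_ : 0 < T^-1)) ?invr_gt0// -mulrA ler_pdivrMl// -ler_pdivrMr//.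
Unshelve. all: by end_near. Qed.

End interval_averages.

Section circle_averages.
Context {R : realType}.
Local Notation mu := (@lebesgue_measure R).

Lemma cosM (a b : R) : cos a * cos b = 2^-1 * cos (a + b) + 2^-1 * cos (a - b).
Proof. by rewrite cosD cosB; field. Qed.

Lemma cosD_int (m : int) (x : R) : cos (x + m%:~R * (2 * pi)) = cos x.
Proof.
have := @periodicz R (2 * pi) (fun x => (cos x)%:E) m x.
by move=> H; apply: EFin_inj; apply: H => y; rewrite mulr_natl cosD2pi.
Qed.

Definition circle_avg (g : R -> R) : R := interval_avg (- pi) pi g.

Let Npi_pi : - pi < pi :> R.
Proof. by have := pi_gt0 R; lra. Qed.

(** Adding a bound of [g] reduces the claim to nonnegative integrands. *)
Lemma circle_avg_shift v g : bounded_measurable g -> (forall x, g (x + 2 * pi) = g x) ->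
  circle_avg (fun x => g (x + v)) = circle_avg g.
Proof.
move=> bg gp; have [mg [M gM]] := bg.
pose h x := g x + M.
have h0 x : 0 <= h x by have := gM x; rewrite ler_norml /h => /andP[]; lra.
have mh : measurable_fun setT h by apply: measurable_funD.
have circE (f : R -> \bar R) : measurable_fun setT f -> (forall x, (0 <= f x)%E) ->
    (forall x : R, f (x + 2 * pi) = f x) ->
    (\int[mu]_(x in `[(- pi)%R, pi]) f x = \int[mu]_(x in `[0%R, (2 * pi)%R[) f x)%E.
  move=> mf f0 fp; rewrite -integral_itv_bndo_bndc; last exact: measurable_funTS.
  have := ge0_integral_translation (- pi) 0 (2 * pi) mf f0.
  rewrite add0r (_ : 2 * pi - pi = pi); last by ring.
  by move=> <-; apply: ge0_integral_periodic => //; exact: two_pi_gt0.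
have msh : measurable_fun setT (fun x : R => x + v).
  by apply: measurable_funD => //; exact: measurable_cst.
have E : circle_avg (fun x => h (x + v)) = circle_avg h.
  rewrite /circle_avg /interval_avg /Rintegral; congr (_ * fine _).
  have mhE : measurable_fun setT (fun x => (h x)%:E) by exact/measurable_EFinP.
  have hp x : (h (x + 2 * pi))%:E = (h x)%:E by rewrite /h gp.
  have h0E x : (0 <= (h x)%:E)%E by rewrite lee_fin.
  rewrite circE//; last 2 first.
  - exact: (measurableT_comp mhE msh).
  - by move=> x; rewrite addrAC hp.
  rewrite circE// (@ge0_integral_periodic _ (2 * pi) v (fun x => (h x)%:E))//.
  exact: two_pi_gt0.
have bgv : bounded_measurable (fun x => g (x + v)).
  split; first exact: (measurableT_comp mg msh).
  by exists M => x.
move: E; rewrite /circle_avg /h !interval_avgD ?interval_avg_cst//;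
  try exact: bounded_measurable_cst.
exact: addIr.
Qed.

Lemma circle_avg_antiperiodic v g : bounded_measurable g ->
  (forall x, g (x + 2 * pi) = g x) -> (forall x, g (x + v) = - g x) -> circle_avg g = 0.
Proof.
move=> bg gp gN; have := circle_avg_shift v bg gp.
rewrite (_ : (fun x => _) = (fun x => -1 * g x)); last by apply/funext => x; rewrite gN mulN1r.
rewrite /circle_avg interval_avgZ//; move: (interval_avg _ _ _) => A; lra.
Qed.

Lemma circle_avg_cos (m : int) : circle_avg (fun x => cos (m%:~R * x)) = (m == 0)%:R.
Proof.
have [->|m0] := eqVneq m 0.
  under eq_fun do rewrite mul0r cos0.
  exact: interval_avg_cst.
have mR : m%:~R != 0 :> R by rewrite intr_eq0.
apply: (@circle_avg_antiperiodic (pi / m%:~R)).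
- by apply: bounded_measurable_cos; apply: measurable_funM => //; exact: measurable_cst.
- by move=> x; rewrite mulrDr cosD_int.
- by move=> x; rewrite mulrDr mulrCA divff// mulr1 cosDpi.
Qed.

Definition bessel0 (s : R) : R := circle_avg (fun x => cos (s * cos x)).

Lemma bounded_measurable_cos_cos (phi s : R) : bounded_measurable (fun x => cos (phi + s * cos x)).
Proof.
apply: bounded_measurable_cos; apply: measurable_funD; first exact: measurable_cst.
by apply: measurable_funM; [exact: measurable_cst|exact: measurable_cosine].
Qed.

Lemma circle_avg_bessel0 (phi s : R) :
  circle_avg (fun x => cos (phi + s * cos x)) = cos phi * bessel0 s.
Proof.
have b0 := bounded_measurable_cos_cos 0 s.
have bpi := bounded_measurable_cos_cos (- (pi / 2)) s.
have E0 : (fun x : R => cos (0 + s * cos x)) = (fun x => cos (s * cos x)).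
  by apply/funext => x; rewrite add0r.
have Epi : (fun x : R => cos (- (pi / 2) + s * cos x)) = (fun x => sin (s * cos x)).
  by apply/funext => x; rewrite addrC cosBpihalf.
rewrite E0 in b0; rewrite Epi in bpi.
rewrite (_ : (fun x => _) = (fun x => cos phi * cos (s * cos x) + (- sin phi) * sin (s * cos x))); last first.
  by apply/funext => x; rewrite cosD mulNr.
rewrite /circle_avg interval_avgD; last 2 first.
- by apply: bounded_measurableM => //; exact: bounded_measurable_cst.
- by apply: bounded_measurableM => //; exact: bounded_measurable_cst.
rewrite !interval_avgZ//.
have -> : interval_avg (- pi) pi (fun x => sin (s * cos x)) = 0.
  apply: (@circle_avg_antiperiodic pi) => // x.
    by rewrite mulr_natl cosD2pi.
  by rewrite cosDpi mulrN sinN.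
by rewrite mulr0 addr0.
Qed.

End circle_averages.

(** * Equidistribution of finitely many oscillators *)

Section equidistribution.
Context {R : realType}.
Variable Z : nat -> R.

(** An integer combination of the frequencies of index at least [n], those
still unused once the first [n] oscillators have been treated. *)
Definition frequency (c : seq int) (n : nat) : R :=
  \sum_(i < size c) (c`_i)%:~R * Z (n + i)%N.

(** Along the time mean, [s] behaves like a symmetric random variable with
[E exp(i s) = a] that is independent of the exponentials of the frequencies
still unused. This is the invariant of the induction on the number of
oscillators. *)
Definition has_phase_mean (n : nat) (s : R -> R) (a : R) : Prop :=
  forall (phi : R) (c : seq int),
    time_mean (fun t => cos (phi + s t + frequency c n * t))
      (if all (pred1 0) c then a * cos phi else 0).

Lemma frequency_cons m c n : frequency (m :: c) n = m%:~R * Z n + frequency c n.+1.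
Proof.
rewrite /frequency big_ord_recl/= addn0; congr (_ + _).
by apply: eq_bigr => i _; rewrite addnS addSn.
Qed.

Section one_more_oscillator.
Variables (n : nat) (s : R -> R) (a th : R).
Hypothesis ms : measurable_fun setT s.
Hypothesis Hs : has_phase_mean n s a.

Let u t := th + t * Z n.

Let measurable_u : measurable_fun setT u.
Proof.
apply: measurable_funD; first exact: measurable_cst.
by apply: measurable_funM => //; exact: measurable_cst.
Qed.

Let measurable_phase phi c (m : int) :
  measurable_fun setT (fun t => phi + s t + frequency c n.+1 * t + m%:~R * u t).
Proof.
apply: measurable_funD; last by apply: measurable_funM => //; exact: measurable_cst.
apply: measurable_funD; last by apply: measurable_funM => //; exact: measurable_cst.
by apply: measurable_funD => //; exact: measurable_cst.
Qed.

Let bcos (m : int) : bounded_measurable (fun x : R => cos (m%:~R * x)).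
Proof. by apply: bounded_measurable_cos; apply: measurable_funM => //; exact: measurable_cst. Qed.

Let bcosX j : bounded_measurable (fun x : R => cos x ^+ j).
Proof. by apply: bounded_measurable_expn; apply: bounded_measurable_cos. Qed.

(** Both sides satisfy the same recursion in [j]: the product formula for
cosines trades one factor [cos u] for the multipliers [m + 1] and [m - 1].
For [j = 0] the multiplier [m] of [Z n] joins the combination [c]. *)
Lemma time_mean_cos_power j (phi : R) (c : seq int) (m : int) :
  time_mean (fun t => cos (phi + s t + frequency c n.+1 * t + m%:~R * u t) * cos (u t) ^+ j)
    ((if all (pred1 0) c then a * cos phi else 0) *
     circle_avg (fun x => cos (m%:~R * x) * cos x ^+ j)).
Proof.
elim: j => [|j IH] in m *.
  under eq_fun do rewrite expr0 mulr1.
  rewrite (_ : (fun x : R => cos (m%:~R * x) * cos x ^+ 0) = (fun x => cos (m%:~R * x))); last first.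
    by apply/funext => x; rewrite expr0 mulr1.
  rewrite circle_avg_cos; have := @Hs (phi + m%:~R * th) (m :: c).
  rewrite frequency_cons /=.
  rewrite (_ : (fun t => _) = (fun t => cos (phi + s t + frequency c n.+1 * t + m%:~R * u t))); last first.
    by apply/funext => t; congr cos; rewrite /u; ring.
  by case: eqP => [->|_]/=; rewrite ?mul0r ?addr0 ?mulr1 ?mulr0.
have -> : (fun t => cos (phi + s t + frequency c n.+1 * t + m%:~R * u t) * cos (u t) ^+ j.+1) =
  (fun t => 2^-1 * (cos (phi + s t + frequency c n.+1 * t + (m + 1)%:~R * u t) * cos (u t) ^+ j) +
            2^-1 * (cos (phi + s t + frequency c n.+1 * t + (m - 1)%:~R * u t) * cos (u t) ^+ j)).
  apply/funext => t; rewrite exprS mulrA cosM mulrDl !mulrA intrD intrB.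
  by congr (_ * cos _ * _ + _ * cos _ * _); ring.
have bX m' : bounded_measurable (fun x : R => cos (m'%:~R * x) * cos x ^+ j).
  exact: bounded_measurableM.
have -> : circle_avg (fun x : R => cos (m%:~R * x) * cos x ^+ j.+1) =
   2^-1 * circle_avg (fun x => cos ((m + 1)%:~R * x) * cos x ^+ j) +
   2^-1 * circle_avg (fun x => cos ((m - 1)%:~R * x) * cos x ^+ j).
  rewrite /circle_avg -(interval_avgZ _ _ _ (bX (m + 1))) -(interval_avgZ _ _ _ (bX (m - 1))).
  rewrite -interval_avgD; last 2 first.
  - by apply: bounded_measurableM => //; exact: bounded_measurable_cst.
  - by apply: bounded_measurableM => //; exact: bounded_measurable_cst.
  congr interval_avg; apply/funext => x; rewrite exprS mulrA cosM mulrDl !mulrA intrD intrB.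
  by congr (_ * cos _ * _ + _ * cos _ * _); ring.
rewrite mulrDr !(mulrCA _ 2^-1).
have bT m' : bounded_measurable (fun t =>
    cos (phi + s t + frequency c n.+1 * t + m'%:~R * u t) * cos (u t) ^+ j).
  apply: bounded_measurableM; first exact: bounded_measurable_cos.
  by apply: bounded_measurable_expn; exact: bounded_measurable_cos.
apply: time_meanD; last 2 first.
- by apply: time_meanZ.
- by apply: time_meanZ.
- by apply: bounded_measurableM => //; exact: bounded_measurable_cst.
- by apply: bounded_measurableM => //; exact: bounded_measurable_cst.
Qed.

End one_more_oscillator.

End equidistribution.

Section bessel_product.
Context {R : realType}.
Variable Z : nat -> R.

Let taylor_error_cvg0 (K Y : R) : K * (`|Y| ^+ J / J`!%:R) @[J --> \oo] --> 0.
Proof.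
rewrite -[X in _ --> X](mulr0 K); apply: cvgM; first exact: cvg_cst.
have := cvg_series_cvg_0 (is_cvg_series_exp_coeff `|Y|).
by rewrite /exp_coeff.
Qed.

Let cos_taylor_cos_le J (x Y v : R) :
  `|cos (x + Y * cos v) - cos_taylor J x (Y * cos v)| <= `|Y| ^+ J / J`!%:R.
Proof.
apply: (le_trans (cos_taylor_norm_le _ _ _)); rewrite ler_wpM2r ?invr_ge0//.
rewrite lerXn2r ?nnegrE// normrM ler_piMr//.
by rewrite ler_norml cos_geN1 cos_le1.
Qed.

(** The cosine is expanded in powers of [Y * cos u], uniformly in time because
[cos u] is bounded. The means of the terms are given by
[time_mean_cos_power], and they are the terms of the expansion of the circle
average that defines [bessel0 Y]. *)
Lemma has_phase_mean_step n s a th (Y : R) : measurable_fun setT s ->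
  has_phase_mean Z n s a ->
  has_phase_mean Z n.+1 (fun t => s t + Y * cos (th + t * Z n)) (a * bessel0 Y).
Proof.
move=> ms Hs phi c.
pose u t := th + t * Z n.
have mu : measurable_fun setT u.
  apply: measurable_funD; first exact: measurable_cst.
  by apply: measurable_funM => //; exact: measurable_cst.
have mph phi' : measurable_fun setT (fun t => phi' + s t + frequency Z c n.+1 * t).
  apply: measurable_funD; last by apply: measurable_funM => //; exact: measurable_cst.
  by apply: measurable_funD => //; exact: measurable_cst.
have bcX j : bounded_measurable (fun t => cos (u t) ^+ j).
  by apply: bounded_measurable_expn; exact: bounded_measurable_cos.
pose G (j : nat) t := cos (phi + j%:R * (pi / 2) + s t + frequency Z c n.+1 * t) * cos (u t) ^+ j.
have bG j : bounded_measurable (G j).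
  by apply: bounded_measurableM => //; exact: bounded_measurable_cos.
pose C (j : nat) : R := circle_avg (fun x => cos x ^+ j).
pose delta : R := if all (pred1 0) c then a else 0.
have GM j : time_mean (G j) (delta * cos (phi + j%:R * (pi / 2)) * C j).
  have := @time_mean_cos_power R Z n s a th ms Hs j (phi + j%:R * (pi / 2)) c 0.
  rewrite (_ : (fun x : R => cos (0%:~R * x) * cos x ^+ j) = (fun x => cos x ^+ j)); last first.
    by apply/funext => x; rewrite mul0r cos0 mul1r.
  rewrite (_ : (fun t => _) = G j); last first.
    by apply/funext => t; rewrite mul0r addr0.
  by rewrite /delta; case: ifP => _; rewrite ?mul0r.
pose k (j : nat) : R := Y ^+ j / j`!%:R.
pose F J t := \sum_(0 <= j < J) k j * G j t.
pose L J := \sum_(0 <= j < J) k j * (delta * cos (phi + j%:R * (pi / 2)) * C j).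
have bkG j : bounded_measurable (fun t => k j * G j t).
  by apply: bounded_measurableM => //; exact: bounded_measurable_cst.
have FE J t : F J t = cos_taylor J (phi + s t + frequency Z c n.+1 * t) (Y * cos (u t)).
  apply: eq_bigr => j _; rewrite /k /G exprMn.
  rewrite (_ : phi + j%:R * (pi / 2) + s t + frequency Z c n.+1 * t =
    phi + s t + frequency Z c n.+1 * t + j%:R * (pi / 2)); last by ring.
  by move: (cos (_ + _)) => v; ring.
have LE J : L J = delta * circle_avg (fun x => cos_taylor J phi (Y * cos x)).
  have bx j : bounded_measurable (fun x : R => cos x ^+ j).
    by apply: bounded_measurable_expn; exact: bounded_measurable_cos.
  rewrite (_ : (fun x => _) = (fun x => \sum_(0 <= j < J)
      (k j * cos (phi + j%:R * (pi / 2))) * cos x ^+ j)); last first.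
    apply/funext => x; apply: eq_bigr => j _; rewrite /k exprMn.
    by move: (cos (_ + _)) => v; ring.
  rewrite /circle_avg interval_avg_sum; last first.
    by move=> j; apply: bounded_measurableM => //; exact: bounded_measurable_cst.
  rewrite mulr_sumr; apply: eq_bigr => j _; rewrite interval_avgZ// /C /circle_avg.
  by move: (cos _) (interval_avg _ _ _) => v w; ring.
have -> : (if all (pred1 0) c then a * bessel0 Y * cos phi else 0) =
    delta * circle_avg (fun x => cos (phi + Y * cos x)).
  by rewrite circle_avg_bessel0 /delta; case: ifP => _; ring.
apply: (@time_mean_uniform_limit _ _ _ F L (fun J => (1 + `|a|) * (`|Y| ^+ J / J`!%:R))).
- apply: bounded_measurable_cos; apply: measurable_funD; last first.
    by apply: measurable_funM => //; exact: measurable_cst.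
  apply: measurable_funD; first exact: measurable_cst.
  apply: measurable_funD => //; apply: measurable_funM; first exact: measurable_cst.
  exact: (measurableT_comp (@measurable_cosine R) mu).
- by move=> J; exact: bounded_measurable_sum.
- move=> J t; rewrite FE (_ : phi + _ + _ = phi + s t + frequency Z c n.+1 * t + Y * cos (u t)); last first.
    by rewrite /u; ring.
  apply: (le_trans (cos_taylor_cos_le _ _ _ _)).
  by rewrite ler_peMl ?divr_ge0// lerDl.
- move=> J; rewrite LE -mulrBr normrM.
  apply: ler_pM => //.
    by rewrite /delta; case: ifP => _; rewrite ?normr0 ?addr_ge0// lerDr.
  have pp : - pi < pi :> R by have := pi_gt0 R; lra.
  apply: interval_avg_dist => //; first exact: bounded_measurable_cos_cos.
  rewrite /cos_taylor; apply: bounded_measurable_sum => j.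
  apply: bounded_measurableM; last exact: bounded_measurable_cst.
  apply: bounded_measurableM; last exact: bounded_measurable_cst.
  apply: bounded_measurable_expn; apply: bounded_measurableM; first exact: bounded_measurable_cst.
  exact: bounded_measurable_cos.
- move=> J; apply: time_mean_sum => // j; exact: time_meanZ.
- exact: taylor_error_cvg0.
Qed.

Hypothesis Z_independent : forall (c : seq int) k, c`_k != 0 ->
  \sum_(i < size c) (c`_i)%:~R * Z i != 0.

Lemma has_phase_mean0 : has_phase_mean Z 0 (fun=> 0) 1.
Proof.
move=> phi c; case: ifPn => [c0|/allPn[m mc m0]].
  rewrite mul1r (_ : (fun t => _) = (fun=> cos phi)).
    exact: time_mean_cst.
  apply/funext => t; rewrite (_ : frequency Z c 0 = 0) ?mul0r ?addr0//.
  rewrite /frequency big1// => i _.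
  by have /allP/(_ c`_i (mem_nth _ _))/eqP -> := c0; rewrite ?mul0r.
rewrite (_ : (fun t => _) = (fun t => cos (phi + frequency Z c 0 * t))); last first.
  by apply/funext => t; rewrite addr0.
apply: time_mean_cos; rewrite /frequency.
have ci : c`_(index m c) != 0 by rewrite nth_index.
exact: Z_independent ci.
Qed.

Variables r th : nat -> R.

Definition oscillators (n : nat) (t : R) : R :=
  \sum_(0 <= k < n) r k * cos (th k + t * Z k).

Lemma measurable_oscillators n : measurable_fun setT (oscillators n).
Proof.
apply: measurable_sum => k; apply: measurable_funM; first exact: measurable_cst.
apply: (measurableT_comp (@measurable_cosine R)).
apply: measurable_funD; first exact: measurable_cst.
by apply: measurable_funM => //; exact: measurable_cst.
Qed.

(** The theorem of Kronecker and Weyl for the torus of phases: the time mean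
factors into one circle average per oscillator. *)
Lemma time_mean_oscillators (phi y : R) n :
  time_mean (fun t => cos (phi + y * oscillators n t))
    (cos phi * \prod_(0 <= k < n) bessel0 (y * r k)).
Proof.
have H : has_phase_mean Z n (fun t => y * oscillators n t)
    (\prod_(0 <= k < n) bessel0 (y * r k)).
  elim: n => [|n IH].
    rewrite big_geq// (_ : (fun t => _) = (fun=> 0)); first exact: has_phase_mean0.
    by apply/funext => t; rewrite /oscillators big_geq// mulr0.
  rewrite big_nat_recr//= (_ : (fun t => _) = (fun t => y * oscillators n t +
      y * r n * cos (th n + t * Z n))).
    apply: has_phase_mean_step => //; apply: measurable_funM; first exact: measurable_cst.
    exact: measurable_oscillators.
  by apply/funext => t; rewrite /oscillators big_nat_recr//= mulrDr mulrA.
have := H phi [::]; rewrite /= mulrC (_ : (fun t => _) = (fun t => cos (phi + y * oscillators n t)))//.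
by apply/funext => t; rewrite /frequency big_ord0 mul0r addr0.
Qed.

End bessel_product.

(** * Time means along a path *)

Section mean_square_approximation.
Context {R : realType}.
Local Notation mu := (@lebesgue_measure R).

Lemma energy_interval (f : R -> R) j : measurable_fun setT f ->
  energy f j = (\int[mu]_(t in `[j%:R, j.+1%:R[) ((f t) ^+ 2)%:E)%E.
Proof.
move=> mf; have mf2 : measurable_fun setT (fun t => ((f t) ^+ 2)%:E).
  by apply/measurable_EFinP; exact: measurable_funX.
have msh : measurable_fun setT (fun t : R => j%:R + t).
  by apply: measurable_funD => //; exact: measurable_cst.
rewrite /energy integral_uniform//; last 2 first.
- exact: (measurableT_comp mf2 msh).
- by move=> t; rewrite lee_fin sqr_ge0.
rewrite subr0 invr1 mul1e -integral_itv_bndo_bndc; last first.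
  exact: measurable_funTS (measurableT_comp mf2 msh).
have := @ge0_integral_translation R j%:R 0 1 _ mf2.
rewrite add0r -natr1 [1 + _]addrC => <-; last by move=> t; rewrite lee_fin sqr_ge0.
by apply: eq_integral => t _; rewrite addrC.
Qed.

Lemma sum_energy (f : R -> R) N : measurable_fun setT f ->
  (\sum_(0 <= j < N) energy f j = \int[mu]_(t in `[0%R, N%:R[) ((f t) ^+ 2)%:E)%E.
Proof.
move=> mf; have mf2 : measurable_fun setT (fun t => ((f t) ^+ 2)%:E).
  by apply/measurable_EFinP; exact: measurable_funX.
elim: N => [|N IH]; first by rewrite big_geq// set_itvco0 integral_set0.
rewrite big_nat_recr//= IH energy_interval//.
rewrite (@itv_bndbnd_setU _ _ (BLeft 0) (BLeft N%:R) (BLeft N.+1%:R)); last 2 first.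
- by rewrite bnd_simp.
- by rewrite bnd_simp ler_nat.
rewrite ge0_integral_setU//.
- exact: measurable_funTS.
- by move=> t _; rewrite lee_fin sqr_ge0.
- apply/disj_setPS => t [/=]; rewrite !in_itv/= => /andP[_ tN] /andP[Nt _].
  by move: (lt_le_trans tN Nt); rewrite ltxx.
Qed.

(** A horizon [T >= 1] is rounded up to an integer at most [2 T]. *)
Lemma mean_square_le (f : R -> R) lam T : measurable_fun setT f -> 0 <= lam ->
  (forall N, ~ excess N lam f) -> 1 <= T ->
  (\int[mu]_(t in `[0%R, T]) ((f t) ^+ 2)%:E <= (2 * lam * T)%:E)%E.
Proof.
move=> mf lam0 nexc T1.
have mf2 : measurable_fun setT (fun t => ((f t) ^+ 2)%:E).
  by apply/measurable_EFinP; exact: measurable_funX.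
have T0 : 0 <= T := le_trans ler01 T1.
pose N := (Num.truncn T).+1.
have /andP[NT TN] : (Num.truncn T)%:R <= T < N%:R by exact: truncn_itv.
have : (\sum_(0 <= j < N) energy f j <= (lam * N%:R)%:E)%E.
  rewrite leNgt; apply/negP => lt; apply: (nexc N).
  by exists N => //; rewrite leqnn.
rewrite sum_energy// => H.
apply: (@le_trans _ _ (\int[mu]_(t in `[0%R, N%:R[) ((f t) ^+ 2)%:E)%E).
  apply: ge0_subset_integral => //.
  - exact: measurable_funTS.
  - by move=> t _; rewrite lee_fin sqr_ge0.
  - move=> t /=; rewrite !in_itv/= => /andP[-> tT].
    exact: le_lt_trans tT TN.
apply: (le_trans H); rewrite lee_fin [2 * lam]mulrC -mulrA ler_wpM2l//.
by rewrite /N -natr1 mulr_natl mulr2n lerD.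
Qed.

Lemma interval_avg_mean_square (f g : R -> R) (e K lam T : R) :
  bounded_measurable g -> measurable_fun setT f -> 0 <= e -> 0 <= K -> 0 <= lam ->
  (forall t, `|g t| <= e + K * f t ^+ 2) ->
  (forall N, ~ excess N lam f) -> 1 <= T ->
  `|interval_avg 0 T g| <= e + 2 * K * lam.
Proof.
move=> bg mf e0 K0 lam0 gf nexc T1.
have T0 : 0 < T := lt_le_trans ltr01 T1.
have mf2 : measurable_fun setT (fun t => ((f t) ^+ 2)%:E).
  by apply/measurable_EFinP; exact: measurable_funX.
have ig := @bounded_measurable_integrable R 0 T g bg.
rewrite /interval_avg subr0 normrM gtr0_norm ?invr_gt0// ler_pdivrMl//.
apply: le_trans (le_normr_Rintegral _ ig) _ => //.
have bn : bounded_measurable (fun t => `|g t|).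
  have [mg [M gM]] := bg; split; first exact: measurableT_comp.
  by exists M => t; rewrite normr_id.
rewrite -lee_fin fineK; last first.
  by apply: integrable_fin_num => //; exact: bounded_measurable_integrable.
apply: (@le_trans _ _ (\int[mu]_(t in `[0%R, T]) (e%:E + K%:E * ((f t) ^+ 2)%:E))%E).
  apply: ge0_le_integral => //.
  - by apply: measurable_funTS; apply/measurable_EFinP; case: bn.
  - by apply: measurable_funTS; apply: emeasurable_funD => //; apply: measurable_funeM.
  - by move=> t _; rewrite -EFinM -EFinD lee_fin.
rewrite ge0_integralD//; last 2 first.
- by move=> t _; rewrite mule_ge0// lee_fin// sqr_ge0.
- by apply: measurable_funTS; apply: measurable_funeM.
rewrite integral_cst//= lebesgue_measure_itv/= lte_fin T0 -EFinB subr0 -EFinM.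
rewrite ge0_integralZl//; last 2 first.
- exact: measurable_funTS.
- by move=> t _; rewrite lee_fin sqr_ge0.
apply: (@le_trans _ _ ((e * T)%:E + K%:E * (2 * lam * T)%:E)%E).
  by rewrite leeD2l// lee_wpmul2l ?lee_fin// mean_square_le.
rewrite -EFinM -EFinD lee_fin [X in X <= _](_ : _ = T * (e + 2 * K * lam))//; ring.
Qed.

Lemma cos_lipschitz (a b : R) : `|cos a - cos b| <= `|a - b|.
Proof.
have := cos_taylor_norm_le 1 b (a - b).
rewrite /cos_taylor big_nat1 expr0 fact0 divr1 mul1r mul0r addr0 expr1 divr1.
by rewrite [b + _]addrC subrK.
Qed.

(** Either [`|v| <= e], or [1 <= e^-1 * `|v|]. *)
Lemma young_le (e v : R) : 0 < e -> `|v| <= e + e^-1 * v ^+ 2.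
Proof.
move=> e0; rewrite -real_normK ?num_real//.
have := normr_ge0 v; move: `|v| => u u0.
have [ue|eu] := leP u e.
  by rewrite (le_trans ue)// lerDl mulr_ge0 ?sqr_ge0 ?invr_ge0 ?ltW.
apply: ler_wpDl; first exact: ltW.
rewrite expr2 mulrA ler_peMl//.
by rewrite -ler_pdivrMl ?invr_gt0// invrK mulr1 ltW.
Qed.

Lemma bessel0_dist1 (s : R) : `|1 - bessel0 s| <= s ^+ 2.
Proof.
have Npi_pi : - pi < pi :> R by have := pi_gt0 R; lra.
have := @interval_avg_cst R (- pi) pi 1 Npi_pi => <-.
have bc := bounded_measurable_cos_cos 0 s.
have E0 : (fun x : R => cos (0 + s * cos x)) = (fun x => cos (s * cos x)).
  by apply/funext => x; rewrite add0r.
rewrite E0 in bc; apply: interval_avg_dist => //; first exact: bounded_measurable_cst.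
move=> t; have := cos_taylor_norm_le 2 0 (s * cos t).
rewrite /cos_taylor !big_nat_recr// big_geq//= expr0 fact0 divr1 mul1r mul0r addr0 cos0.
rewrite !add0r mul1r cos_pihalf mulr0 addr0 distrC => H; apply: (le_trans H).
rewrite normrM exprMn real_normK ?num_real// real_normK ?num_real//.
rewrite -mulrA ler_piMr ?sqr_ge0//.
have c1 : cos t ^+ 2 <= 1 by rewrite cos2sin2 lerBlDr lerDl sqr_ge0.
by rewrite ler_pdivrMr// mul1r (le_trans c1)// ler1n.
Qed.

Lemma bessel0_norm_le1 (s : R) : `|bessel0 s| <= 1.
Proof.
have Npi_pi : - pi < pi :> R by have := pi_gt0 R; lra.
have := @interval_avg_cst R (- pi) pi 0 Npi_pi => E.
have bc := bounded_measurable_cos_cos 0 s.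
have E0 : (fun x : R => cos (0 + s * cos x)) = (fun x => cos (s * cos x)).
  by apply/funext => x; rewrite add0r.
rewrite E0 in bc; rewrite -[bessel0 s]subr0 -[X in _ - X]E.
apply: interval_avg_dist => //; first exact: bounded_measurable_cst.
by move=> t; rewrite subr0 ler_norml cos_geN1 cos_le1.
Qed.

Lemma prod_norm_le1 (b : nat -> R) n : (forall k, `|b k| <= 1) ->
  `|\prod_(0 <= k < n) b k| <= 1.
Proof.
move=> b1; elim: n => [|n IH]; first by rewrite big_geq// normr1.
by rewrite big_nat_recr//= normrM mulr_ile1.
Qed.

(** The bound on the distance to the limit is what makes the convergence
uniform when [s] depends on a parameter and [w] does not. *)
Lemma telescoping_cvg (s w : nat -> R) :
  (forall n, `|s n.+1 - s n| <= w n) -> cvgn (series w) ->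
  cvgn s /\ forall N, `|limn s - s N| <= limn (series w) - series w N.
Proof.
move=> sw cw.
have cs : cvgn s.
  have : cvgn (series (telescope s)).
    apply: normed_cvg; apply: (series_le_cvg _ _ sw cw) => n //.
    exact: le_trans (normr_ge0 _) (sw n).
  rewrite telescopeK => cp.
  rewrite (_ : s = (fun n => (s n - s 0) + s 0)); last by apply/funext => n; rewrite subrK.
  by apply: is_cvgD => //; exact: is_cvg_cst.
split => // N.
apply: (@ler_cvg_to nat \oo _ R (fun n => `|s n - s N|) (fun n => series w n - series w N)).
- by apply: cvg_norm; apply: cvgB => //; exact: cvg_cst.
- by apply: (cvgB cw); exact: cvg_cst.
- near=> n.
  have /subnK <- : (N <= n)%N by near: n; exact: nbhs_infty_ge.
  elim: (n - N)%N => [|k IH]; first by rewrite !subrr normr0.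
  rewrite addSn seriesSr [leRHS]addrAC -(subrKA (s (k + N)%N)).
  by rewrite (le_trans (ler_normD _ _))// addrC lerD.
Unshelve. all: by end_near. Qed.

Lemma is_cvg_bessel0_prod (r : nat -> R) y : cvgn (series (fun k => r k ^+ 2)) ->
  cvgn (fun n => \prod_(0 <= k < n) bessel0 (y * r k)).
Proof.
move=> cr; have cy : cvgn (series (fun k => y ^+ 2 * r k ^+ 2)).
  rewrite (_ : (fun k => _) = y ^+ 2 *: (fun k => r k ^+ 2)); last exact/funext.
  exact: is_cvg_seriesZ.
apply: (proj1 (telescoping_cvg _ cy)) => n.
rewrite big_nat_recr//= -{2}[\prod_(0 <= k < n) _]mulr1 -mulrBr normrM distrC -exprMn.
apply: le_trans (bessel0_dist1 _).
by rewrite ler_piMl// prod_norm_le1// => k; exact: bessel0_norm_le1.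
Qed.

Definition bessel_product (r : nat -> R) (y : R) : R :=
  limn (fun n => \prod_(0 <= k < n) bessel0 (y * r k)).

(** A mean-square approximation of the path by the first [n] oscillators
changes the time mean of a Lipschitz function of it by little, so the means
computed in [time_mean_oscillators] pass to the limit. *)
Lemma time_mean_path (Z r th : nat -> R) (x : R -> R) (phi y : R) :
  (forall (c : seq int) k, c`_k != 0 -> \sum_(i < size c) (c`_i)%:~R * Z i != 0) ->
  cvgn (series (fun k => r k ^+ 2)) -> measurable_fun setT x ->
  (forall lam, 0 < lam -> forall n0, exists2 n, (n0 <= n)%N &
    forall N, ~ excess N lam (fun t => x t - oscillators Z r th n t)) ->
  time_mean (fun t => cos (phi + y * x t)) (cos phi * bessel_product r y).
Proof.
move=> indZ cr mx approx.
have mcx (f : R -> R) : measurable_fun setT f ->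
    bounded_measurable (fun t => cos (phi + y * f t)).
  move=> mf; apply: bounded_measurable_cos; apply: measurable_funD; first exact: measurable_cst.
  by apply: measurable_funM => //; exact: measurable_cst.
apply/cvgrPdist_le => eps eps0.
pose e := eps / 4; have e0 : 0 < e by rewrite divr_gt0.
pose K := e^-1 * y ^+ 2; have K0 : 0 <= K by rewrite mulr_ge0 ?sqr_ge0// invr_ge0 ltW.
pose lam := e / (2 * K + 1).
have K1 : 0 < 2 * K + 1 by rewrite ltr_wpDl// mulr_ge0.
have lam0 : 0 < lam by rewrite divr_gt0.
have Klam : 2 * K * lam <= e.
  rewrite /lam mulrCA; apply: ler_piMr; first exact: ltW.
  by rewrite ler_pdivrMr// mul1r lerDl.
have /cvgrPdist_le/(_ _ e0)[n0 _ Hn0] := @is_cvg_bessel0_prod r y cr.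
have [n n0n nexc] := approx _ lam0 n0.
have mo := measurable_oscillators Z r th n.
have /cvgrPdist_le/(_ _ e0) Hn := @time_mean_oscillators R Z indZ r th phi y n.
near=> T.
have T1 : 1 <= T by near: T; exact: nbhs_pinfty_ge.
have h1 : `|cos phi * bessel_product r y - cos phi * \prod_(0 <= k < n) bessel0 (y * r k)| <= e.
  rewrite -mulrBr normrM; apply: le_trans (Hn0 n n0n).
  by rewrite ler_piMl// ler_norml cos_geN1 cos_le1.
have h2 : `|cos phi * \prod_(0 <= k < n) bessel0 (y * r k) -
    interval_avg 0 T (fun t => cos (phi + y * oscillators Z r th n t))| <= e by near: T.
have h3 : `|interval_avg 0 T (fun t => cos (phi + y * x t)
   + (-1) * cos (phi + y * oscillators Z r th n t))| <= e + 2 * K * lam.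
  apply: (@interval_avg_mean_square (fun t => x t - oscillators Z r th n t)) => //.
  - apply: bounded_measurableD; first exact: mcx.
    by apply: bounded_measurableM; [exact: bounded_measurable_cst|exact: mcx].
  - exact: measurable_funB.
  - exact: ltW.
  - exact: ltW.
  - move=> t; rewrite mulN1r; apply: le_trans (cos_lipschitz _ _) _.
    rewrite (_ : _ - _ = y * (x t - oscillators Z r th n t)); last by ring.
    apply: (le_trans (young_le _ e0)).
    by rewrite exprMn mulrA.
rewrite interval_avgD in h3; last 2 first.
- exact: mcx.
- by apply: bounded_measurableM; [exact: bounded_measurable_cst|exact: mcx].
rewrite interval_avgZ in h3; last exact: mcx.
move: h1 h2 h3.
move: (interval_avg 0 T (fun t => cos (phi + y * oscillators _ _ _ _ _))).
move: (interval_avg 0 T (fun t => cos (phi + y * x t))) => B A.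
move: (cos phi * \prod_(0 <= k < n) _) (cos phi * bessel_product r y) => D C h1 h2 h3.
rewrite (_ : C - B = (C - D) + (D - A) - (B + -1 * A)); last by ring.
rewrite (le_trans (ler_normB _ _))// (le_trans (lerD (ler_normD _ _) (lexx _)))//.
rewrite (le_trans (lerD (lerD h1 h2) h3))//.
rewrite (le_trans (lerD (lexx _) (lerD (lexx _) Klam)))//.
by rewrite /e; lra.
Unshelve. all: by end_near. Qed.

End mean_square_approximation.

(** * Time means of Fourier integrals *)

Section modulated_integrals.
Context {R : realType}.
Local Notation mu := (@lebesgue_measure R).
Variable A : R -> R.
Hypothesis iA : mu.-integrable setT (EFin \o A).

Lemma integrable_modulated (phi v : R) :
  mu.-integrable setT (fun y => (A y * cos (phi + y * v))%:E).
Proof.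
apply: le_integrable iA => //.
  apply/measurable_EFinP; apply: measurable_funM.
    by apply/measurable_EFinP; exact: measurable_int iA.
  apply: (measurableT_comp (@measurable_cosine R)).
  apply: measurable_funD; first exact: measurable_cst.
  by apply: measurable_funM => //; exact: measurable_cst.
move=> y _; rewrite lee_fin normrM ler_piMr//.
by rewrite ler_norml cos_geN1 cos_le1.
Qed.

Lemma modulated_integral_continuous (phi : R) :
  continuous (fun v : R => Rintegral mu setT (fun y => A y * cos (phi + y * v))).
Proof.
move=> a; pose f v y := A y * cos (phi + y * v).
have cf y : continuous (f ^~ y).
  move=> v; apply: cvgM; first exact: cvg_cst.
  apply: (continuous_comp (f := fun v : R => phi + y * v)); last exact: continuous_cos.
  by apply: cvgD; [exact: cvg_cst|apply: cvgM; [exact: cvg_cst|exact: cvg_id]].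
apply: (@continuity_under_integral _ _ _ mu f setT measurableT (a - 1) (a + 1) _ _
  (fun y => `|A y|)).
- by move=> v _; exact: integrable_modulated.
- by apply: aeW => y _ v _; exact: cf.
- exact: (integrable_abse iA).
- move=> v _; apply: aeW => y _; rewrite /f normrM ler_piMr//.
  by rewrite ler_norml cos_geN1 cos_le1.
- by rewrite inE/= in_itv/= ltrBlDr !ltrDl ltr01.
Qed.

Lemma bounded_measurable_modulated (phi : R) (x : R -> R) : measurable_fun setT x ->
  bounded_measurable (fun t => Rintegral mu setT (fun y => A y * cos (phi + y * x t))).
Proof.
move=> mx; split.
  have mc := continuous_measurable_fun (@modulated_integral_continuous phi).
  exact: (measurableT_comp mc mx).
exists (Rintegral mu setT (fun y => `|A y|)) => t.
apply: le_trans (le_normr_Rintegral _ (integrable_modulated phi (x t))) _ => //.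
apply: le_Rintegral => //.
- exact: integrable_abse (integrable_modulated phi (x t)).
- exact: (integrable_abse iA).
- move=> y _; rewrite normrM ler_piMr//.
  by rewrite ler_norml cos_geN1 cos_le1.
Qed.

End modulated_integrals.

Section fourier_time_means.
Context {R : realType}.
Local Notation mu := (@lebesgue_measure R).
Variables (x A : R -> R) (phi : R).
Hypothesis mx : measurable_fun setT x.
Hypothesis iA : mu.-integrable setT (EFin \o A).

Let mA : measurable_fun setT A.
Proof. by apply/measurable_EFinP; exact: measurable_int iA. Qed.

Let measurable_phase : measurable_fun setT
  (fun u : measurableTypeR R * measurableTypeR R => A u.2 * cos (phi + u.2 * x u.1)).
Proof.
apply: measurable_funM; first exact: (measurableT_comp mA measurable_snd).
apply: (measurableT_comp (@measurable_cosine R)).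
apply: measurable_funD; first exact: measurable_cst.
apply: measurable_funM; first exact: measurable_snd.
exact: (measurableT_comp mx measurable_fst).
Qed.

Let mcos y : measurable_fun setT (fun t => cos (phi + y * x t)).
Proof.
apply: (measurableT_comp (@measurable_cosine R)).
apply: measurable_funD; first exact: measurable_cst.
by apply: measurable_funM => //; exact: measurable_cst.
Qed.

Let bcos y : bounded_measurable (fun t => cos (phi + y * x t)).
Proof.
by split => //; exists 1 => t; rewrite ler_norml cos_geN1 cos_le1.
Qed.

Let integrable_phase t : mu.-integrable setT (fun y => (A y * cos (phi + y * x t))%:E).
Proof. exact: integrable_modulated. Qed.

Section fixed_horizon.
Variable T : R.
Hypothesis T0 : 0 < T.

(** The indicator confines time to [[0, T]] while both variables range over
the whole line, as Fubini for the product Lebesgue measure requires. *)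
Let kernel (u : measurableTypeR R * measurableTypeR R) : \bar R :=
  (\1_(`[0, T]%classic : set R) u.1 * (A u.2 * cos (phi + u.2 * x u.1)))%:E.

Let measurable_kernel : measurable_fun setT kernel.
Proof.
apply/measurable_EFinP; apply: measurable_funM; last exact: measurable_phase.
apply: (measurableT_comp _ measurable_fst); exact: measurable_indic.
Qed.

Let integrable_kernel : (mu \x mu)%E.-integrable setT kernel.
Proof.
apply/(integrable21ltyP _ _ measurable_kernel).
apply: (@le_lt_trans _ _ (\int[mu]_y (`|(A y)%:E| * T%:E))%E).
  apply: ge0_le_integral => //.
  - by move=> y _; exact: integral_ge0.
  - apply: (measurable_fun_fubini_tonelli_G (abse \o kernel)).
      exact: measurableT_comp.
    by move=> u; exact: abse_ge0.
  - apply: emeasurable_funM; last exact: measurable_cst.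
    by apply: measurableT_comp => //; exact: measurable_int iA.
  - move=> y _.
    apply: (@le_trans _ _ (\int[mu]_t (`|(A y)%:E| * (\1_(`[0, T]%classic : set R) t)%:E))%E).
      apply: ge0_le_integral => //.
      + apply: measurableT_comp => //.
        exact: (measurableT_comp measurable_kernel (measurable_pair2 y)).
      + apply: emeasurable_funM; first exact: measurable_cst.
        by apply/measurable_EFinP; exact: measurable_indic.
      + move=> t _; rewrite /kernel/= lee_fin normrM mulrC (ger0_norm (_ : 0 <= \1_ _ t))//.
        apply: ler_wpM2r => //; rewrite normrM ler_piMr//.
        by rewrite ler_norml cos_geN1 cos_le1.
    rewrite ge0_integralZl//; last by apply/measurable_EFinP; exact: measurable_indic.
    rewrite integral_indic// setIT.
    have /= -> := lebesgue_measure_itv `[0, T].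
    by rewrite lte_fin T0 -EFinB subr0.
have [_ lty] := integrableP _ _ _ iA.
rewrite ge0_integralZr//; last 2 first.
- exact: (measurableT_comp _ (measurable_int _ iA)).
- by rewrite lee_fin ltW.
rewrite lte_mul_pinfty//; first exact: integral_ge0.
  by rewrite ge0_fin_numE//; exact: integral_ge0.
exact: ltry.
Qed.

Lemma integral_kernel_time y : (\int[mu]_t kernel (t, y) =
  (A y * (T * interval_avg 0 T (fun t => cos (phi + y * x t))))%:E)%E.
Proof.
have ic := bounded_measurable_integrable 0 T (bcos y).
rewrite /interval_avg subr0 mulVKf ?gt_eqF// EFinM /Rintegral fineK; last first.
  exact: integrable_fin_num.
rewrite -integralZl// [RHS]integral_mkcond epatch_indic.
by apply: eq_integral => t _; rewrite /kernel/= -EFinM mulrC.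
Qed.

Lemma measurable_mean_weight :
  measurable_fun setT (fun y => A y * interval_avg 0 T (fun t => cos (phi + y * x t))).
Proof.
have mG := measurable_fubini_G integrable_kernel.
apply/measurable_EFinP.
rewrite (_ : EFin \o _ = (fun y => (T^-1)%:E * fubini_G mu kernel y)%E).
  by apply: emeasurable_funM => //; exact: measurable_cst.
apply/funext => y; rewrite /fubini_G integral_kernel_time -EFinM/=.
by congr (_%:E); rewrite [RHS]mulrCA mulKf ?gt_eqF.
Qed.

Lemma interval_avg_fourier :
  interval_avg 0 T (fun t => Rintegral mu setT (fun y => A y * cos (phi + y * x t))) =
  Rintegral mu setT (fun y => A y * interval_avg 0 T (fun t => cos (phi + y * x t))).
Proof.
have := Fubini integrable_kernel.
under [RHS]eq_integral do rewrite integral_kernel_time.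
rewrite (_ : \int[mu]_t \int[mu]_y kernel (t, y) = \int[mu]_(t in `[0%R, T])
  (Rintegral mu setT (fun y => (A y * cos (phi + y * x t))%R))%:E)%E; last first.
  rewrite [RHS]integral_mkcond epatch_indic; apply: eq_integral => t _.
  rewrite /kernel/= /Rintegral fineK; last exact: integrable_fin_num.
  rewrite muleC -integralZl//.
move=> E; rewrite [LHS]/interval_avg subr0 [X in _ * X]/Rintegral E.
rewrite (_ : fine _ = T * Rintegral mu setT (fun y => A y * interval_avg 0 T (fun t => cos (phi + y * x t)))).
  by rewrite mulKf ?gt_eqF.
rewrite -RintegralZl//; first by apply: eq_Rintegral => y _; rewrite mulrCA.
apply: le_integrable iA => //.
  by apply/measurable_EFinP; exact: measurable_mean_weight.
move=> y _; rewrite lee_fin normrM ler_piMr//.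
rewrite -[X in `|X|]subr0 -[X in _ - X](interval_avg_cst 0 T0).
apply: interval_avg_dist => //; first exact: bounded_measurable_cst.
by move=> t; rewrite subr0 ler_norml cos_geN1 cos_le1.
Qed.

End fixed_horizon.

Variables (k : R) (Phi : R -> R).
Hypothesis mean_cos : forall y, time_mean (fun t => cos (phi + y * x t)) (k * Phi y).

(** Fubini moves the time mean inside the integral over [y]. There it is
bounded by 1 and converges for every [y], so dominated convergence applies;
it is used along sequences of horizons tending to infinity. *)
Lemma time_mean_fourier :
  time_mean (fun t => Rintegral mu setT (fun y => A y * cos (phi + y * x t)))
    (Rintegral mu setT (fun y => A y * (k * Phi y))).
Proof.
apply/cvg_pinftyP => u uoo.
have /cvgryPge/(_ 1)[N _ uN] := uoo.
have u0 n : 0 < u (n + N)%N.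
  by apply: lt_le_trans ltr01 _; apply: uN; rewrite /= leq_addl.
have {}uoo : u (n + N)%N @[n --> \oo] --> +oo by exact: (cvg_comp _ _ (cvg_addnr N) uoo).
rewrite -(cvg_shiftn N).
have mean_le1 n y : `|interval_avg 0 (u (n + N)%N) (fun t => cos (phi + y * x t))| <= 1.
  rewrite -[X in `|X|]subr0 -[X in _ - X](interval_avg_cst 0 (u0 n)).
  apply: interval_avg_dist => //; first exact: bounded_measurable_cst.
  by move=> t; rewrite subr0 ler_norml cos_geN1 cos_le1.
pose g n y := A y * interval_avg 0 (u (n + N)%N) (fun t => cos (phi + y * x t)).
have gcvg y : g n y @[n --> \oo] --> A y * (k * Phi y).
  apply: cvgM; first exact: cvg_cst.
  have /cvg_pinftyP/(_ _ uoo) := @mean_cos y; exact.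
have mg n : measurable_fun setT (g n) by exact: measurable_mean_weight.
have mL : measurable_fun setT (fun y => A y * (k * Phi y)).
  by apply: (measurable_fun_cvg mg) => y _; exact: gcvg.
have g_le n y : `|g n y| <= `|A y| by rewrite normrM ler_piMr.
have [iL _ cvgL] : [/\ mu.-integrable setT (fun y => (A y * (k * Phi y))%:E),
   (fun n => \int[mu]_y `|(g n y)%:E - (A y * (k * Phi y))%:E|)%E @ \oo --> 0%E &
   (fun n => \int[mu]_y (g n y)%:E)%E @ \oo --> (\int[mu]_y (A y * (k * Phi y))%:E)%E].
  apply: (@dominated_convergence _ _ _ mu setT _ _ _ (fun y => `|(A y)%:E|)%E) => //.
  - by move=> n; apply/measurable_EFinP; exact: mg.
  - exact/measurable_EFinP.
  - apply: aeW => y _; apply: cvg_EFin; first exact: nearW.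
    exact: gcvg.
  - exact: integrable_abse.
  - by apply: aeW => y n _; rewrite /= lee_fin.
rewrite (_ : (fun n => _) = (fun n => fine (\int[mu]_y (g n y)%:E)%E)).
  apply: fine_cvg; rewrite /Rintegral fineK//; exact: integrable_fin_num.
by apply/funext => n; rewrite interval_avg_fourier.
Qed.

End fourier_time_means.

Section complex_means.
Context {R : realType}.
Local Notation mu := (@lebesgue_measure R).

Lemma Re_mulr_real (z : R[i]) (a : R) : complex.Re (z * a%:C) = complex.Re z * a.
Proof. by case: z => b c; simpc. Qed.

Lemma Im_mulr_real (z : R[i]) (a : R) : complex.Im (z * a%:C) = complex.Im z * a.
Proof. by case: z => b c; simpc. Qed.

(** The sine is written as a cosine with shifted phase, so that one hypothesis on
the time means of [cos (phi + y * x t)] covers both. *)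
Lemma Re_mulr_cexpi (z : R[i]) (v : R) :
  complex.Re (z * cexpi v) = complex.Re z * cos (0 + v) + complex.Im z * cos (pi / 2 + v).
Proof. by case: z => b c; rewrite add0r [pi / 2 + v]addrC cosDpihalf /cexpi; simpc. Qed.

Lemma Im_mulr_cexpi (z : R[i]) (v : R) :
  complex.Im (z * cexpi v) = complex.Re z * cos (- (pi / 2) + v) + complex.Im z * cos (0 + v).
Proof. by case: z => b c; rewrite add0r [- (pi / 2) + v]addrC cosBpihalf /cexpi; simpc. Qed.

(** The imaginary part is the circle average of [sin (s * cos x)], which changes
sign under [x + pi]. *)
Lemma J0E (s : R) : J0 s = (bessel0 s)%:C.
Proof.
have sin0 : Rintegral mu `[- pi, pi] (fun x => sin (s * cos x)) = 0.
  have : circle_avg (fun x : R => sin (s * cos x)) = 0.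
    apply: (@circle_avg_antiperiodic _ pi) => [|x|x].
    - split; last by exists 1 => x; rewrite ler_norml sin_geN1 sin_le1.
      apply: (measurableT_comp (continuous_measurable_fun (@continuous_sin R))).
      by apply: measurable_funM; [exact: measurable_cst|exact: measurable_cosine].
    - by rewrite mulr_natl cosD2pi.
    - by rewrite cosDpi mulrN sinN.
  rewrite /circle_avg /interval_avg => /eqP; rewrite mulf_eq0 invr_eq0 opprK.
  by rewrite -mulr2n mulrn_eq0/= gt_eqF ?pi_gt0//= => /eqP.
apply/eqP; rewrite eq_complex /J0 /Cint mulrC Re_mulr_real Im_mulr_real /= sin0 mul0r eqxx andbT.
rewrite mulrC /bessel0 /circle_avg /interval_avg opprK; apply/eqP; congr (_^-1 * _).
by rewrite mulr_natl mulr2n.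
Qed.

Lemma Cprod_J0 (r : nat -> R) (y : R) :
  Cprod (fun k => J0 (y * r k)) = (bessel_product r y)%:C.
Proof.
rewrite /Cprod /Clim.
have E n : \prod_(0 <= k < n) J0 (y * r k) = (\prod_(0 <= k < n) bessel0 (y * r k))%:C.
  by rewrite rmorph_prod; apply: eq_bigr => k _; rewrite J0E.
rewrite /bessel_product; congr (_ +i* _).
  by congr (lim (_ @ \oo)); apply/funext => n; rewrite E.
by rewrite (_ : (fun n => _) = (fun=> 0)) ?lim_cst//; apply/funext => n; rewrite E.
Qed.

Variables (x Phi : R -> R).
Hypothesis mx : measurable_fun setT x.
Hypothesis mean_cos : forall phi y,
  time_mean (fun t => cos (phi + y * x t)) (cos phi * Phi y).

(** The real part of the inversion formula yields the limit. Its imaginary part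
is the zero function along the path, and the time mean of that function
shows that the imaginary part of the right-hand side vanishes. *)
Lemma time_mean_inversion (h : R -> R) (F : R -> R[i]) :
  Cintegrable mu setT F ->
  (forall v, (h v)%:C = Cint mu setT (fun y => F y * cexpi (v * y))) ->
  exists2 L, time_mean (fun t => h (x t)) L &
    L%:C = Cint mu setT (fun y => F y * (Phi y)%:C).
Proof.
move=> [iRe iIm] hF.
pose G (A : R -> R) phi t := Rintegral mu setT (fun y => A y * cos (phi + y * x t)).
have split_int (A B : R -> R) (iA : mu.-integrable setT (EFin \o A))
    (iB : mu.-integrable setT (EFin \o B)) phi psi t :
    Rintegral mu setT (fun y => A y * cos (phi + x t * y) + B y * cos (psi + x t * y)) =
    G A phi t + G B psi t.
  rewrite /G -RintegralD//; last 2 first.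
  - exact: integrable_modulated.
  - exact: integrable_modulated.
  by apply: eq_Rintegral => y _; rewrite [y * _]mulrC.
have mean2 (A B : R -> R) (iA : mu.-integrable setT (EFin \o A))
    (iB : mu.-integrable setT (EFin \o B)) phi psi :
    time_mean (fun t => G A phi t + G B psi t)
      (Rintegral mu setT (fun y => A y * (cos phi * Phi y)) +
       Rintegral mu setT (fun y => B y * (cos psi * Phi y))).
  apply: time_meanD.
  - exact: bounded_measurable_modulated.
  - exact: bounded_measurable_modulated.
  - exact: time_mean_fourier.
  - exact: time_mean_fourier.
have zero_int (A : R -> R) (c : R) : c = 0 -> Rintegral mu setT (fun y => A y * (c * Phi y)) = 0.
  move=> ->; under eq_Rintegral do rewrite mul0r mulr0.
  by rewrite Rintegral_cst// mul0r.
have one_int (A : R -> R) : Rintegral mu setT (fun y => A y * (cos 0 * Phi y)) =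
    Rintegral mu setT (fun y => A y * Phi y).
  by apply: eq_Rintegral => y _; rewrite cos0 mul1r.
exists (Rintegral mu setT (fun y => complex.Re (F y) * Phi y)).
  rewrite (_ : (fun t => _) = (fun t => G (fun y => complex.Re (F y)) 0 t +
      G (fun y => complex.Im (F y)) (pi / 2) t)); last first.
    apply/funext => t; rewrite -split_int//.
    have := congr1 (@complex.Re R) (hF (x t)); rewrite /= => ->.
    by apply: eq_Rintegral => y _; rewrite Re_mulr_cexpi.
  have := mean2 _ _ iRe iIm 0 (pi / 2).
  by rewrite (zero_int _ _ (@cos_pihalf R)) one_int addr0.
have ImE : Rintegral mu setT (fun y => complex.Im (F y) * Phi y) = 0.
  have := mean2 _ _ iRe iIm (- (pi / 2)) 0.
  rewrite (zero_int _ (cos _)) ?cosN ?cos_pihalf// one_int add0r => H.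
  rewrite (_ : (fun t => _ + _) = (fun=> 0)) in H; first exact: time_mean_unique H (@time_mean_cst R 0).
  apply/funext => t; rewrite -split_int//.
  have /= E := congr1 (@complex.Im R) (hF (x t)); rewrite [RHS]E.
  by apply: eq_Rintegral => y _; rewrite Im_mulr_cexpi.
apply/eqP; rewrite eq_complex /Cint /=; apply/andP; split; apply/eqP.
  by apply: eq_Rintegral => y _; rewrite Re_mulr_real.
by rewrite -[LHS]ImE; apply: eq_Rintegral => y _; rewrite Im_mulr_real.
Qed.

End complex_means.

(** * Time means of Fourier series *)

Section symmetric_sums.
Context {R : realType}.

Definition symmetric_sum (V : nmodType) (u : int -> V) (N : nat) : V :=
  \sum_(0 <= k < N.*2.+1) u (k%:Z - N%:Z).

Lemma symmetric_sumS (V : nmodType) (u : int -> V) N :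
  symmetric_sum u N.+1 = symmetric_sum u N + (u (N.+1%:Z) + u (- N.+1%:Z)).
Proof.
rewrite /symmetric_sum doubleS big_nat_recl// big_nat_recr//=.
rewrite (_ : (N.*2.+2)%:Z - N.+1%:Z = N.+1%:Z); last by lia.
rewrite sub0r addrC -addrA; congr (_ + _).
by apply: eq_bigr => k _; congr (u _); lia.
Qed.

Lemma symmetric_sum_tail (u : int -> R) (b : int -> R) :
  (forall n, `|u n| <= b n) ->
  cvgn (series (fun j : nat => b j.+1%:Z + b (- j.+1%:Z))) ->
  cvgn (symmetric_sum u) /\ forall N, `|limn (symmetric_sum u) - symmetric_sum u N| <=
    limn (series (fun j : nat => b j.+1%:Z + b (- j.+1%:Z))) -
    series (fun j : nat => b j.+1%:Z + b (- j.+1%:Z)) N.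
Proof.
move=> ub; apply: telescoping_cvg => N.
rewrite symmetric_sumS addrAC subrr add0r.
by rewrite (le_trans (ler_normD _ _))// lerD.
Qed.

Lemma summable_int_series (b : int -> R) : (forall n, 0 <= b n) ->
  (\esum_(n in [set: int]) (b n)%:E < +oo)%E ->
  cvgn (series (fun j : nat => b j.+1%:Z + b (- j.+1%:Z))).
Proof.
move=> b0 sb.
have half (e : nat -> int) : injective e -> cvgn (series (fun j => b (e j))).
  move=> inj_e; apply: nondecreasing_is_cvgn.
    apply/nondecreasing_seqP => n; rewrite seriesSr lerDl; exact: b0.
  have E : (\sum_(j <oo) (b (e j))%:E <= \esum_(n in [set: int]) (b n)%:E)%E.
    rewrite nneseries_esumT; last by move=> j; rewrite lee_fin.
    rewrite -(esum_image setT e (fun n => (b n)%:E)); last by move=> i j _ _; exact: inj_e.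
    rewrite esum_mkcond; apply: le_esum => i _.
    by case: ifP => // _; rewrite lee_fin.
  exists (fine (\esum_(n in [set: int]) (b n)%:E)%E) => _ [n _ <-].
  rewrite -lee_fin fineK; last first.
    by rewrite ge0_fin_numE//; apply: esum_ge0 => i _; rewrite lee_fin.
  apply: le_trans E; rewrite /series/= -sumEFin.
  by apply: nneseries_lim_ge => j _ _; rewrite lee_fin.
have := is_cvg_seriesD (half (fun j => j.+1%:Z) _) (half (fun j => - j.+1%:Z) _).
by apply => i j /eqP; rewrite ?eqr_opp eqz_nat eqSS => /eqP.
Qed.

Local Notation normc := ComplexField.Normc.normc.

Lemma Re_le_normc (z : R[i]) : `|complex.Re z| <= normc z.
Proof.
case: z => a b; rewrite /= -sqrtr_sqr ler_wsqrtr// lerDl sqr_ge0//.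
Qed.

Lemma Im_le_normc (z : R[i]) : `|complex.Im z| <= normc z.
Proof.
case: z => a b; rewrite /= -sqrtr_sqr ler_wsqrtr// lerDr sqr_ge0//.
Qed.

Lemma normc_mul_cexpi (z : R[i]) (v : R) : normc (z * cexpi v) = normc z.
Proof.
case: z => a b; rewrite /cexpi /= ; congr Num.sqrt; simpc.
have := cos2Dsin2 v; move: (cos v) (sin v) => c s cs.
rewrite (_ : _ + _ = (a ^+ 2 + b ^+ 2) * (c ^+ 2 + s ^+ 2)); last by ring.
by rewrite cs mulr1.
Qed.

Lemma normc_ge0 (z : R[i]) : 0 <= normc z.
Proof. by case: z => a b; exact: sqrtr_ge0. Qed.

Lemma ZsumE (u : int -> R[i]) : Zsum u =
  limn (symmetric_sum (fun n => complex.Re (u n))) +i*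
  limn (symmetric_sum (fun n => complex.Im (u n))).
Proof.
rewrite /Zsum /Clim; congr (_ +i* _); congr (lim (_ @ \oo)); apply/funext => N.
  by apply: (big_morph (@complex.Re R)) => // [[a b] [c d]].
by apply: (big_morph (@complex.Im R)) => // [[a b] [c d]].
Qed.

End symmetric_sums.

Section fourier_series_means.
Context {R : realType}.
Variables (x Phi : R -> R).
Hypothesis mx : measurable_fun setT x.
Hypothesis mean_cos : forall phi y,
  time_mean (fun t => cos (phi + y * x t)) (cos phi * Phi y).

Lemma mean_cos_le1 y : `|Phi y| <= 1.
Proof.
have H := @mean_cos 0 y; rewrite cos0 mul1r in H.
apply: (@ler_cvg_to R +oo _ R
  (fun T => `|interval_avg 0 T (fun t => cos (0 + y * x t))|) (fun=> 1)).
- exact: cvg_norm H.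
- exact: cvg_cst.
- near=> T; have T0 : 0 < T by near: T; exact: nbhs_pinfty_gt.
  rewrite -[X in `|X|]subr0 -[X in _ - X](interval_avg_cst 0 T0).
  apply: interval_avg_dist => //; last by move=> t; rewrite subr0 ler_norml cos_geN1 cos_le1.
    apply: bounded_measurable_cos; apply: measurable_funD; first exact: measurable_cst.
    by apply: measurable_funM => //; exact: measurable_cst.
  exact: bounded_measurable_cst.
Unshelve. all: by end_near. Qed.

(** The symmetric partial sums converge uniformly, by comparison with the
summable bounds [b], and each of them is a finite combination of cosines. *)
Lemma time_mean_series (A B b : int -> R) (phi psi om : R) (g : R -> R) :
  (forall n v, `|A n * cos (phi + v) + B n * cos (psi + v)| <= b n) ->
  cvgn (series (fun j : nat => b j.+1%:Z + b (- j.+1%:Z))) ->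
  (forall v, g v = limn (symmetric_sum
     (fun n => A n * cos (phi + om * n%:~R * v) + B n * cos (psi + om * n%:~R * v)))) ->
  time_mean (fun t => g (x t)) (limn (symmetric_sum
     (fun n => A n * (cos phi * Phi (om * n%:~R)) + B n * (cos psi * Phi (om * n%:~R))))).
Proof.
move=> AB cb gE.
have AB0 n y : `|A n * (cos phi * Phi y) + B n * (cos psi * Phi y)| <= b n.
  have := AB n 0; rewrite !addr0 => H; apply: le_trans H.
  rewrite !mulrA -mulrDl normrM ler_piMr//; exact: mean_cos_le1.
pose u v n := A n * cos (phi + om * n%:~R * v) + B n * cos (psi + om * n%:~R * v).
pose w (j : nat) : R := b j.+1%:Z + b (- j.+1%:Z).
have mcos th y : bounded_measurable (fun t => cos (th + y * x t)).
  apply: bounded_measurable_cos; apply: measurable_funD; first exact: measurable_cst.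
  by apply: measurable_funM => //; exact: measurable_cst.
have mk (k y th : R) : bounded_measurable (fun t => k * cos (th + y * x t)).
  by apply: bounded_measurableM; [exact: bounded_measurable_cst|exact: mcos].
have mF N : bounded_measurable (fun t => symmetric_sum (u (x t)) N).
  apply: bounded_measurable_sum => i; exact: bounded_measurableD.
have tail v := symmetric_sum_tail (fun n => AB n (om * n%:~R * v)) cb.
apply: (@time_mean_uniform_limit _ _ _ (fun N t => symmetric_sum (u (x t)) N)
  (symmetric_sum (fun n => A n * (cos phi * Phi (om * n%:~R)) + B n * (cos psi * Phi (om * n%:~R))))
  (fun N => limn (series w) - series w N)) => //.
- split.
    apply: (@measurable_fun_cvg _ _ _ setT (fun N t => symmetric_sum (u (x t)) N)).
      by move=> N; case: (mF N).
    by move=> t _; rewrite gE; case: (tail (x t)).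
  have [_ [M FM]] := mF 0%N.
  exists (limn (series w) - series w 0%N + M) => t.
  have [_ /(_ 0%N)] := tail (x t); rewrite -gE -/w => H.
  rewrite -(subrK (symmetric_sum (u (x t)) 0%N) (g (x t))).
  by rewrite (le_trans (ler_normD _ _))// lerD.
- by move=> N t; rewrite gE; case: (tail (x t)).
- by case: (symmetric_sum_tail (fun n => AB0 n (om * n%:~R)) cb).
- move=> N; apply: time_mean_sum => i; first exact: bounded_measurableD.
  by apply: time_meanD => //; apply: time_meanZ => //; exact: mcos.
- rewrite -(subrr (limn (series w))); apply: cvgB => //; exact: cvg_cst.
Qed.

(** As for the integral, the imaginary part of the expansion of [h] is zero
along the path and contributes the vanishing imaginary part of the limit. *)
Lemma time_mean_fourier_series (h : R -> R) (c : int -> R[i]) (om : R) :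
  (\esum_(n in [set: int]) (ComplexField.Normc.normc (c n))%:E < +oo)%E ->
  (forall v, (h v)%:C = Zsum (fun n => c n * cexpi (om * n%:~R * v))) ->
  exists2 L, time_mean (fun t => h (x t)) L &
    L%:C = Zsum (fun n => c n * (Phi (om * n%:~R))%:C).
Proof.
move=> sc hE.
have cb := summable_int_series (fun n => normc_ge0 (c n)) sc.
have reb n v : `|complex.Re (c n) * cos (0 + v) + complex.Im (c n) * cos (pi / 2 + v)|
    <= ComplexField.Normc.normc (c n).
  by rewrite -Re_mulr_cexpi -(normc_mul_cexpi _ v) Re_le_normc.
have imb n v : `|complex.Re (c n) * cos (- (pi / 2) + v) + complex.Im (c n) * cos (0 + v)|
    <= ComplexField.Normc.normc (c n).
  by rewrite -Im_mulr_cexpi -(normc_mul_cexpi _ v) Im_le_normc.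
have hRe v := congr1 (@complex.Re R) (hE v).
have hIm v := congr1 (@complex.Im R) (hE v).
have Hre := time_mean_series (g := h) (om := om) reb cb.
have Him := time_mean_series (g := fun=> 0) (om := om) imb cb.
rewrite ZsumE; exists (limn (symmetric_sum (fun n => complex.Re (c n * (Phi (om * n%:~R))%:C)))).
  rewrite (_ : (fun n => _) = (fun n => complex.Re (c n) * (cos 0 * Phi (om * n%:~R)) +
    complex.Im (c n) * (cos (pi / 2) * Phi (om * n%:~R)))); last first.
    by apply/funext => n; rewrite cos0 cos_pihalf mul0r mulr0 addr0 mul1r Re_mulr_real.
  apply: Hre => v; have := hRe v; rewrite ZsumE/= => ->; congr (lim (symmetric_sum _ @ \oo)).
  by apply/funext => n; rewrite Re_mulr_cexpi.
congr (_ +i* _); apply: time_mean_unique (@time_mean_cst R 0) _.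
rewrite (_ : (fun n => complex.Im _) = (fun n => complex.Re (c n) * (cos (- (pi / 2)) * Phi (om * n%:~R)) +
    complex.Im (c n) * (cos 0 * Phi (om * n%:~R)))); last first.
  by apply/funext => n; rewrite cos0 cosN cos_pihalf mul0r mulr0 add0r mul1r Im_mulr_real.
apply: Him => v; have := hIm v; rewrite ZsumE/= => E; rewrite [LHS]E; congr (lim (symmetric_sum _ @ \oo)).
by apply/funext => n; rewrite Im_mulr_cexpi.
Qed.

End fourier_series_means.

(** * The harmonizable process *)

Section grouping.
Context {R : realType} d {Omega : measurableType d} (P : probability Omega R).
Variables (I : finType) (F : I -> set (set Omega)) (i0 : I).
Hypothesis FT : forall i, F i setT.
Hypothesis FI : forall i, setI_closed (F i).
Hypothesis mF : forall i, F i `<=` measurable.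
Hypothesis iF : independent_systems P F.

(** The pi-system generated by all the systems except [F i0]. *)
Definition grouped : set (set Omega) :=
  [set C | exists E, [/\ forall i, F i (E i), E i0 = setT & C = \bigcap_i E i]].

Lemma grouped_setT : grouped setT.
Proof. by exists (fun=> setT); split => //; rewrite bigcap_const//; exists i0. Qed.

Lemma grouped_setI : setI_closed grouped.
Proof.
move=> _ _ [E [FE Ei0 ->]] [G [FG Gi0 ->]]; exists (fun i => E i `&` G i); split.
- by move=> i; exact: FI.
- by rewrite Ei0 Gi0 setTI.
- by rewrite bigcapI.
Qed.

Lemma grouped_measurable : grouped `<=` measurable.
Proof.
move=> _ [E [FE _ ->]]; apply: fin_bigcap_measurable => [|i _]; last exact: mF.
exact: finite_finset.
Qed.

Lemma sub_grouped i : i != i0 -> F i `<=` grouped.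
Proof.
move=> ii0 B FB; exists (fun j => if j == i then B else setT); split.
- by move=> j; case: eqP => [->//|_]; exact: FT.
- by rewrite eq_sym (negbTE ii0).
- apply/seteqP; split => w; last by move/(_ i Logic.I); rewrite eqxx.
  by move=> Bw j _; case: ifP.
Qed.

Lemma grouped_indep A B : grouped A -> F i0 B -> P (A `&` B) = (P A * P B)%E.
Proof.
move=> [E [FE Ei0 ->]] FB.
pose J := [fset i | i in I]%fset.
have JT : [set` J] = setT by apply/seteqP; split => i //= _; apply/imfsetP; exists i.
have i0J : i0 \in J by apply/imfsetP; exists i0.
have mE i : measurable (E i) by exact: mF.
pose G i := if i == i0 then B else E i.
have FG i : F i (G i) by rewrite /G; case: eqP => [->//|_]; exact: FE.
have -> : \bigcap_i E i `&` B = \bigcap_i G i.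
  apply/seteqP; split => w.
    by move=> [Ew Bw] i _; rewrite /G; case: ifP => // _; exact: Ew.
  move=> Gw; split; last by have := Gw i0 Logic.I; rewrite /G eqxx.
  move=> i _; have := Gw i Logic.I; rewrite /G; case: eqP => // ->.
  by rewrite Ei0.
rewrite -JT (iF (fun i _ => FG i)) (iF (fun i _ => FE i)).
rewrite (big_fsetD1 i0)//= [in RHS](big_fsetD1 i0)//= /G eqxx Ei0 probability_setT/= mul1r.
rewrite -[P B]fineK ?fin_num_measure//; last exact: mF FB.
rewrite -EFinM mulrC; congr (_ * _)%:E; apply: eq_big_seq => i.
by rewrite in_fsetD1 => /andP[/negbTE ->].
Qed.

End grouping.

Lemma excess_lower (R : realType) N (lam lam' : R) f :
  lam <= lam' -> excess N lam' f -> excess N lam f.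
Proof.
move=> ll [T TN lT]; exists T => //; apply: le_lt_trans lT.
by rewrite lee_fin ler_wpM2r.
Qed.

Section harmonizable_paths.
Context {R : realType} d {Omega : measurableType d} (P : probability Omega R).

Lemma measurable_amplitude d' (T : measurableType d') (alpha mass : R)
    (Gam G1 G2 : nat -> T -> measurableTypeR R) k :
  measurable_fun setT (Gam k) -> measurable_fun setT (G1 k) ->
  measurable_fun setT (G2 k) ->
  measurable_fun setT (amplitude alpha mass Gam G1 G2 k).
Proof.
move=> mG m1 m2; apply: measurable_funM; first apply: measurable_funM.
- exact: measurable_cst.
- exact: (measurableT_comp (measurable_powR _) mG).
- have ms : measurable_fun setT (Num.sqrt : R -> R).
    by apply: continuous_measurable_fun; exact: sqrt_continuous.
  apply: (measurableT_comp ms); apply: measurable_funD.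
    exact: measurable_funX.
  exact: measurable_funX.
Qed.

Lemma sigma_RV_sub_seq (Y : nat -> Omega -> R) k : sigma_RV (Y k) `<=` sigma_seq Y.
Proof. by move=> B sB; apply: sub_gen_smallest; exists k. Qed.

Variables (alpha : R) (m : {finite_measure set (measurableTypeR R) -> \bar R}).
Variables (f : R -> R) (X : R -> Omega -> R).
Variables (Gam G1 G2 Z Th : nat -> {RV P >-> measurableTypeR R}).
Hypothesis alpha02 : 0 < alpha < 2.
Hypothesis density : forall A : set R, measurable A ->
     m A = (\int[lebesgue_measure]_(x in A) (f x)%:E)%E.
Hypothesis mX : measurable_fun setT (fun tw : measurableTypeR R * Omega => X tw.1 tw.2).
Hypothesis data : series_data P m Gam G1 G2 Z Th.
Let Rk := amplitude alpha (fine (m setT)) Gam G1 G2.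
Hypothesis seriesX : forall t : R, {ae P, forall w,
     series (fun k => Rk k w * cos (Th k w + t * Z k w)) @ \oo --> X t w}.

Lemma path_measurable w : measurable_fun setT (fun t : R => X t w).
Proof. exact: (measurableT_comp mX (measurable_pair2 w)). Qed.

Lemma frequencies_atomless k (c : measurableTypeR R) : P (Z k @^-1` [set c]) = 0%E.
Proof.
have [_ _ [_ lawZ] _ _] := data.
have mc : measurable ([set c] : set R) := measurable_set1 c.
by rewrite lawZ// (density mc) integral_set1.
Qed.

Let F (i : 'I_5) := sigma_seq (tnth [tuple (fun k => Gam k : Omega -> R); (fun k => G1 k : Omega -> R);
   (fun k => G2 k : Omega -> R); (fun k => Z k : Omega -> R); (fun k => Th k : Omega -> R)] i).
(* Index 4 holds the phases: [AA] is generated by the amplitudes and frequencies. *)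
Let AA := grouped F ord_max.

Let FT i : F i setT.
Proof. exact: (@measurableT _ (g_sigma_algebraType _)). Qed.

Let FI i : setI_closed (F i).
Proof. by move=> A B; exact: (@measurableI _ (g_sigma_algebraType _)). Qed.

Let mF i : F i `<=` measurable.
Proof.
have rv (Y : {RV P >-> measurableTypeR R}) : sigma_RV (Y : Omega -> R) `<=` measurable.
  by move=> _ [C mC <-]; exact: (@measurable_funPT _ _ _ _ Y measurableT C mC).
apply: smallest_sub; first exact: sigma_algebra_measurable.
move=> B [k _ sB]; case: i sB => -[|[|[|[|[|//]]]]] i5; rewrite (tnth_nth (fun _ _ => 0)) => /= sB;
  exact: rv sB.
Qed.

Let adapted (i : 'I_5) (Y : nat -> Omega -> R) : (i < 4)%N -> F i = sigma_seq Y ->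
  forall k, sigma_RV (Y k) `<=` <<s AA >>.
Proof.
move=> i4 FE k B sB; apply: sub_gen_smallest; apply: (@sub_grouped _ _ _ F _ _ i) => //.
  by rewrite -val_eqE/= neq_ltn i4.
by rewrite FE; exact: sigma_RV_sub_seq sB.
Qed.

(** The null event is chosen once for all [phi] and [y]; it gathers the failures
of square summability, of rational independence, and of the mean-square
approximation for the countably many levels [1/(k+1)]. *)
Lemma mean_cos_path : {ae P, forall w, forall phi y,
  time_mean (fun t => cos (phi + y * X t w)) (cos phi * bessel_product (Rk ^~ w) y)}.
Proof.
have [poisson [gauss1 gauss2] iidZ iidTh indep] := data.
have summable := amplitude_square_summable (fine (m setT)) alpha02 poisson gauss1 gauss2.
have indepZ := rationally_independent (proj1 iidZ) frequencies_atomless.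
have sZ : forall k, sigma_RV (Z k) `<=` <<s AA >>.
  by apply: (@adapted (@Ordinal 5 3 isT)).
have sR : forall k, sigma_RV (Rk k : Omega -> measurableTypeR R) `<=` <<s AA >>.
  move=> k; apply/adaptedP; apply: measurable_amplitude; apply/adaptedP.
  - exact: (@adapted (@Ordinal 5 0 isT) (fun k => Gam k)).
  - exact: (@adapted (@Ordinal 5 1 isT) (fun k => G1 k)).
  - exact: (@adapted (@Ordinal 5 2 isT) (fun k => G2 k)).
have mXs : measurable_fun setT (fun u : Omega * measurableTypeR R => X u.2 u.1).
  pose swap (u : Omega * measurableTypeR R) : measurableTypeR R * Omega := (u.2, u.1).
  have mswap : measurable_fun setT swap.
    by apply/measurable_fun_pairP; split; [exact: measurable_snd|exact: measurable_fst].
  exact: (measurableT_comp mX mswap).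
have control k : {ae P, forall w, forall n0, exists2 n, (n0 <= n)%N &
    forall N, ~ excess N k.+1%:R^-1 (fun t => X t w - partial_sum Th Z Rk n w t)}.
  apply: (@tail_control _ _ _ P AA Th Z Rk _ _ _ _ _ _ _ sZ sR (fun w t => X t w) mXs) => //.
  - exact: grouped_measurable.
  - exact: grouped_setI.
  - exact: grouped_setT.
  - by case: iidTh.
  - by move=> A B; apply: (grouped_indep mF indep).
  - by case: iidTh.
near=> w => phi y.
apply: (@time_mean_path _ (Z ^~ w) (Rk ^~ w) (Th ^~ w)).
- by near: w.
- by near: w.
- exact: path_measurable.
- move=> lam lam0 n0.
  have [k klam] : exists k, k.+1%:R^-1 <= lam.
    have [k _ /(_ k (leqnn k)) kl] := near_infty_natSinv_lt (PosNum lam0).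
    by exists k; exact: ltW.
  have : forall k n0, exists2 n, (n0 <= n)%N &
    forall N, ~ excess N k.+1%:R^-1 (fun t => X t w - partial_sum Th Z Rk n w t).
    by near: w; exact: ae_foralln.
  move=> /(_ k n0)[n n0n nex]; exists n => // N exN; apply: (nex N).
  exact: excess_lower exN.
Unshelve. all: by end_near. Qed.

End harmonizable_paths.

Unset Implicit Arguments.

Theorem corollary1 (R : realType) (d : measure_display)
    (Omega : measurableType d) (P : probability Omega R)
    (alpha : R) (m : {finite_measure set (measurableTypeR R) -> \bar R})
    (f : R -> R) (X : R -> Omega -> R)
    (Gam G1 G2 Z Th : nat -> {RV P >-> measurableTypeR R}) :
  0 < alpha < 2 ->
  measurable_fun setT f -> (forall x, 0 <= f x) -> (forall x, f (- x) = f x) ->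
  (forall A : set R, measurable A ->
     m A = (\int[lebesgue_measure]_(x in A) (f x)%:E)%E) ->
  m setT = 1%E ->
  measurable_fun setT (fun tw : measurableTypeR R * Omega => X tw.1 tw.2) ->
  SRH_SaS P alpha m X ->
  series_data P m Gam G1 G2 Z Th ->
  let Rk := amplitude alpha (fine (m setT)) Gam G1 G2 in
  (forall t : R, {ae P, forall w,
     series (fun k => Rk k w * cos (Th k w + t * Z k w)) @ \oo --> X t w}) ->
  (forall h : R -> R,
     lebesgue_measure.-integrable setT (EFin \o h) ->
     Cintegrable lebesgue_measure setT (Fourier h) ->
     (forall x : R, (h x)%:C =
        Cint lebesgue_measure setT (fun y : R => Fourier h y * cexpi (x * y))) ->
     {ae P, forall w, exists2 L : R,
        (T^-1 * Rintegral lebesgue_measure `[0, T] (fun tau : R => h (X tau w)))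
          @[T --> +oo] --> L &
        L%:C = Cint lebesgue_measure setT
          (fun y : R => Fourier h y * Cprod (fun k => J0 (y * Rk k w)))})
  /\
  (forall (h : R -> R) (p : R) (c : int -> R[i]),
     0 < p ->
     (forall x : R, h (x + p) = h x) ->
     (\esum_(n in [set: int]) (ComplexField.Normc.normc (c n))%:E < +oo)%E ->
     (forall x : R,
        (h x)%:C = Zsum (fun n => c n * cexpi (2 * pi / p * n%:~R * x))) ->
     {ae P, forall w, exists2 L : R,
        (T^-1 * Rintegral lebesgue_measure `[0, T] (fun tau : R => h (X tau w)))
          @[T --> +oo] --> L &
        L%:C = Zsum (fun n =>
          c n * Cprod (fun k => J0 (n%:~R * (2 * pi / p) * Rk k w)))}).
Proof.
move=> alpha02 mf f0 fsym density m1 mX srh data Rk seriesX.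
have mean_cos := mean_cos_path alpha02 density mX data seriesX.
have meanE (g : R -> R) L : time_mean g L ->
    (T^-1 * Rintegral lebesgue_measure `[0, T] g) @[T --> +oo] --> L.
  rewrite /time_mean /interval_avg => gL.
  by under eq_fun => T do rewrite -[T in T^-1]subr0.
split=> [h _ iF hF|h p c _ _ sc hS]; apply: filterS mean_cos => w wmean.
  have [L hL LE] := time_mean_inversion (path_measurable mX w) wmean iF hF.
  exists L; first exact: meanE.
  rewrite LE; congr (Cint _ _ _); apply/funext => y.
  by rewrite -(Cprod_J0 (Rk ^~ w)).
have [L hL LE] := time_mean_fourier_series (path_measurable mX w) wmean sc hS.
exists L; first exact: meanE.
rewrite LE; congr Zsum; apply/funext => n.
by rewrite -(Cprod_J0 (Rk ^~ w)) [_ * n%:~R]mulrC.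
Qed.
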